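(* Every set $\Lambda$ generated by the product construction (over $\mathbb{Z}$ or over $\mathbb{Z}[\omega]$) is a lattice. Moreover, there exists a sequence of lattices generated by the product construction, of dimension $N\to\infty$ (where $L$, the primes, and the linear codes may depend on $N$), that is simultaneously good for MSE quantization and Poltyrev-good under multistage decoding.
   Context: **Product construction.** Over $\mathbb{Z}$: let $p_1,\ldots,p_L$ be distinct rational primes, $q=\prod_l p_l$, and let $\mathcal{M}:\mathbb{F}_{p_1}\times\cdots\times\mathbb{F}_{p_L}\to\mathbb{Z}/q\mathbb{Z}$ be a ring isomorphism, where elements of $\mathbb{Z}/q\mathbb{Z}$ are identified with a fixed set of minimum-energy (smallest absolute value) coset representatives in $\mathbb{Z}$. For each $l$ let $C^l\subseteq\mathbb{F}_{p_l}^N$ be a linear code $\{\mathbf{G}_l\mathbf{w}:\mathbf{w}\in\mathbb{F}_{p_l}^{m^l}\}$ with $\mathbf{G}_l$ an $N\times m^l$ matrix over $\mathbb{F}_{p_l}$. Let $\Lambda^*=\mathcal{M}(C^1,\ldots,C^L)=\{\mathcal{M}(\mathbf{c}^1,\ldots,\mathbf{c}^L):\mathbf{c}^l\in C^l\}$, with $\mathcal{M}$ applied coordinatewise, and $\Lambda=\Lambda^*+\Lambda'$ with $\Lambda'=q\mathbb{Z}^N$. Over $\mathbb{Z}[\omega]$ ($\omega=-\frac12+j\frac{\sqrt3}{2}$): the same with $\mathbb{Z}$ replaced by $\mathbb{Z}[\omega]$, $p_l$ in the modulus replaced by relatively prime distinct Eisenstein primes $\phi_l$, $\mathbb{F}_{p_l}$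 replaced by $\mathbb{F}_{q_l}$ with $q_l=|\phi_l|^2$, and $\Lambda'=\big(\prod_l\phi_l\big)\mathbb{Z}[\omega]^N$; then $\Lambda\subset\mathbb{C}^N\cong\mathbb{R}^{2N}$. Lattices are considered up to scaling. **Lattice.** A lattice is a discrete subgroup of $\mathbb{R}^n$ (here $n=N$ over $\mathbb{Z}$, $n=2N$ over $\mathbb{Z}[\omega]$). $\mathcal{V}_\Lambda$ denotes the fundamental Voronoi region (the points whose nearest lattice point is $\mathbf{0}$), $\sigma^2(\Lambda)=\frac{1}{n\,\mathrm{Vol}(\mathcal{V}_\Lambda)}\int_{\mathcal{V}_\Lambda}\|\mathbf{x}\|^2d\mathbf{x}$, and $G(\Lambda)=\sigma^2(\Lambda)/\mathrm{Vol}(\mathcal{V}_\Lambda)^{2/n}$. **Good for MSE quantization.** A sequence of lattices with $n\to\infty$ is good for MSE quantization if $G(\Lambda)\to\frac{1}{2\pi e}$. **Poltyrev-good under multistage decoding.** Consider the unconstrained channel $\mathbf{Y}=\mathbf{X}+\mathbf{Z}$, $\mathbf{X}\in\Lambda$ arbitrary, $\mathbf{Z}$ having i.i.d. $\mathcal{N}(0,\eta^2)$ real components. The sequence of lattices (scaled so that $\mathrm{Vol}(\mathcal{V}_\Lambda)^{2/n}$ is a constant) is Poltyrev-good under multistage decoding if, whenever $\eta^2<\mathrm{Vol}(\mathcal{V}_\Lambda)^{2/n}/(2\pi e)$, the probability that the multistage decoder does not output $\mathbf{X}$ tends to $0$ as $n\to\infty$. **Multistage decoding.** Each $\mathbf{X}\in\Lambda$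 is $\mathcal{M}(\mathbf{c}^1,\ldots,\mathbf{c}^L)+\lambda'$ with $\mathbf{c}^l\in C^l$, $\lambda'\in\Lambda'$ (up to the common scaling). For $l=1,\ldots,L$ successively, the decoder takes $\hat{\mathbf{c}}^l$ to be an element $\mathbf{c}\in C^l$ maximizing the likelihood of $\mathbf{Y}\bmod\Lambda'$ when the words at levels $1,\ldots,l-1$ are assumed to be the already decoded $\hat{\mathbf{c}}^1,\ldots,\hat{\mathbf{c}}^{l-1}$, the word at level $l$ is $\mathbf{c}$, and the words at levels $l+1,\ldots,L$ are treated as unknown, i.e. independent and uniform over all length-$N$ vectors over the respective fields (not only codewords). Finally, with $\hat{\mathbf{s}}=\mathcal{M}(\hat{\mathbf{c}}^1,\ldots,\hat{\mathbf{c}}^L)$, it outputs $\hat{\mathbf{s}}$ plus the point of $\Lambda'$ nearest to $\mathbf{Y}-\hat{\mathbf{s}}$. *)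

(* Defs.v *)
From HB Require Import structures.
From mathcomp Require Import all_boot all_order all_algebra ring.
From mathcomp Require Import all_classical all_reals all_analysis.
Import numFieldNormedType.Exports.
Import Order.TTheory GRing.Theory Num.Theory.

Set Implicit Arguments.
Unset Strict Implicit.
Unset Printing Implicit Defensive.

Local Open Scope classical_set_scope.
Local Open Scope ring_scope.

Section PowerMeasure.
Context d (T : measurableType d) (R : realType).

Definition tcons n (p : T * n.-tuple T) : n.+1.-tuple T :=
  [the n.+1.-tuple T of p.1 :: p.2].

Lemma measurable_tcons n : measurable_fun [set: T * n.-tuple T] (@tcons n).
Proof. exact: (measurable_cons measurable_fst measurable_snd). Qed.

Section Step.
Variables (n : nat) (mu : {sigma_finite_measure set T -> \bar R})
  (nu : {sigma_finite_measure set (n.-tuple T) -> \bar R}).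

Definition power_step : set (n.+1.-tuple T) -> \bar R :=
  pushforward (mu \x nu)%E (@tcons n).

Let power_step0 : power_step set0 = 0%E.
Proof. by rewrite /power_step /pushforward preimage_set0 measure0. Qed.

Let power_step_ge0 A : (0 <= power_step A)%E.
Proof. by rewrite /power_step /pushforward; exact: measure_ge0. Qed.

Let power_step_additive : semi_sigma_additive power_step.
Proof.
move=> F mF tF mUF; rewrite /power_step /pushforward preimage_bigcup.
apply: measure_semi_sigma_additive.
- by move=> k; rewrite -[X in measurable X]setTI; exact: measurable_tcons.
- apply/trivIsetP => /= i j _ _ ij; rewrite -preimage_setI.
  by move/trivIsetP : tF => /(_ _ _ _ _ ij) ->//; rewrite preimage_set0.
- by rewrite -preimage_bigcup -[X in measurable X]setTI; exact: measurable_tcons.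
Qed.

HB.instance Definition _ := isMeasure.Build _ _ _ power_step
  power_step0 power_step_ge0 power_step_additive.

Let power_step_sigma_finite : sigma_finite setT power_step.
Proof.
have /sigma_finiteP[F [TF ndF Foo]] := sigma_finiteT mu.
have /sigma_finiteP[G [TG ndG Goo]] := sigma_finiteT nu.
pose g (t : n.+1.-tuple T) : T * n.-tuple T := (thead t, [tuple of behead t]).
have mg : measurable_fun setT g.
  apply/measurable_fun_pairP; split; last exact: measurable_behead.
  exact: measurable_tnth.
have gK : cancel (@tcons n) g.
  by move=> [x t]; rewrite /g /tcons; congr pair; apply/val_inj.
exists (fun k => g @^-1` (F k `*` G k)).
  rewrite -preimage_bigcup (_ : \bigcup_k (F k `*` G k) = setT) //.
  rewrite -setXTT TF TG predeqE => -[x y]; split.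
    by move=> [k _ []/= ? ?]; split; exists k.
  move=> [/= [k _ Fkx] [l _ Gly]]; exists (maxn k l) => //; split.
  - by move: x Fkx; exact/subsetPset/ndF/leq_maxl.
  - by move: y Gly; exact/subsetPset/ndG/leq_maxr.
move=> k; have [? ?] := Foo k; have [? ?] := Goo k; split.
  by rewrite -[X in measurable X]setTI; apply: mg => //; exact: measurableX.
rewrite /power_step /pushforward -comp_preimage.
rewrite (_ : g \o @tcons n = id); last by apply/funext => p /=; rewrite gK.
by rewrite preimage_id product_measure1E// lte_mul_pinfty// ge0_fin_numE.
Qed.

HB.instance Definition _ := Measure_isSigmaFinite.Build _ _ _ power_step
  power_step_sigma_finite.

End Step.

(* The n-fold product measure mu x ... x mu on T^n. *)
Fixpoint power_measure (mu : {sigma_finite_measure set T -> \bar R}) n :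
    {sigma_finite_measure set (n.-tuple T) -> \bar R} :=
  if n is n'.+1 return {sigma_finite_measure set (n.-tuple T) -> \bar R}
  then power_step mu (power_measure mu n') else \d_[tuple].

End PowerMeasure.

(* [Eis a b] is the Eisenstein integer a + b w, where w ^ 2 = - 1 - w. *)
Record eisenstein_int := Eis { eis_re : int; eis_om : int }.

Definition eis_pair (z : eisenstein_int) := (eis_re z, eis_om z).
Definition pair_eis (p : int * int) := Eis p.1 p.2.
Lemma eis_pairK : cancel eis_pair pair_eis. Proof. by case. Qed.

HB.instance Definition _ := Choice.copy eisenstein_int (can_type eis_pairK).

Definition eis_zero := Eis 0 0.
Definition eis_opp (x : eisenstein_int) := Eis (- eis_re x) (- eis_om x).
Definition eis_add (x y : eisenstein_int) :=
  Eis (eis_re x + eis_re y) (eis_om x + eis_om y).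
Definition eis_one := Eis 1 0.
Definition eis_mul (x y : eisenstein_int) :=
  Eis (eis_re x * eis_re y - eis_om x * eis_om y)
      (eis_re x * eis_om y + eis_om x * eis_re y - eis_om x * eis_om y).

Lemma eis_addA : associative eis_add.
Proof. by move=> [a b] [c d] [e f]; rewrite /eis_add /= !addrA. Qed.
Lemma eis_addC : commutative eis_add.
Proof. by move=> [a b] [c d]; congr Eis; rewrite /= addrC. Qed.
Lemma eis_add0 : left_id eis_zero eis_add.
Proof. by move=> [a b]; rewrite /eis_add /= !add0r. Qed.
Lemma eis_addN : left_inverse eis_zero eis_opp eis_add.
Proof. by move=> [a b]; rewrite /eis_add /= !addNr. Qed.

HB.instance Definition _ := GRing.isZmodule.Build eisenstein_int
  eis_addA eis_addC eis_add0 eis_addN.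

Lemma eis_mulA : associative eis_mul.
Proof. by move=> [a b] [c d] [e f]; rewrite /eis_mul /=; congr Eis; ring. Qed.
Lemma eis_mulC : commutative eis_mul.
Proof. by move=> [a b] [c d]; rewrite /eis_mul /=; congr Eis; ring. Qed.
Lemma eis_mul1 : left_id eis_one eis_mul.
Proof. by move=> [a b]; rewrite /eis_mul /=; congr Eis; ring. Qed.
Lemma eis_mulDl : left_distributive eis_mul +%R.
Proof. by move=> [a b] [c d] [e f]; congr Eis; rewrite /=; ring. Qed.
Lemma eis_one_neq0 : eis_one != 0. Proof. by []. Qed.

HB.instance Definition _ := GRing.Zmodule_isComNzRing.Build eisenstein_int
  eis_mulA eis_mulC eis_mul1 eis_mulDl eis_one_neq0.

(* |a + b w| ^ 2 *)
Definition eis_norm (z : eisenstein_int) : nat :=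
  `|(eis_re z ^+ 2 - eis_re z * eis_om z + eis_om z ^+ 2)%R|%N.

Section Divisibility.
Variable D : comNzRingType.
Implicit Types x y : D.

Definition ring_dvd x y := exists z, y = z * x.
Definition ring_unit x := ring_dvd x 1.

Definition ring_prime x := [/\ x <> 0, ~ ring_unit x &
  forall y z, ring_dvd x (y * z) -> ring_dvd x y \/ ring_dvd x z].

Definition ring_coprime x y :=
  forall z, ring_dvd z x -> ring_dvd z y -> ring_unit z.

End Divisibility.

Definition rational_primes L (p : 'I_L -> int) :=
  (forall l, exists2 k : nat, prime k & p l = k%:Z) /\ injective p.

Definition eisenstein_primes L (phi : 'I_L -> eisenstein_int) :=
  [/\ forall l, ring_prime (phi l), injective phi &
      forall i j, i != j -> ring_coprime (phi i) (phi j)].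

Section BaseRing.
Variable R : realType.

(* [bnorm] plays two roles: it is the cardinality of the residue field of a
   prime, and, being |.| over Z and |.| ^ 2 over Z[w], it orders the elements
   of the ring by energy. *)
Record base_ring := BaseRing {
  carrier :> comNzRingType;
  bnorm : carrier -> nat;
  admissible_primes : forall L, ('I_L -> carrier) -> Prop;
  bdim : nat;
  embed : carrier -> 'rV[R]_bdim }.

Definition int_base := BaseRing absz rational_primes
  (fun z : int => \row_(_ < 1) (z%:~R : R)).

(* The coordinates are the real and imaginary parts of a + b w, with
   w = - 1 / 2 + i sqrt 3 / 2. *)
Definition eisenstein_base := BaseRing eis_norm eisenstein_primes
  (fun z : eisenstein_int => \row_(j < 2)
    if j == 0 then (eis_re z)%:~R - (eis_om z)%:~R / 2 : R
    else (eis_om z)%:~R * (Num.sqrt 3 / 2)).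

End BaseRing.

Inductive base_kind := Integers | EisensteinIntegers.

Definition base_of (R : realType) (b : base_kind) : base_ring R :=
  match b with
  | Integers => int_base R
  | EisensteinIntegers => eisenstein_base R
  end.

Definition congr_mod (D : comNzRingType) (q x y : D) := ring_dvd q (x - y).

(* The map to D composed with reduction modulo q is a ring isomorphism
   \prod_l F l -> D / q D. *)
Definition ring_iso_mod (D : comNzRingType) (q : D) (I : Type)
    (F : I -> finFieldType) (M : (forall l, F l) -> D) : Prop :=
  (congr_mod q (M (fun=> 1)) 1) /\
  (forall x y, congr_mod q (M (fun l => x l + y l)) (M x + M y)) /\
  (forall x y, congr_mod q (M (fun l => x l * y l)) (M x * M y)) /\
  (forall x y, congr_mod q (M x) (M y) -> x = y) /\
  (forall z, exists x, congr_mod q (M x) z).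

Record product_data (R : realType) (B : base_ring R) (N : nat) := ProductData {
  levels : nat;
  levels_gt0 : (0 < levels)%N;
  primes_of : 'I_levels -> B;
  primes_ofP : admissible_primes primes_of;
  residue_field : 'I_levels -> finFieldType;
  card_residue_field : forall l, #|residue_field l| = bnorm (primes_of l);
  mapM : (forall l, residue_field l) -> B;
  mapM_iso : ring_iso_mod (\prod_l primes_of l) mapM;
  mapM_min_energy : forall x z,
    congr_mod (\prod_l primes_of l) (mapM x) z ->
    (bnorm (mapM x) <= bnorm z)%N;
  code_dim : 'I_levels -> nat;
  generator : forall l, 'M[residue_field l]_(N, code_dim l) }.

Arguments levels {R B N} p.
Arguments primes_of {R B N} p l.
Arguments residue_field {R B N} p l.
Arguments mapM {R B N} p _.
Arguments code_dim {R B N} p l.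
Arguments generator {R B N} p l.

Section Construction.
Variables (R : realType) (B : base_ring R) (N : nat) (P : product_data B N).

Definition modulus : B := \prod_l primes_of P l.

Definition linear_code l : {set 'cV[residue_field P l]_N} :=
  [set (generator P l *m w)%R | w in [set: 'cV[residue_field P l]_(code_dim P l)]]%SET.

Definition words := {dffun forall l : 'I_(levels P), 'cV[residue_field P l]_N}.

Definition map_words (c : words) : 'cV[B]_N :=
  \col_i mapM P (fun l => c l i 0).

Definition coarse_vectors : set 'cV[B]_N :=
  [set v | exists u : 'cV[B]_N, v = modulus *: u].

Definition product_vectors : set 'cV[B]_N :=
  [set v | exists c : words, (forall l, c l \in linear_code l) /\
     exists2 u, coarse_vectors u & v = map_words c + u].

Definition embed_vector (v : 'cV[B]_N) : 'rV[R]_(N * bdim B) :=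
  mxvec (\matrix_(i < N, j < bdim B) embed (v i 0) 0 j).

Definition product_lattice : set 'rV[R]_(N * bdim B) :=
  embed_vector @` product_vectors.

End Construction.
Arguments linear_code {R B N} P l.

Section Lattices.
Variable R : realType.

Definition is_lattice n (L : set 'rV[R]_n) :=
  [/\ L 0, (forall x y, L x -> L y -> L (x - y)) & L `<=` isolated L].

Definition scale_set n (a : R) (L : set 'rV[R]_n) : set 'rV[R]_n :=
  [set a *: x | x in L].

Definition sqnorm n (x : 'rV[R]_n) : R := \sum_i x 0 i ^+ 2.

Definition voronoi n (L : set 'rV[R]_n) : set 'rV[R]_n :=
  [set x | forall y, L y -> sqnorm x <= sqnorm (x - y)].

Definition tuple_row n (t : n.-tuple R) : 'rV[R]_n := \row_i tnth t i.

Definition lebesgue_tuple n := power_measure (@lebesgue_measure R) n.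

Definition volume n (A : set 'rV[R]_n) : R :=
  fine (lebesgue_tuple n (@tuple_row n @^-1` A)).

Definition second_moment n (L : set 'rV[R]_n) : R :=
  (\int[lebesgue_tuple n]_(t in @tuple_row n @^-1` voronoi L) sqnorm (tuple_row t))
  / (n%:R * volume (voronoi L)).

Definition normalized_volume n (L : set 'rV[R]_n) : R :=
  volume (voronoi L) `^ (2 / n%:R).

Definition normalized_second_moment n (L : set 'rV[R]_n) : R :=
  second_moment L / normalized_volume L.

Definition good_for_MSE (n : nat -> nat) (L : forall k, set 'rV[R]_(n k)) :=
  normalized_second_moment (L k) @[k --> \oo] --> (2 * pi * expR 1)^-1.

(* The law on R^n of a vector with i.i.d. N(0, eta ^ 2) components
   ([normal_prob] is parametrised by the standard deviation). *)
Definition gaussian_noise n (eta : R) : set 'rV[R]_n -> \bar R :=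
  fun A => power_measure (normal_prob 0 eta) n (@tuple_row n @^-1` A).

Definition gaussian_density n (eta : R) (z : 'rV[R]_n) : R :=
  \prod_i normal_pdf 0 eta (z 0 i).

End Lattices.

(* Multistage decoding for the product lattice scaled by [a], with noise of
   standard deviation [eta]. *)
Section MultistageDecoding.
Variables (R : realType) (B : base_ring R) (N : nat) (P : product_data B N).
Variables (a eta : R).

Let pt (v : 'cV[B]_N) : 'rV[R]_(N * bdim B) := a *: embed_vector v.

(* The density at y of Y mod Lambda' when X lies in the coset of s: the
   Gaussian density folded along Lambda'. *)
Definition folded_density (y : 'rV[R]_(N * bdim B)) (s : 'cV[B]_N) : \bar R :=
  (\esum_(u in coarse_vectors P) (gaussian_density eta (y - pt (s + u)))%:E)%E.

Definition compatible (l : 'I_(levels P)) (prev : words P)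
    (c : 'cV[residue_field P l]_N) : {set words P} :=
  [set w : words P | [forall j : 'I_(levels P), (j < l)%N ==> (w j == prev j)]
                     & w l == c]%SET.

(* The words at the levels above l range uniformly over all vectors; this only
   depends on the entries of [prev] at the levels below l. *)
Definition level_likelihood (y : 'rV[R]_(N * bdim B)) (l : 'I_(levels P))
    (prev : words P) (c : 'cV[residue_field P l]_N) : \bar R :=
  ((#|compatible prev c|%:R^-1)%:E *
   \sum_(w in compatible prev c) folded_density y (map_words w))%E.

Definition decoded_words (y : 'rV[R]_(N * bdim B)) (chat : words P) : Prop :=
  forall l, chat l \in linear_code P l /\
    forall c, c \in linear_code P l ->
      (level_likelihood y chat c <= level_likelihood y chat (chat l))%E.

(* [xhat] is an output of the decoder for some way of breaking the ties in the
   maximum likelihood and nearest point steps. *)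
Definition decoder_output (y xhat : 'rV[R]_(N * bdim B)) : Prop :=
  exists2 chat, decoded_words y chat &
  exists2 u, coarse_vectors P u &
    xhat = pt (map_words chat + u) /\
    forall v, coarse_vectors P v ->
      sqnorm (y - pt (map_words chat + u)) <=
      sqnorm (y - pt (map_words chat + v)).

(* Ties are counted as errors. *)
Definition error_probability (x : 'rV[R]_(N * bdim B)) : \bar R :=
  gaussian_noise eta
    [set z | exists2 xhat, decoder_output (x + z) xhat & xhat <> x].

End MultistageDecoding.

Definition poltyrev_good (R : realType) (B : base_ring R) (N : nat -> nat)
    (P : forall k, product_data B (N k)) : Prop :=
  exists (a : nat -> R) (c : R),
  let L k := scale_set (a k) (product_lattice (P k)) in
  [/\ forall k, 0 < a k, 0 < c, forall k, normalized_volume (L k) = c &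
      forall eta : R, 0 < eta -> eta ^+ 2 < c / (2 * pi * expR 1) ->
      forall x : (forall k, 'rV[R]_(N k * bdim B)), (forall k, L k (x k)) ->
        error_probability (P k) (a k) eta (x k) @[k --> \oo] --> 0%E].

(* Main.v *)
(* The good lattices have a single level: Construction A with a random linear
   code of length N = 4 m and dimension m over the residue field of a rational
   prime p of order m ^ 4, inert in Z[w] in the Eisenstein case, so that
   Lambda' = p Z^N or p Z[w]^N.

   No ball volumes are used, only Gaussian functions.  Any lattice has
   G >= 1 / (2 pi e) by Gibbs' inequality for the uniform law on the Voronoi
   region.  Conversely, restrict a Gaussian density to the shell where |x|^2 is
   close to its mean and sum its translates over the lattice.  For a random code
   the first two moments of this sum over a fundamental domain of Lambda' are
   controlled by a pairwise independence argument, in which the exact lattice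
   sums of Z^N or Z[w]^N are bounded by exp(s n) times their mean; by Chebyshev
   all but a small fraction of the points are within the shell radius of the
   lattice, and the others are within p sqrt n of it.

   With one level the multistage decoder is the maximum likelihood decoder for
   Lambda modulo Lambda'.  If it fails then either the noise is atypically long,
   or the density at the noise is at most the sum of the densities at its
   translates by the points of Lambda outside Lambda'; the latter event is
   handled by a Bhattacharyya bound, averaged over the code.  A code that is good
   for both criteria exists since the sum of the two averages tends to 0. *)
Require Import Defs.
From HB Require Import structures.
From mathcomp Require Import all_boot all_order all_algebra.
From mathcomp Require Import ring lra finmap.
From mathcomp Require Import all_fingroup all_solvable all_field.
From mathcomp Require Import all_classical all_reals all_analysis.
From mathcomp Require Import measurable_realfun.
Import numFieldNormedType.Exports HBNNSimple.
Import Order.TTheory GRing.Theory Num.Theory.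
Set Implicit Arguments.
Unset Strict Implicit.
Unset Printing Implicit Defensive.
Local Open Scope classical_set_scope.
Local Open Scope ring_scope.

(** * Product measures *)

(** The code rate and the size of p balance three demands. At rate 1 / 4 the normalized volume W of
    the lattice is of order p^(3/2). Gaussian sums over the unscaled Z^N or Z[w]^N lose a factor
    exp(c n / W), so n / W must tend to 0, and a fixed p would not do. The nonzero points of Lambda'
    have length at least p, and both the shells and the typical noise, of squared radius of order n
    W, must stay well within this distance: n must be small against sqrt p. Finally an uncovered
    point may be p sqrt n away from the lattice, so the uncovered fraction must be small against W /
    p^2, of order 1 / sqrt p; the errors that make it up are n / W and terms exponentially small in
    n, and p of order n^4 leaves room for all three.

    Poltyrev-goodness concerns every noise level below the limit, whereas the lattice is chosen
    beforehand. The union bound is arranged to be monotone in the noise level, so that a code chosen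
    for the largest admissible level serves all smaller ones; a diagonal sequence then lets this
    level tend to the limit. *)

Section TupleMeasure.
Context d (T : measurableType d) (R : realType).
Variable mu : {sigma_finite_measure set T -> \bar R}.
Local Open Scope ereal_scope.

Lemma ge0_integral_power_measure n (f : n.+1.-tuple T -> \bar R) :
  measurable_fun [set: n.+1.-tuple T] f -> (forall t, 0 <= f t) ->
  \int[power_measure mu n.+1]_t f t =
  \int[mu]_x \int[power_measure mu n]_t f (tcons (x, t)).
Proof.
move=> mf f0.
have mt : measurable_fun [set: T * n.-tuple T] (@tcons _ T n).
  exact: measurable_tcons.
rewrite /= [LHS](_ : _ =
  \int[pushforward (mu \x power_measure mu n) (@tcons _ T n)]_t f t)//.
rewrite ge0_integral_pushforward//= preimage_setT.
rewrite fubini_tonelli1//.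
exact: measurableT_comp.
Qed.

(** No measurability is assumed: the integral of a nonnegative function is a supremum over the
    simple functions below it. *)
Lemma le_integral_pointwise (nu : {measure set T -> \bar R})
    (f g : T -> \bar R) :
  (forall x, 0 <= f x) -> (forall x, f x <= g x) ->
  \int[nu]_x f x <= \int[nu]_x g x.
Proof.
move=> f0 fg.
have g0 x : 0 <= g x by exact: le_trans (f0 x) (fg x).
rewrite !ge0_integralTE//; apply: le_ereal_sup => _ [h hf <-].
by exists h => // x; exact: le_trans (hf x) (fg x).
Qed.

(** The sets need not be measurable. This is how the error event of the decoder, whose measurability
    is never established, is compared with measurable events. *)
Lemma power_measure_monotone n (A B : set (n.-tuple T)) : A `<=` B ->
  power_measure mu n A <= power_measure mu n B.
Proof.
elim: n A B => [|n IH] A B AB.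
  rewrite /= /dirac !indicE lee_fin.
  have [|] := boolP ([tuple] \in A) => //; rewrite inE => /AB BA.
  by rewrite mem_set.
rewrite /= /power_step /pushforward /product_measure1.
apply: le_integral_pointwise => x; first exact: measure_ge0.
apply: IH => t /=; rewrite /xsection /= !inE; exact: AB.
Qed.

End TupleMeasure.

Section Density.
Context d (T : measurableType d) (R : realType).
Variables (mu nu : {measure set T -> \bar R}) (g : T -> R).
Hypothesis mg : measurable_fun setT g.
Hypothesis g0 : forall x, 0 <= g x.
Hypothesis nuE : forall A, measurable A ->
  (nu A = \int[mu]_(x in A) (g x)%:E)%E.
Local Open Scope ereal_scope.

Lemma ge0_integral_density (f : T -> \bar R) :
  measurable_fun setT f -> (forall x, 0 <= f x) ->
  \int[nu]_x f x = \int[mu]_x ((g x)%:E * f x).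
Proof.
move=> mf f0.
have mgE : measurable_fun setT (EFin \o g) by exact/measurable_EFinP.
pose h := nnsfun_approx measurableT mf.
have cvgh x : (EFin \o h ^~ x) n @[n --> \oo] --> f x by apply: cvg_nnsfun_approx => // ? _; exact: f0.
have -> : \int[nu]_x f x = limn (fun n => \int[nu]_x (h n x)%:E).
  have fE x : f x = limn (fun n => (h n x)%:E) by apply/esym/cvg_lim; last exact: cvgh.
  under eq_integral => x _ do rewrite fE.
  apply: monotone_convergence => //.
  - by move=> n; exact/measurable_EFinP/measurable_funP.
  - by move=> n x _; rewrite lee_fin.
  - by move=> x _ a b ab; rewrite lee_fin; exact/lefP/nd_nnsfun_approx.
have -> : \int[mu]_x ((g x)%:E * f x) =
    limn (fun n => \int[mu]_x ((g x)%:E * (h n x)%:E)).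
  have fE x : (g x)%:E * f x = limn (fun n => (g x)%:E * (h n x)%:E).
    by apply/esym/cvg_lim => //; apply: cvgeZl => //; exact: cvgh.
  under eq_integral => x _ do rewrite fE.
  apply: monotone_convergence => //.
  - move=> n; apply: emeasurable_funM => //.
    exact/measurable_EFinP/measurable_funP.
  - by move=> n x _; rewrite mule_ge0 ?lee_fin.
  - move=> x _ a b ab; rewrite lee_wpmul2l ?lee_fin//.
    exact/lefP/nd_nnsfun_approx.
congr (limn _); apply/funext => n.
rewrite integralT_nnsfun sintegralE.
transitivity (\int[mu]_x \sum_(y \in range (h n))
    (g x)%:E * (y * \1_(h n @^-1` [set y]) x)%:E).
  rewrite ge0_integral_fsum//; last 2 first.
  - move=> y; apply: emeasurable_funM => //.
    by apply/measurable_EFinP; exact: measurable_funM.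
  - by move=> y x _; apply: mule_ge0; [rewrite lee_fin|exact: nnfun_muleindic_ge0].
  apply: eq_fsbigr => r /[!inE] -[t _ rE].
  have r0 : (0 <= r)%R by rewrite -rE.
  rewrite nuE//.
  under [in RHS]eq_integral do rewrite EFinM muleCA.
  rewrite ge0_integralZl//; last first.
  - by move=> x _; rewrite mule_ge0 ?lee_fin.
  - by apply: emeasurable_funM => //; exact/measurable_EFinP.
  congr (_ * _); rewrite integral_mkcond; apply: eq_integral => x _.
  rewrite patchE indicE; case: ifP => _; rewrite ?mule1 ?mule0//.
apply: eq_integral => x _.
rewrite [in RHS]fimfunE -fsumEFin// ge0_mule_fsumr// => y.
exact: nnfun_muleindic_ge0.
Qed.

End Density.

Section LebesgueTuple.
Variable R : realType.
Local Open Scope ereal_scope.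
Notation leb := (@lebesgue_measure R).

(** Both sides agree on half-open intervals, which determine Lebesgue measure. *)
Lemma lebesgue_measure_affine (a v : R) (A : set (measurableTypeR R)) :
  (0 < a)%R -> measurable A ->
  leb A = a%:E * pushforward leb (fun x : measurableTypeR R =>
     (a * x + v)%R : measurableTypeR R) A.
Proof.
move=> a0 mA.
pose f (x : measurableTypeR R) := (a * x + v)%R : measurableTypeR R.
have mf : measurable_fun setT f.
  by apply: measurable_funD => //; exact: measurable_funM.
pose m := mscale (NngNum (ltW a0))
  (measure_function_pushforward__canonical__measure_function_Measure leb mf).
apply: (@lebesgue_measure_unique R m) => //= _ [[x y]] _ <-.
rewrite /m /mscale /= /pushforward.
have -> : (f @^-1` `]x, y]%classic = `]((x - v) / a)%R, ((y - v) / a)%R]%classic)%classic.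
  apply/seteqP; split => z /=; rewrite !in_itv/= /f => /andP[xz zy];
    apply/andP; split; move: xz zy;
    by rewrite ?ltr_pdivrMr// ?ler_pdivlMr// ?ltrBlDr ?lerBrDr mulrC.
rewrite !lebesgue_measure_itv/= !lte_fin ltr_pM2r ?invr_gt0// ltrD2r.
case: ifPn => // xy; last by rewrite mule0.
by rewrite -!EFinD -EFinM -mulrBl mulrCA divff ?gt_eqF// mulr1; congr EFin; ring.
Qed.

Lemma ge0_integral_lebesgue_affine (a v : R) (f : R -> \bar R) : (0 < a)%R ->
  measurable_fun setT f -> (forall x, 0 <= f x) ->
  \int[leb]_x f x = a%:E * \int[leb]_x f (a * x + v)%R.
Proof.
move=> a0 mf f0.
pose g (x : measurableTypeR R) := (a * x + v)%R : measurableTypeR R.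
have mg : measurable_fun setT g.
  by apply: measurable_funD => //; exact: measurable_funM.
pose m := mscale (NngNum (ltW a0))
  (measure_function_pushforward__canonical__measure_function_Measure leb mg).
rewrite (@eq_measure_integral _ _ _ setT m); last first.
  move=> A mA _; exact: lebesgue_measure_affine.
rewrite ge0_integral_mscale//=; congr (_ * _).
by rewrite (ge0_integral_pushforward mg).
Qed.

Definition affine_tuple n (a : R) (v : 'I_n -> R) (t : n.-tuple R) : n.-tuple R :=
  [tuple (a * tnth t i + v i)%R | i < n].

Lemma measurable_affine_tuple n a v :
  measurable_fun setT (@affine_tuple n a v : n.-tuple (measurableTypeR R) -> n.-tuple (measurableTypeR R)).
Proof.
apply/(@measurable_fun_tnthP _ _ _ (measurableTypeR R)) => i.
rewrite (_ : _ \o _ = (fun t : n.-tuple (measurableTypeR R) => a * tnth t i + v i)%R).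
  apply: measurable_funD => //; apply: measurable_funM => //.
  exact: measurable_tnth.
by apply/funext => t /=; rewrite tnth_mktuple.
Qed.

Lemma affine_tuple_cons n a v (x : R) (t : n.-tuple R) :
  affine_tuple a v (tcons (x, t)) =
  tcons ((a * x + v ord0)%R, affine_tuple a (v \o lift ord0) t).
Proof.
apply: eq_from_tnth => i; rewrite tnth_mktuple.
case: (unliftP ord0 i) => [j|] ->; rewrite /tcons.
  by rewrite !tnthS tnth_mktuple.
by rewrite !tnth0.
Qed.

Lemma measurable_tcons_slice n (f : n.+1.-tuple (measurableTypeR R) -> \bar R)
    (x : measurableTypeR R) : measurable_fun setT f ->
  measurable_fun setT (fun t : n.-tuple _ => f (tcons (x, t))).
Proof.
move=> mf; apply: (measurableT_comp mf).
have -> : (fun t : n.-tuple (measurableTypeR R) => tcons (x, t)) = @tcons _ (measurableTypeR R) n \o pair x by [].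
apply: measurableT_comp; first exact: measurable_tcons.
exact: pair1_measurable.
Qed.

Lemma ge0_integral_lebesgue_tupleS n
    (f : n.+1.-tuple (measurableTypeR R) -> \bar R) :
  measurable_fun setT f -> (forall t, 0 <= f t) ->
  \int[lebesgue_tuple R n.+1]_t f t =
  \int[leb]_x \int[lebesgue_tuple R n]_t f (tcons (x, t)).
Proof. exact: ge0_integral_power_measure. Qed.

Lemma measurable_integral_lebesgue_tupleS n
    (f : n.+1.-tuple (measurableTypeR R) -> \bar R) :
  measurable_fun setT f -> (forall t, 0 <= f t) ->
  measurable_fun setT
   (fun x : measurableTypeR R => \int[lebesgue_tuple R n]_t f (tcons (x, t))).
Proof.
move=> mf f0.
apply: (@measurable_fun_fubini_tonelli_F _ _ _ _ _ (lebesgue_tuple R n)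
  (f \o @tcons _ (measurableTypeR R) n)).
- by apply: measurableT_comp => //; exact: measurable_tcons.
- by move=> t /=.
Qed.

Lemma ge0_integral_lebesgue_tuple0
    (f : 0.-tuple (measurableTypeR R) -> \bar R) :
  measurable_fun setT f ->
  \int[lebesgue_tuple R 0]_t f t = f [tuple].
Proof. by move=> mf; rewrite integral_dirac// diracT mul1e. Qed.

Lemma ge0_integral_affine_tuple n (a : R) (v : 'I_n -> R)
    (f : n.-tuple (measurableTypeR R) -> \bar R) : (0 < a)%R ->
  measurable_fun setT f -> (forall t, 0 <= f t) ->
  \int[lebesgue_tuple R n]_t f t =
  (a ^+ n)%:E * \int[lebesgue_tuple R n]_t f (affine_tuple a v t).
Proof.
move=> a0; elim: n v f => [|n IH] v f mf f0.
  rewrite !ge0_integral_lebesgue_tuple0//.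
    by rewrite expr0 mul1e; congr f; exact/esym/tuple0.
  by apply: measurableT_comp => //; exact: measurable_affine_tuple.
rewrite !ge0_integral_lebesgue_tupleS//; last first.
  by apply: measurableT_comp => //; exact: measurable_affine_tuple.
under [in RHS]eq_integral do under eq_integral do rewrite affine_tuple_cons.
rewrite [LHS](@ge0_integral_lebesgue_affine a (v ord0)
  (fun x => \int[lebesgue_tuple R n]_t f (tcons (x, t))) a0); last 2 first.
  exact: measurable_integral_lebesgue_tupleS.
  by move=> x; exact: integral_ge0.
rewrite exprS EFinM -muleA; congr (_ * _).
rewrite -ge0_integralZl//; last 3 first.
- pose g (t : n.+1.-tuple (measurableTypeR R)) := f (affine_tuple a v t).
  have mg : measurable_fun setT g.
    by apply: measurableT_comp => //; exact: measurable_affine_tuple.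
  have := measurable_integral_lebesgue_tupleS mg (fun t => f0 _).
  apply: eq_measurable_fun => x _.
  by apply: eq_integral => t _; rewrite /g affine_tuple_cons.
- by move=> x _; exact: integral_ge0.
- by rewrite lee_fin exprn_ge0// ltW.
apply: eq_integral => x _.
apply: (IH (v \o lift ord0) (fun t => f (tcons ((a * x + v ord0)%R, t)))) => //.
exact: measurable_tcons_slice.
Qed.

End LebesgueTuple.

(** * Sums over countable sets: measurability and exchange with integrals *)

Section CountableSums.
Context d (T : measurableType d) (R : realType) (E : choiceType).
Local Open Scope ereal_scope.

(** One enumeration serves every family [a], so results on series apply pointwise to sums of
    functions. The option type allows for an empty [E]. *)
Lemma countable_esumE (S : set E) : countable S ->
  exists (P : pred nat) (e : nat -> option E),
   (forall n, P n -> exists2 x, S x & e n = Some x) /\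
   forall a : E -> \bar R, (forall x, S x -> 0 <= a x) ->
     \esum_(x in S) a x =
     \sum_(n <oo) (if P n then oapp a 0 (e n) else 0).
Proof.
move=> /countable_bijP[B].
elim/choicePpointed: E => E' in S *.
  rewrite (_ : S = set0) ?emptyE// => _; exists xpred0, (fun=> None); split=> // a _.
  by rewrite esum_set0 eseries0//.
rewrite card_eq_sym => /pcard_eqP/unsquash f.
have fbij : set_bij B S f by exact: bij.
exists (mem B), (Some \o f); split.
  by move=> n /set_mem Bn; exists (f n) => //; exact: funS.
move=> a a0; rewrite (reindex_esum _ _ _ _ fbij) esum_mkcond.
rewrite -nneseries_esumT; first exact: eq_eseriesr.
by move=> n; case: ifPn => // /set_mem Bn; apply: a0; exact: funS.
Qed.

Variable mu : {measure set T -> \bar R}.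

Lemma measurable_esum (S : set E) (f : E -> T -> \bar R) : countable S ->
  (forall i, S i -> measurable_fun setT (f i)) ->
  (forall i x, S i -> 0 <= f i x) ->
  measurable_fun setT (fun x => \esum_(i in S) f i x).
Proof.
move=> /countable_esumE[P [e [eS h]]] mf f0.
have -> : (fun x => \esum_(i in S) f i x) =
    fun x => \sum_(n <oo) (if P n then oapp (f ^~ x) 0 (e n) else 0).
  by apply/funext => x; rewrite h// => i; exact: f0.
apply: (@ge0_emeasurable_sum _ _ _ setT
  (fun n x => if P n then oapp (f ^~ x) 0 (e n) else 0) xpredT) => [k x _ _|k _].
  by case: ifPn => // /eS[y Sy ->]; exact: f0.
by have [/eS[y Sy ->]|//] := boolP (P k); exact: mf.
Qed.

Lemma ge0_integral_esum (S : set E) (f : E -> T -> \bar R) : countable S ->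
  (forall i, S i -> measurable_fun setT (f i)) ->
  (forall i x, S i -> 0 <= f i x) ->
  \int[mu]_x (\esum_(i in S) f i x) = \esum_(i in S) \int[mu]_x f i x.
Proof.
move=> /countable_esumE[P [e [eS h]]] mf f0.
transitivity (\int[mu]_x
    \sum_(n <oo) (if P n then oapp (f ^~ x) 0 (e n) else 0)).
  by apply: eq_integral => x _; rewrite h// => i; exact: f0.
rewrite h; last by move=> i Si; apply: integral_ge0 => x _; exact: f0.
rewrite integral_nneseries//; last 2 first.
- by move=> n; have [/eS[y Sy ->]|//] := boolP (P n); exact: mf.
- by move=> n x _; case: ifPn => // /eS[y Sy ->]; exact: f0.
apply: eq_eseriesr => n _; have [/eS[y Sy ->]//|_] := boolP (P n).
by rewrite integral0.
Qed.

End CountableSums.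

(** * Product integrands, Gaussian noise and hyperplanes *)

Section TupleIntegrals.
Variable R : realType.
Local Open Scope ereal_scope.
Notation leb := (@lebesgue_measure R).
Notation mR := (measurableTypeR R).

Lemma measurable_tnth_comp n (i : 'I_n) (g : mR -> R) :
  measurable_fun setT g ->
  measurable_fun setT (fun t : n.-tuple mR => g (tnth t i)).
Proof. by move=> mg; apply: (measurableT_comp mg); exact: measurable_tnth. Qed.

Lemma measurable_tnth_prod n (g : 'I_n -> mR -> R) :
  (forall i, measurable_fun setT (g i)) ->
  measurable_fun setT (fun t : n.-tuple mR => \prod_(i < n) g i (tnth t i))%R.
Proof.
move=> mg.
apply: (@measurable_prod _ _ _ setT _ _ (fun i (t : n.-tuple mR) => g i (tnth t i))).
by move=> i _; exact: measurable_tnth_comp.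
Qed.

Lemma ge0_integral_tuple_prod n (g : 'I_n -> mR -> R) :
  (forall i, measurable_fun setT (g i)) -> (forall i x, (0 <= g i x)%R) ->
  \int[lebesgue_tuple R n]_t (\prod_(i < n) g i (tnth t i))%:E =
  \prod_(i < n) \int[leb]_x (g i x)%:E.
Proof.
elim: n g => [|n IH] g mg g0.
  rewrite ge0_integral_lebesgue_tuple0 ?big_ord0//.
  by apply/measurable_EFinP; apply: measurable_tnth_prod.
rewrite ge0_integral_lebesgue_tupleS; last 2 first.
- by apply/measurable_EFinP; apply: measurable_tnth_prod.
- by move=> t; rewrite lee_fin prodr_ge0.
rewrite big_ord_recl -IH// -ge0_integralZr//; last 3 first.
- exact/measurable_EFinP.
- by move=> x _; rewrite lee_fin.
- by apply: integral_ge0 => t _; rewrite lee_fin prodr_ge0.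
apply: eq_integral => x _.
rewrite -ge0_integralZl ?lee_fin//; last 2 first.
- by apply/measurable_EFinP; apply: (@measurable_tnth_prod n (fun i => g (lift ord0 i))).
- by move=> t _; rewrite lee_fin prodr_ge0.
apply: eq_integral => t _; rewrite -EFinM big_ord_recl; congr (_ * _)%:E%R.
by apply: eq_bigr => i _; rewrite /tcons tnthS.
Qed.

Lemma ge0_integral_power_normal n (eta : R) (f : n.-tuple mR -> \bar R) :
  measurable_fun setT f -> (forall t, 0 <= f t) ->
  \int[power_measure (normal_prob 0 eta) n]_t f t =
  \int[lebesgue_tuple R n]_t
    ((\prod_(i < n) normal_pdf 0 eta (tnth t i))%:E * f t).
Proof.
have mpdf := measurable_normal_pdf 0%R eta.
have pdf0 := normal_pdf_ge0 0%R eta.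
have mprod m : measurable_fun setT
    (fun t : m.-tuple mR => (\prod_(i < m) normal_pdf 0 eta (tnth t i))%:E)%R.
  apply/measurable_EFinP.
  exact: (@measurable_tnth_prod m (fun=> normal_pdf 0 eta)).
elim: n f => [|n IH] f mf f0.
  rewrite integral_dirac// ge0_integral_lebesgue_tuple0.
    by rewrite diracT big_ord0.
  by apply: emeasurable_funM => //; exact: mprod.
rewrite ge0_integral_power_measure//.
rewrite ge0_integral_lebesgue_tupleS; last 2 first.
- by apply: emeasurable_funM => //; exact: mprod.
- by move=> t; rewrite mule_ge0// lee_fin prodr_ge0.
transitivity (\int[normal_prob 0 eta]_x (\int[lebesgue_tuple R n]_t
    ((\prod_(i < n) normal_pdf 0 eta (tnth t i))%:E * f (tcons (x, t))))).
  apply: eq_integral => x _; rewrite IH//.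
  exact: measurable_tcons_slice.
have mF : measurable_fun setT (fun x : mR => \int[lebesgue_tuple R n]_t
    ((\prod_(i < n) normal_pdf 0 eta (tnth t i))%:E * f (tcons (x, t)))).
  pose h (t : n.+1.-tuple mR) :=
    (\prod_(i < n) normal_pdf 0 eta (tnth t (lift ord0 i)))%:E * f t.
  have mh : measurable_fun setT h.
    apply: emeasurable_funM => //; apply/measurable_EFinP.
    apply: (@measurable_prod _ _ _ setT _ _ (fun i (t : n.+1.-tuple mR) =>
      normal_pdf 0 eta (tnth t (lift ord0 i)))) => i _.
    exact: measurable_tnth_comp.
  have h0 t : 0 <= h t by rewrite mule_ge0// lee_fin prodr_ge0.
  have := measurable_integral_lebesgue_tupleS mh h0.
  apply: eq_measurable_fun => x _; apply: eq_integral => t _.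
  by congr (_%:E * _); apply: eq_bigr => i _; rewrite /tcons tnthS.
rewrite (@ge0_integral_density _ _ _ leb _ (normal_pdf 0 eta))//; last first.
  move=> x; apply: integral_ge0 => t _.
  by rewrite mule_ge0// lee_fin prodr_ge0.
apply: eq_integral => x _; rewrite -ge0_integralZl//; last 3 first.
- apply: emeasurable_funM; last exact: measurable_tcons_slice.
  exact: mprod.
- by move=> t _; rewrite mule_ge0// lee_fin prodr_ge0.
- by rewrite lee_fin.
apply: eq_integral => t _; rewrite muleA -EFinM big_ord_recl.
by congr ((_ * _)%R%:E * _); apply: eq_bigr => i _; rewrite /tcons tnthS.
Qed.

(** Slicing along the first coordinate: if a later coefficient is nonzero, every slice is null by
    induction; otherwise the equation fixes the first coordinate and at most one slice is
    nonempty. *)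
Lemma integral_hyperplane n (y : 'I_n -> R) (b : R) : (exists i, y i != 0)%R ->
  \int[lebesgue_tuple R n]_t
    (\1_[set t : n.-tuple mR | (\sum_(i < n) y i * tnth t i)%R = b] t)%:E = 0.
Proof.
elim: n y b => [|n IH] y b [i yi]; first by case: i yi.
have mlin m (z : 'I_m -> R) :
    measurable_fun setT (fun t : m.-tuple mR => \sum_(i < m) z i * tnth t i)%R.
  apply: (@measurable_sum _ _ _ setT _ _ (fun i (t : m.-tuple mR) => z i * tnth t i)%R) => j.
  by apply: measurable_funM => //; exact: measurable_tnth.
have mset m (z : 'I_m -> R) c :
    measurable [set t : m.-tuple mR | (\sum_(i < m) z i * tnth t i)%R = c].
  rewrite -[X in measurable X]setTI.
  exact: (mlin m z measurableT [set c] (measurable_set1 c)).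
rewrite ge0_integral_lebesgue_tupleS; last 2 first.
- by apply/measurable_EFinP; apply: measurable_indic; exact: mset.
- by move=> t; rewrite lee_fin.
have sumS x (t : n.-tuple mR) : (\sum_(i < n.+1) y i * tnth (tcons (x, t)) i =
    y ord0 * x + \sum_(i < n) y (lift ord0 i) * tnth t i)%R.
  by rewrite big_ord_recl; congr (_ + _)%R; apply: eq_bigr => j _; rewrite /tcons tnthS.
have [/existsP[j yj]|/existsPn yN] :=
    boolP [exists j : 'I_n, (y (lift ord0 j) != 0)%R].
  rewrite integral0_eq// => x _.
  rewrite -(IH (y \o lift ord0) (b - y ord0 * x)%R); last by exists j.
  apply: eq_integral => t _; rewrite !indicE; congr ((nat_of_bool _)%:R%:E)%R.
  by apply/idP/idP => /set_mem/= h; apply/mem_set => /=; move: h; rewrite sumS => h;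
    [rewrite -h; ring|rewrite h; ring].
have y0 : (y ord0 != 0)%R.
  case: (unliftP ord0 i) yi => [j|] -> // yj.
  by have := yN j; rewrite yj.
(* The right-hand side 0 is written as the integral over the only nonempty slice, a single value of
   the first coordinate. *)
rewrite -(integral_set1 (fun x : R => \int[lebesgue_tuple R n]_t
  (\1_[set t : n.+1.-tuple mR | (\sum_(i < n.+1) y i * tnth t i)%R = b]
     (tcons (x, t)))%:E) (b / y ord0)%R).
rewrite [RHS]integral_mkcond; apply: eq_integral => x _.
rewrite patchE; case: ifPn => // /negP xb; rewrite integral0_eq// => t _.
rewrite indicE memNset// => /=; rewrite sumS big1 ?addr0 => [h|j _].
  by apply: xb; apply/mem_set => /=; rewrite -h mulrAC divff ?mul1r.
by have /negbNE/eqP -> := yN j; rewrite mul0r.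
Qed.

End TupleIntegrals.

(** * Integration over row vectors *)

Section VectorIntegral.
Variable R : realType.
Local Notation mR := (measurableTypeR R).
Implicit Types n : nat.

(** Lattices live among row vectors and product measures on tuples; measurability and integrals are
    transported along [tuple_row]. *)
Definition vmeasurable n (h : 'rV[R]_n -> \bar R) :=
  measurable_fun [set: n.-tuple mR] (fun t => h (tuple_row t)).

Definition vmeasurable_set n (A : set 'rV[R]_n) :=
  measurable [set t : n.-tuple mR | A (tuple_row t)].

Definition vint n (h : 'rV[R]_n -> \bar R) : \bar R :=
  (\int[lebesgue_tuple R n]_t h (tuple_row t))%E.

Lemma tuple_row_affine n (a : R) (v : 'rV[R]_n) (t : n.-tuple R) :
  tuple_row (affine_tuple a (v 0) t) = a *: tuple_row t + v.
Proof. by apply/rowP => i; rewrite !mxE tnth_mktuple. Qed.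

Lemma vmeasurable_affine n (a : R) (v : 'rV[R]_n) h : vmeasurable h ->
  vmeasurable (fun x => h (a *: x + v)).
Proof.
move=> mh; rewrite /vmeasurable.
under eq_fun do rewrite -tuple_row_affine.
by apply: (measurableT_comp mh); exact: measurable_affine_tuple.
Qed.

Lemma vmeasurable_shift n (v : 'rV[R]_n) h : vmeasurable h ->
  vmeasurable (fun x => h (x + v)).
Proof.
move=> mh; have := vmeasurable_affine 1 v mh.
by rewrite /vmeasurable; under eq_fun do rewrite scale1r.
Qed.

Lemma ge0_vint_affine n (a : R) (v : 'rV[R]_n) (h : 'rV[R]_n -> \bar R) : 0 < a ->
  vmeasurable h -> (forall x, 0 <= h x)%E ->
  vint h = ((a ^+ n)%:E * vint (fun x => h (a *: x + v)%R))%E.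
Proof.
move=> a0 mh h0; rewrite /vint (ge0_integral_affine_tuple (v 0) a0)//.
congr (_ * _)%E; apply: eq_integral => t _.
by rewrite tuple_row_affine.
Qed.

Lemma ge0_vint_shift n (v : 'rV[R]_n) h :
  vmeasurable h -> (forall x, 0 <= h x)%E ->
  vint (fun x => h (x + v)) = vint h.
Proof.
move=> mh h0; rewrite [RHS](ge0_vint_affine v ltr01)// expr1n mul1e.
by apply: eq_integral => t _; rewrite scale1r.
Qed.

Lemma le_vint n (f g : 'rV[R]_n -> \bar R) :
  (forall x, 0 <= f x)%E -> (forall x, f x <= g x)%E -> (vint f <= vint g)%E.
Proof. by move=> f0 fg; apply: le_integral_pointwise. Qed.

Lemma eq_vint n (f g : 'rV[R]_n -> \bar R) : f =1 g -> vint f = vint g.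
Proof. by move=> /funext ->. Qed.

Lemma vint_ge0 n (f : 'rV[R]_n -> \bar R) :
  (forall x, 0 <= f x)%E -> (0 <= vint f)%E.
Proof. by move=> f0; apply: integral_ge0. Qed.

Lemma vintD n (f g : 'rV[R]_n -> \bar R) : vmeasurable f -> vmeasurable g ->
  (forall x, 0 <= f x)%E -> (forall x, 0 <= g x)%E ->
  vint (fun x => f x + g x)%E = (vint f + vint g)%E.
Proof. by move=> mf mg f0 g0; rewrite /vint ge0_integralD. Qed.

Lemma vintZ n (k : \bar R) (f : 'rV[R]_n -> \bar R) : vmeasurable f ->
  (forall x, 0 <= f x)%E -> (0 <= k)%E ->
  vint (fun x => k * f x)%E = (k * vint f)%E.
Proof. by move=> mf f0 k0; rewrite /vint ge0_integralZl. Qed.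

Lemma vint_esum n (E : choiceType) (S : set E) (f : E -> 'rV[R]_n -> \bar R) :
  countable S -> (forall i, S i -> vmeasurable (f i)) ->
  (forall i x, S i -> 0 <= f i x)%E ->
  vint (fun x => \esum_(i in S) f i x)%E = (\esum_(i in S) vint (f i))%E.
Proof.
move=> cS mf f0; rewrite /vint; apply: (@ge0_integral_esum _ _ _ _
  (lebesgue_tuple R n) S (fun i t => f i (tuple_row t))) => // i x Si; exact: f0.
Qed.

Lemma vmeasurable_esum n (E : choiceType) (S : set E)
    (f : E -> 'rV[R]_n -> \bar R) :
  countable S -> (forall i, S i -> vmeasurable (f i)) ->
  (forall i x, S i -> 0 <= f i x)%E ->
  vmeasurable (fun x => \esum_(i in S) f i x)%E.
Proof.
move=> cS mf f0; apply: (@measurable_esum _ _ _ _ S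
  (fun i (t : n.-tuple mR) => f i (tuple_row t))) => // i x Si; exact: f0.
Qed.

Lemma vint_sum n (I : Type) (s : seq I) (f : I -> 'rV[R]_n -> \bar R) :
  (forall i, vmeasurable (f i)) -> (forall i x, 0 <= f i x)%E ->
  vint (fun x => \sum_(i <- s) f i x)%E = (\sum_(i <- s) vint (f i))%E.
Proof. by move=> mf f0; rewrite /vint ge0_integral_sum. Qed.

Lemma vmeasurable_sum n (I : Type) (s : seq I) (f : I -> 'rV[R]_n -> \bar R) :
  (forall i, vmeasurable (f i)) ->
  vmeasurable (fun x => \sum_(i <- s) f i x)%E.
Proof.
by move=> mf; apply: (@emeasurable_sum _ _ _ setT _ _ (fun i t => f i (tuple_row t))).
Qed.

Lemma vmeasurableD n (f g : 'rV[R]_n -> \bar R) : vmeasurable f ->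
  vmeasurable g -> vmeasurable (fun x => f x + g x)%E.
Proof. by move=> mf mg; apply: emeasurable_funD. Qed.

Lemma vmeasurableM n (f g : 'rV[R]_n -> \bar R) : vmeasurable f ->
  vmeasurable g -> vmeasurable (fun x => f x * g x)%E.
Proof. by move=> mf mg; apply: emeasurable_funM. Qed.

Lemma vmeasurable_EFinM n (f g : 'rV[R]_n -> R) :
  vmeasurable (fun x => (f x)%:E) -> vmeasurable (fun x => (g x)%:E) ->
  vmeasurable (fun x => (f x * g x)%:E).
Proof. by move=> mf mg; apply: (vmeasurableM mf mg). Qed.

Lemma vmeasurable_cst n (k : \bar R) : vmeasurable (fun _ : 'rV[R]_n => k).
Proof. exact: measurable_cst. Qed.

Lemma vmeasurable_indic n (A : set 'rV[R]_n) : vmeasurable_set A ->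
  vmeasurable (fun x => (\1_A x)%:E).
Proof.
move=> mA; apply/measurable_EFinP.
rewrite (_ : (fun t => _) = \1_[set t : n.-tuple mR | A (tuple_row t)]).
  exact: measurable_indic.
by apply/funext => t; rewrite !indicE; congr ((nat_of_bool _)%:R); apply/idP/idP => /set_mem h; apply/mem_set.
Qed.

Lemma vint_indic n (A : set 'rV[R]_n) : vmeasurable_set A ->
  vint (fun x => (\1_A x)%:E) = lebesgue_tuple R n (@tuple_row R n @^-1` A).
Proof.
by move=> mA; rewrite /vint -[X in lebesgue_tuple R n X]setIT -integral_indic//.
Qed.

Lemma measurable_sqnorm n : measurable_fun [set: n.-tuple mR]
  (fun t => sqnorm (tuple_row t)).
Proof.
rewrite /sqnorm.
apply: (@measurable_sum _ _ _ setT _ _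
  (fun i (t : n.-tuple mR) => tuple_row t 0 i ^+ 2)) => i.
rewrite (_ : (fun t => _) = (fun t : n.-tuple mR => tnth t i ^+ 2)); last first.
  by apply/funext => t; rewrite mxE.
by apply: measurable_funX; exact: measurable_tnth.
Qed.

Lemma vmeasurable_sqnorm n : vmeasurable (fun x : 'rV[R]_n => (sqnorm x)%:E).
Proof. by apply/measurable_EFinP; exact: measurable_sqnorm. Qed.

Lemma vmeasurable_set_le n (f g : 'rV[R]_n -> \bar R) :
  vmeasurable f -> vmeasurable g -> vmeasurable_set [set x | f x <= g x]%E.
Proof.
move=> mf mg; rewrite /vmeasurable_set /= -[X in measurable X]setTI.
exact: emeasurable_fun_le.
Qed.

Lemma vmeasurable_setI n (A B : set 'rV[R]_n) : vmeasurable_set A ->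
  vmeasurable_set B -> vmeasurable_set (A `&` B).
Proof. exact: measurableI. Qed.

Lemma vmeasurable_setC n (A : set 'rV[R]_n) : vmeasurable_set A ->
  vmeasurable_set (~` A).
Proof. exact: measurableC. Qed.

Lemma vmeasurable_affine_set n (a : R) (v : 'rV[R]_n) (A : set 'rV[R]_n) :
  vmeasurable_set A -> vmeasurable_set [set x | A (a *: x + v)].
Proof.
move=> mA; rewrite /vmeasurable_set /=.
under eq_set do rewrite -tuple_row_affine.
have := @measurable_affine_tuple R n a (v 0).
by move=> /(_ measurableT _ mA); rewrite setTI.
Qed.

End VectorIntegral.

(** * Gaussian functions *)

Section Gauss.
Variable R : realType.
Local Notation mR := (measurableTypeR R).
Implicit Types (n : nat) (s : R).

Lemma sqnorm_ge0 n (x : 'rV[R]_n) : 0 <= sqnorm x.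
Proof. by apply: sumr_ge0 => i _; exact: sqr_ge0. Qed.

Lemma sqnormZ n a (x : 'rV[R]_n) : sqnorm (a *: x) = a ^+ 2 * sqnorm x.
Proof.
by rewrite /sqnorm mulr_sumr; apply: eq_bigr => i _; rewrite mxE exprMn.
Qed.

Lemma sqnormN n (x : 'rV[R]_n) : sqnorm (- x) = sqnorm x.
Proof. by rewrite -scaleN1r sqnormZ sqrrN expr1n mul1r. Qed.

Lemma sqnormC n (x y : 'rV[R]_n) : sqnorm (x - y) = sqnorm (y - x).
Proof. by rewrite -opprB sqnormN. Qed.

Lemma sqnorm_parallelogram n (x y : 'rV[R]_n) :
  sqnorm (x + y) + sqnorm (x - y) = 2 * sqnorm x + 2 * sqnorm y.
Proof.
rewrite /sqnorm !mulr_sumr -!big_split; apply: eq_bigr => i _ /=.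
by rewrite !mxE; ring.
Qed.

Lemma sqnorm_half n (z v : 'rV[R]_n) :
  sqnorm z + sqnorm (z - v) = 2 * sqnorm (z - 2^-1 *: v) + 2^-1 * sqnorm v.
Proof.
rewrite /sqnorm !mulr_sumr -!big_split; apply: eq_bigr => i _ /=.
by rewrite !mxE; field.
Qed.

Lemma sqnormB_le n (x y : 'rV[R]_n) :
  sqnorm (x - y) <= 2 * sqnorm x + 2 * sqnorm y.
Proof. by rewrite -sqnorm_parallelogram lerDr sqnorm_ge0. Qed.

(** The density of i.i.d. centred normal coordinates of variance 1 / (2 s). Products, shifts and
    tilts of Gaussians act simply on the parameter [s]. *)
Definition gauss n s (x : 'rV[R]_n) : R :=
  Num.sqrt (s / pi) ^+ n * expR (- s * sqnorm x).

Lemma gauss_ge0 n s (x : 'rV[R]_n) : 0 <= gauss s x.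
Proof. by rewrite mulr_ge0// ?expR_ge0// exprn_ge0// sqrtr_ge0. Qed.

Lemma vmeasurable_gauss n s : vmeasurable (fun x : 'rV[R]_n => (gauss s x)%:E).
Proof.
apply/measurable_EFinP; apply: measurable_funM => //.
apply: measurableT_comp => //; apply: measurable_funM => //.
exact: measurable_sqnorm.
Qed.

Lemma gaussian_densityE n (eta : R) (x : 'rV[R]_n) : 0 < eta ->
  gaussian_density eta x = gauss (2 * eta ^+ 2)^-1 x.
Proof.
move=> e0; rewrite /gaussian_density /gauss /sqnorm mulr_sumr expR_sum.
rewrite -[X in _ ^+ X](card_ord n) -prodr_const -big_split.
apply: eq_bigr => i _ /=; rewrite normal_pdfE ?gt_eqF// /normal_fun subr0.
congr (_ * expR _).
  rewrite /normal_peak -sqrtrV ?mulrn_wge0 ?mulr_ge0 ?pi_ge0 ?(ltW e0)//.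
  by congr Num.sqrt; rewrite -invfM; congr (_^-1); ring.
by rewrite !mulNr mulrC; congr (- (_^-1 * _)); ring.
Qed.

Lemma vint_gaussian_density n (eta : R) : 0 < eta ->
  vint (fun x : 'rV[R]_n => (gaussian_density eta x)%:E) = 1%E.
Proof.
move=> e0; rewrite /vint /gaussian_density.
under eq_integral do under eq_bigr do rewrite mxE.
rewrite (@ge0_integral_tuple_prod R n (fun=> normal_pdf 0 eta)); last 2 first.
- by move=> _; exact: measurable_normal_pdf.
- by move=> _ x; exact: normal_pdf_ge0.
by rewrite big1// => i _; rewrite integral_normal_pdf.
Qed.

Lemma vint_gauss n s : 0 < s -> vint (fun x : 'rV[R]_n => (gauss s x)%:E) = 1%E.
Proof.
move=> s0; pose eta := Num.sqrt (2 * s)^-1.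
have e0 : 0 < eta by rewrite sqrtr_gt0 invr_gt0 mulr_gt0.
rewrite -(vint_gaussian_density n e0); apply: eq_vint => x.
rewrite gaussian_densityE// sqr_sqrtr ?invr_ge0 ?mulr_ge0 ?(ltW s0)//.
by congr (gauss _ x)%:E; field; rewrite gt_eqF.
Qed.

Lemma gaussian_noiseE n eta (A : set 'rV[R]_n) : vmeasurable_set A ->
  gaussian_noise eta A =
  vint (fun x => (gaussian_density eta x)%:E * (\1_A x)%:E)%E.
Proof.
move=> mA; rewrite /gaussian_noise /vint.
rewrite -[X in power_measure _ _ X]setIT -integral_indic//.
pose f (t : n.-tuple mR) : \bar R := (\1_(@tuple_row R n @^-1` A) t)%:E.
have mf : measurable_fun setT f.
  by apply/measurable_EFinP; exact: measurable_indic.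
have f0 t : (0 <= f t)%E by rewrite lee_fin.
rewrite -/f (ge0_integral_power_normal eta mf f0).
apply: eq_integral => t _; congr (_%:E * _)%E.
by apply: eq_bigr => i _; rewrite mxE.
Qed.

Lemma le_gaussian_noise n eta (A B : set 'rV[R]_n) : A `<=` B ->
  (gaussian_noise eta A <= gaussian_noise eta B)%E.
Proof. by move=> AB; apply: power_measure_monotone => t; exact: AB. Qed.

(** Completing the square at the midpoint of 0 and [v]. *)
Lemma gauss_mul_shift n s (z v : 'rV[R]_n) : 0 < s ->
  gauss s z * gauss s (z - v) = gauss (s / 2) v * gauss (2 * s) (z - 2^-1 *: v).
Proof.
move=> s0; rewrite /gauss mulrACA -expRD -mulrDr sqnorm_half.
rewrite [RHS]mulrACA -expRD -!exprMn -!sqrtrM ?divr_ge0 ?pi_ge0 ?(ltW s0)//.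
  have pin : pi != 0 :> R by rewrite gt_eqF ?pi_gt0.
  congr (_ ^+ n * expR _); last by field.
  congr (Num.sqrt _).
  by move: (pi : R) pin => P pin; field.
Qed.

Lemma vint_gauss_conv n s (v : 'rV[R]_n) : 0 < s ->
  vint (fun z => (gauss s z * gauss s (z - v))%:E) = (gauss (s / 2) v)%:E.
Proof.
move=> s0; under eq_vint do rewrite gauss_mul_shift// EFinM.
rewrite vintZ ?lee_fin ?gauss_ge0//; last 2 first.
- exact: (vmeasurable_shift (- (2^-1 *: v)) (@vmeasurable_gauss n (2 * s))).
- by move=> x; rewrite lee_fin gauss_ge0.
rewrite (@ge0_vint_shift _ _ (- (2^-1 *: v)) (fun z => (gauss (2 * s) z)%:E)).
- by rewrite vint_gauss ?mule1// mulr_gt0.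
- exact: vmeasurable_gauss.
- by move=> x; rewrite lee_fin gauss_ge0.
Qed.

Lemma sqrtr_expR (x : R) : Num.sqrt (expR x) = expR (x / 2).
Proof.
by rewrite [x in LHS]splitr expRD -expr2 sqrtr_sqr ger0_norm ?expR_ge0.
Qed.

(** Exponential tilting as a pointwise bound. The Gaussian with variance multiplied by [rho]
    dominates, up to a factor exponential in [n], outside the squared radius n rho / (2 s) if rho >
    1 and inside it if rho < 1; the sign of the product in the hypothesis covers both tails.
    Integrating gives the Chernoff bound. *)
Lemma gauss_chernoff n s (rho : R) (x : 'rV[R]_n) : 0 < s -> 0 < rho ->
  0 <= (rho - 1) * (sqnorm x - n%:R * rho / (2 * s)) ->
  gauss s x <= Num.sqrt (rho * expR (1 - rho)) ^+ n * gauss (s / rho) x.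
Proof.
move=> s0 r0 h; rewrite /gauss mulrA -exprMn -sqrtrM; last first.
  by rewrite mulr_ge0 ?expR_ge0// ltW.
have -> : rho * expR (1 - rho) * (s / rho / pi) = s / pi * expR (1 - rho).
  have : pi != 0 :> R by rewrite gt_eqF ?pi_gt0.
  by move: (pi : R) => P pin; field; rewrite pin gt_eqF.
rewrite [Num.sqrt (s / pi * _)]sqrtrM ?divr_ge0 ?pi_ge0 ?(ltW s0)// exprMn.
rewrite -[X in _ <= X]mulrA.
rewrite ler_wpM2l ?exprn_ge0 ?sqrtr_ge0//.
rewrite sqrtr_expR.
rewrite -expRM_natl -expRD ler_expR.
rewrite -subr_ge0.
have -> : n%:R * ((1 - rho) / 2) + - (s / rho) * sqnorm x - - s * sqnorm x =
  (s / rho) * ((rho - 1) * (sqnorm x - n%:R * rho / (2 * s))).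
  by field; rewrite !gt_eqF.
by rewrite mulr_ge0// divr_ge0// ltW.
Qed.

Lemma sqrtr_powR_exprn n (V : R) : (0 < n)%N -> 0 <= V ->
  Num.sqrt (V `^ (2 / n%:R)) ^+ n = V.
Proof.
move=> n0 V0; have nn : n%:R != 0 :> R by rewrite pnatr_eq0 -lt0n.
have -> : 2 / n%:R = n%:R^-1 + n%:R^-1 :> R by field.
have [->|Vn0] := eqVneq V 0.
  rewrite powR0 ?sqrtr0 ?expr0n ?gtn_eqF//.
  by rewrite gt_eqF// addr_gt0// invr_gt0 ltr0n.
rewrite powRD ?Vn0 ?implybT// -expr2 sqrtr_sqr ger0_norm ?powR_ge0//.
by rewrite -powR_mulrn ?powR_ge0// -powRrM mulVf// powRr1.
Qed.

(* Gibbs: integrate the tangent bound e^(-n/2) (1 + n/2 - s |x|^2) <=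
   e^(-s |x|^2) over A, for the s that would be optimal if the claim were
   an equality. *)
Lemma second_moment_lower_bound n (A : set 'rV[R]_n) (V M : R) : (0 < n)%N ->
  vmeasurable_set A -> 0 < V ->
  vint (fun x => (\1_A x)%:E) = V%:E ->
  vint (fun x => (\1_A x * sqnorm x)%:E) = M%:E ->
  (2 * pi * expR 1)^-1 * (n%:R * V * V `^ (2 / n%:R)) <= M.
Proof.
move=> n0 mA V0 VE ME; rewrite leNgt; apply/negP => Mlt.
set W := V `^ (2 / n%:R) in Mlt.
have W0 : 0 < W by exact: powR_gt0.
have nr0 : 0 < n%:R :> R by rewrite ltr0n.
have pi0 : 0 < pi :> R := pi_gt0 R.
have e0 : 0 < expR 1 :> R := expR_gt0 1.
pose s := pi * expR 1 / W.
have s0 : 0 < s by rewrite divr_gt0// mulr_gt0.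
pose k := expR (- (n%:R / 2)) : R.
have k0 : 0 < k by exact: expR_gt0.
(* The integral of e^(-s |x|^2) over the whole space; the choice of [s] makes it V e^(-n/2). *)
pose c := Num.sqrt (pi / s) ^+ n.
have cE : c = V * k.
  have ce : pi / s = W * expR (- 1).
    rewrite expRN /s; move: (pi : R) pi0 (W : R) W0 (expR 1) e0.
    by move=> P p0 w w0 e e0; field; rewrite !gt_eqF.
  rewrite /c ce sqrtrM ?(ltW W0)// exprMn sqrtr_powR_exprn ?(ltW V0)//.
  rewrite sqrtr_expR -expRM_natl.
  by congr (_ * expR _); field.
have mf : vmeasurable (fun x : 'rV[R]_n => (\1_A x * sqnorm x)%:E).
  by apply: vmeasurable_EFinM; [exact: vmeasurable_indic|exact: vmeasurable_sqnorm].
have f0 (x : 'rV[R]_n) : (0 <= (\1_A x * sqnorm x)%:E)%E.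
  by rewrite lee_fin mulr_ge0// sqnorm_ge0.
have := @le_vint R n (fun x => (k * (1 + n%:R / 2))%:E * (\1_A x)%:E)%E
  (fun x => c%:E * (gauss s x)%:E + (k * s)%:E * (\1_A x * sqnorm x)%:E)%E.
rewrite vintD; last 4 first.
- by apply: vmeasurableM; [exact: vmeasurable_cst|exact: vmeasurable_gauss].
- by apply: vmeasurableM => //; exact: vmeasurable_cst.
- move=> x; rewrite -EFinM lee_fin mulr_ge0 ?gauss_ge0// cE.
  by rewrite mulr_ge0// ltW.
- by move=> x; rewrite mule_ge0// lee_fin mulr_ge0// ltW.
rewrite (vintZ (k := (k * (1 + n%:R / 2))%:E) (vmeasurable_indic mA)); last 2 first.
- by move=> x; rewrite lee_fin.
- by rewrite lee_fin mulr_ge0 ?addr_ge0 ?divr_ge0// ltW.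
rewrite (vintZ (k := c%:E) (@vmeasurable_gauss n s)); last 2 first.
- by move=> x; rewrite lee_fin gauss_ge0.
- by rewrite lee_fin cE mulr_ge0// ltW.
rewrite (vintZ (k := (k * s)%:E) mf)//; last by rewrite lee_fin mulr_ge0 ?ltW.
rewrite VE ME vint_gauss// mule1 -!EFinM -EFinD lee_fin.
move=> H.
have {H} : k * (1 + n%:R / 2) * V <= c + k * s * M.
  apply: H => x; first by rewrite mule_ge0// lee_fin mulr_ge0 ?addr_ge0 ?divr_ge0// ltW.
  rewrite -!EFinM -EFinD lee_fin indicE; case: (_ \in _); last first.
    by rewrite /= !mul0r !mulr0 addr0 mulr_ge0 ?gauss_ge0// cE mulr_ge0// ltW.
  rewrite /= mulr1 mul1r -lerBlDr.
  have -> : c * gauss s x = expR (- s * sqnorm x).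
    rewrite /gauss mulrA -exprMn -sqrtrM; last exact/ltW/divr_gt0.
    rewrite (_ : pi / s * (s / pi) = 1) ?sqrtr1 ?expr1n ?mul1r//.
    by move: (pi : R) pi0 (s : R) s0 => P p0 w w0; field; rewrite !gt_eqF.
  have -> : - s * sqnorm x = - (n%:R / 2) + (n%:R / 2 - s * sqnorm x) by ring.
  rewrite expRD -/k -mulrA -mulrBr ler_pM2l//.
  by apply: le_trans (expR_ge1Dx _); rewrite addrA.
have sM : s * M < n%:R * V / 2.
  have -> : n%:R * V / 2 = s * ((2 * pi * expR 1)^-1 * (n%:R * V * W)).
    rewrite /s; move: (pi : R) pi0 (W : R) W0 (expR 1) e0.
    by move=> P p0 w w0 e e0; field; rewrite !gt_eqF.
  by rewrite ltr_pM2l.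
have : k * (s * M) < k * (n%:R * V / 2) by rewrite ltr_pM2l.
rewrite cE; lra.
Qed.

End Gauss.

(** * Lattice sums *)

Section EsumMore.
Variables (R : realType) (E : choiceType).
Local Open Scope ereal_scope.

Lemma esum_single (S : set E) (a : E -> \bar R) v : S v ->
  (forall w, S w -> 0 <= a w) -> (forall w, S w -> w <> v -> a w = 0) ->
  \esum_(w in S) a w = a v.
Proof.
move=> Sv a0 az; rewrite (esumID [set v])//.
rewrite (_ : S `&` [set v] = [set v]); last by apply/setIidr => _ ->.
rewrite esum_set1 ?a0// esum1 ?adde0// => w [Sw /= wv]; exact: az.
Qed.

Lemma esum_ge_term (S : set E) (a : E -> \bar R) v : S v ->
  (forall w, S w -> 0 <= a w) -> a v <= \esum_(w in S) a w.
Proof.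
move=> Sv a0; apply: esum_ge; exists [set v]; last by rewrite fsbig_set1.
by split => // _ ->.
Qed.

Lemma ge0_esumZl (S : set E) (a : E -> \bar R) (k : R) : (0 <= k)%R ->
  (forall w, 0 <= a w) ->
  \esum_(w in S) (k%:E * a w) = k%:E * \esum_(w in S) a w.
Proof.
have le1 (c : R) (b : E -> \bar R) : (0 <= c)%R -> (forall w, 0 <= b w) ->
    \esum_(w in S) (c%:E * b w) <= c%:E * \esum_(w in S) b w.
  move=> c0 b0; apply: ge_ereal_sup => _ [X [finX XS] <-].
  rewrite -ge0_mule_fsumr// lee_wpmul2l ?lee_fin//.
  by apply: esum_ge; exists X.
move=> k0 a0; have [->|kn0] := eqVneq k 0%R.
  by rewrite mul0e esum1// => i _; rewrite mul0e.
have kp : (0 < k)%R by rewrite lt_neqAle eq_sym kn0.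
apply/eqP; rewrite eq_le le1//= -lee_pdivlMl//.
rewrite (_ : \esum_(w in S) a w = \esum_(w in S) (k^-1%:E * (k%:E * a w))).
  by apply: le1; [rewrite invr_ge0|move=> w; rewrite mule_ge0// lee_fin].
by apply: eq_esum => w _; rewrite muleA -EFinM mulVf// mul1e.
Qed.

End EsumMore.

Section FundamentalDomain.
Variables (R : realType) (n : nat) (E : zmodType) (e : E -> 'rV[R]_n).
Hypothesis eB : {morph e : x y / x - y}.
Hypothesis cE : countable [set: E].
Local Open Scope ereal_scope.

Lemma embedding0 : e 0%R = 0%R. Proof. by rewrite -(subrr (0%R : E)) eB subrr. Qed.
Lemma embeddingN x : e (- x)%R = (- e x)%R.
Proof. by rewrite -sub0r eB embedding0 sub0r. Qed.
Lemma embeddingD x y : e (x + y)%R = (e x + e y)%R.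
Proof. by rewrite -[y in LHS]opprK eB embeddingN opprK. Qed.

Lemma countable_subset (S : set E) : countable S.
Proof. by apply: sub_countable cE; exact: subset_card_le. Qed.

Variable S : set E.
Hypothesis S0 : S 0%R.
Hypothesis SB : forall x y, S x -> S y -> S (x - y)%R.

Lemma subgroupN x : S x -> S (- x)%R.
Proof. by move=> Sx; rewrite -sub0r; exact: SB. Qed.

Lemma subgroupD x y : S x -> S y -> S (x + y)%R.
Proof. by move=> Sx Sy; rewrite -[y]opprK; apply: SB => //; exact: subgroupN. Qed.

Lemma esum_subgroupN (a : E -> \bar R) :
  \esum_(v in S) a (- v)%R = \esum_(v in S) a v.
Proof.
rewrite [RHS](reindex_esum S S (fun v => - v)%R)//; split => //.
- by move=> v; exact: subgroupN.
- by move=> x y _ _ /oppr_inj.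
- by move=> v Sv; exists (- v)%R; [exact: subgroupN|rewrite opprK].
Qed.

Lemma esum_coset (a : E -> \bar R) v w : S (v - w)%R ->
  \esum_(u in S) a (v + u)%R = \esum_(u in S) a (w + u)%R.
Proof.
move=> Svw; rewrite [RHS](reindex_esum S S (fun u => v - w + u)%R); last first.
  split.
  - by move=> u Su; exact: subgroupD.
  - by move=> x y _ _ /addrI.
  - move=> u Su; exists (u - (v - w))%R; first exact: SB.
    by rewrite addrCA subrr addr0.
by apply: eq_esum => u _; rewrite addrA [(w + _)%R]addrC subrK.
Qed.

(** The translates tile space exactly and not only up to null sets, so that unfolding is a pointwise
    identity. Half-open boxes qualify; closed Voronoi regions need not. *)
Definition fundamental (D : set 'rV[R]_n) := [/\ vmeasurable_set D,
  forall x, exists2 v, S v & D (x - e v)%R &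
  forall x v w, S v -> S w -> D (x - e v)%R -> D (x - e w)%R -> v = w].

Variable D : set 'rV[R]_n.
Hypothesis fD : fundamental D.

Let mD : vmeasurable_set D. Proof. by case: fD. Qed.

(** The indicators of the translates of [D] sum to 1 at every point; inserting this sum and shifting
    each term back to [D] gives the claim. *)
Lemma vint_unfold (h : 'rV[R]_n -> \bar R) : vmeasurable h ->
  (forall x, 0 <= h x) ->
  vint h = \esum_(v in S) vint (fun x => (\1_D x)%:E * h (x + e v)%R).
Proof.
move=> mh h0; have [_ ex un] := fD.
transitivity (vint (fun x =>
    \esum_(v in S) ((\1_D (x - e v)%R)%:E * h x))).
  apply: eq_vint => x; have [v Sv Dv] := ex x.
  rewrite (@esum_single _ _ _ _ v)//.
  - by rewrite indicE mem_set// mul1e.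
  - by move=> w _; rewrite mule_ge0// lee_fin.
  - move=> w Sw wv; rewrite indicE memNset ?mul0e// => Dw.
    by apply: wv; exact: un Dw Dv.
have m1 v : vmeasurable (fun x => (\1_D (x - e v)%R)%:E * h x).
  apply: vmeasurableM => //.
  exact: (@vmeasurable_shift _ _ (- e v)%R _ (vmeasurable_indic mD)).
rewrite (vint_esum (countable_subset S) (fun v _ => m1 v)); last first.
  by move=> v x _; rewrite mule_ge0// lee_fin.
apply: eq_esum => v _.
rewrite -(ge0_vint_shift (e v) (m1 v)); last first.
  by move=> x; rewrite mule_ge0// lee_fin.
by apply: eq_vint => x; rewrite addrK.
Qed.

(** Pairing [u] with [- u] cancels the inner product: the parallelogram identity followed by 2 a b
    <= a^2 + b^2. *)
Lemma gauss_midpoint (s : R) (y u : 'rV[R]_n) : (2 * expR (- s * sqnorm u) * gauss s y <=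
  gauss s (y + u)%R + gauss s (y - u)%R)%R.
Proof.
rewrite /gauss -mulrDr mulrCA ler_wpM2l ?exprn_ge0 ?sqrtr_ge0//.
set a := expR (- s / 2 * sqnorm (y + u)%R).
set b := expR (- s / 2 * sqnorm (y - u)%R).
have -> : expR (- s * sqnorm (y + u)%R) = (a ^+ 2)%R.
  by rewrite -expRM_natl; congr expR; field.
have -> : expR (- s * sqnorm (y - u)%R) = (b ^+ 2)%R.
  by rewrite -expRM_natl; congr expR; field.
have -> : (2 * expR (- s * sqnorm u) * expR (- s * sqnorm y) = 2 * (a * b))%R.
  rewrite -mulrA -!expRD -!mulrDr.
  rewrite sqnorm_parallelogram.
  by congr (_ * expR _)%R; field.
by rewrite -subr_ge0 (_ : _ - _ = (a - b) ^+ 2)%R ?sqr_ge0//; ring.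
Qed.

(** Averaging the midpoint bound over [u] in [D] bounds each term by the Gaussian masses of the two
    cells x - e v + D and x - e v - D. Over all [v] each family of cells tiles space and has total
    mass 1. The result is e^(s r) times the mean 1 / V, uniformly in [x] and without Poisson
    summation. *)
Lemma esum_gauss_le (s r V : R) (x : 'rV[R]_n) : (0 < s)%R ->
  (forall u, D u -> sqnorm u <= r)%R ->
  vint (fun x => (\1_D x)%:E) = V%:E -> (0 < V)%R ->
  \esum_(v in S) (gauss s (x - e v)%R)%:E <= (expR (s * r) / V)%:E.
Proof.
move=> s0 Dr VE V0.
pose k := (2 * expR (- s * r) * V)%R.
have k0 : (0 < k)%R by rewrite !mulr_gt0// expR_gt0.
have mg : vmeasurable (fun u : 'rV[R]_n => (gauss s u)%:E) by exact: vmeasurable_gauss.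
have g0 (u : 'rV[R]_n) : 0 <= (gauss s u)%:E by rewrite lee_fin gauss_ge0.
have md y : vmeasurable (fun u => (\1_D u)%:E * (gauss s (u + y)%R)%:E).
  by apply: vmeasurableM; [exact: vmeasurable_indic|exact: (vmeasurable_shift y mg)].
have d0 y u : 0 <= (\1_D u)%:E * (gauss s (u + y)%R)%:E.
  by rewrite mule_ge0// lee_fin.
have gC (y u : 'rV[R]_n) : gauss s (y - u)%R = gauss s (u - y)%R.
  by rewrite /gauss sqnormC.
have one y : \esum_(v in S) vint (fun u => (\1_D u)%:E * (gauss s (u + (e v + y))%R)%:E) = 1.
  have e1 : vint (fun u : 'rV[R]_n => (gauss s (u + y)%R)%:E) = 1.
    by rewrite -(vint_gauss n s0); exact: (ge0_vint_shift y mg g0).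
  rewrite -e1; have /= -> := vint_unfold (vmeasurable_shift y mg) (fun u => g0 (u + y)%R).
  by apply: eq_esum => v _; apply: eq_vint => u; rewrite addrA.
have term v : k%:E * (gauss s (x - e v)%R)%:E <=
    vint (fun u => (\1_D u)%:E * (gauss s (u + (- e v + x))%R)%:E) +
    vint (fun u => (\1_D u)%:E * (gauss s (u + (e v - x))%R)%:E).
  rewrite -vintD//.
  rewrite -EFinM (_ : _ * _ = 2 * expR (- s * r) * gauss s (x - e v) * V)%R; last first.
    by rewrite /k; ring.
  rewrite EFinM -VE -(vintZ (vmeasurable_indic mD)); last 2 first.
  - by move=> ?; rewrite lee_fin.
  - by rewrite lee_fin !mulr_ge0 ?expR_ge0 ?gauss_ge0.
  apply: le_vint => u.
    by rewrite mule_ge0// lee_fin !mulr_ge0 ?expR_ge0 ?gauss_ge0.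
  rewrite indicE; have [/set_mem Du|_] := boolP (u \in D); last first.
    by rewrite /= !mul0e mule0 adde0.
  rewrite /= !mul1e mule1 lee_fin.
  apply: le_trans (_ : 2 * expR (- s * sqnorm u) * gauss s (x - e v) <= _)%R.
    rewrite ler_wpM2r ?gauss_ge0// ler_wpM2l// ler_expR.
    by rewrite !mulNr lerN2 ler_pM2l//; exact: Dr.
  apply: le_trans (gauss_midpoint _ _ _) _.
  rewrite [gauss s (x - e v - u)%R]gC opprB.
  by rewrite [(- e v + x)%R]addrC [(x - e v + u)%R]addrC.
rewrite -(@lee_pmul2l _ k%:E)//.
rewrite -ge0_esumZl ?(ltW k0)//.
apply: le_trans (le_esum (fun v _ => term v)) _.
rewrite esumD; last 2 first.
- by move=> v _; apply: vint_ge0.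
- by move=> v _; apply: vint_ge0.
have A : \esum_(v in S)
    vint (fun u => (\1_D u)%:E * (gauss s (u + (- e v + x))%R)%:E) = 1.
  pose T v := vint (fun u => (\1_D u)%:E * (gauss s (u + (e v + x))%R)%:E).
  transitivity (\esum_(v in S) T (- v)%R); last first.
    by rewrite (esum_subgroupN T); exact: one.
  by apply: eq_esum => v _; rewrite /T embeddingN.
have B := one (- x)%R.
rewrite [X in X + _ <= _]A [X in _ + X <= _]B.
rewrite -EFinM -EFinD lee_fin /k.
rewrite (_ : _ * _ * _ * _ = 2 * (expR (- s * r) * expR (s * r)))%R; last first.
  by field; rewrite gt_eqF.
by rewrite -expRD mulNr addNr expR0 mulr1.
Qed.

End FundamentalDomain.

Section EsumScale.
Variables (R : realType) (E : choiceType).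
Local Open Scope ereal_scope.

(** An infinite factor is allowed because the factor may itself be the value of a periodised sum. *)
Lemma ge0_esumZ (S : set E) (a : E -> \bar R) (k : \bar R) : 0 <= k ->
  (forall w, 0 <= a w) ->
  \esum_(w in S) (k * a w) = k * \esum_(w in S) a w.
Proof.
case: k => [k| |]//; first by move=> k0 a0; apply: ge0_esumZl.
move=> _ a0; have [[w Sw aw]|/forall2NP a_eq0] := pselect (exists2 w, S w & a w != 0).
  have aw0 : 0 < a w by rewrite lt_neqAle eq_sym aw a0.
  rewrite gt0_mulye; last first.
    by apply: lt_le_trans aw0 _; apply: esum_ge_term.
  apply/eqP; rewrite -leye_eq -[X in X <= _](gt0_mulye aw0).
  by apply: (@esum_ge_term _ _ S (fun w => +oo * a w)) => // v _; rewrite mule_ge0.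
have aE w : S w -> a w = 0.
  by move=> Sw; case: (a_eq0 w) => // /negP/negPn/eqP.
rewrite !esum1 ?mule0// => w Sw; by rewrite aE ?mule0.
Qed.

Lemma sume_const (I : finType) (x : \bar R) : 0 <= x ->
  \sum_(i : I) x = #|I|%:R%:E * x.
Proof.
move=> x0; rewrite big_const; elim: #|I| => [|m IH] /=; first by rewrite mul0e.
by rewrite IH -natr1 EFinD ge0_muleDl ?lee_fin// mul1e addeC.
Qed.

End EsumScale.

(** * Periodised functions, their correlations, and sums over a code *)

Section Cosets.
Variables (R : realType) (n : nat) (E : zmodType) (e : E -> 'rV[R]_n).
Hypothesis eB : {morph e : x y / x - y}.
Hypothesis cE : countable [set: E].
Variable Q : set E.
Hypothesis Q0 : Q 0.
Hypothesis QB : forall x y, Q x -> Q y -> Q (x - y).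
Variables (C : finZmodType) (rep : C -> E).
Hypothesis repB : forall c c', Q (rep (c - c') - (rep c - rep c')).
Hypothesis rep_ex : forall v, exists c, Q (v - rep c).
Hypothesis rep_inj : forall c c', Q (rep c - rep c') -> c = c'.
Local Open Scope ereal_scope.

Lemma esum_cosets (h : E -> \bar R) : (forall v, 0 <= h v) ->
  \esum_(v in [set: E]) h v = \sum_(c : C) \esum_(u in Q) h (rep c + u)%R.
Proof.
move=> h0.
transitivity (\esum_(v in [set: E])
    \sum_(c : C) (if v \in [set v | Q (v - rep c)%R] then h v else 0)).
  apply: eq_esum => v _; have [c Qc] := rep_ex v.
  rewrite (bigD1 c)//= mem_set// big1 ?adde0// => c' c'c.
  rewrite memNset//= => Qc'; move/eqP: c'c; apply.
  apply: rep_inj.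
  have -> : (rep c' - rep c = (v - rep c) - (v - rep c'))%R.
    by rewrite opprB [RHS]addrC subrKA.
  exact: QB.
rewrite esum_sum; last by move=> v c _ _; case: ifP.
apply: eq_bigr => c _; rewrite -esum_mkcond.
rewrite (reindex_esum Q _ (fun u => rep c + u)%R)//; split.
- by move=> u Qu /=; rewrite addrC addKr.
- by move=> x y _ _ /addrI.
- by move=> v /= Qv; exists (v - rep c)%R => //; rewrite addrC subrK.
Qed.

Variable phi : 'rV[R]_n -> R.
Hypothesis mphi : vmeasurable (fun x => (phi x)%:E).
Hypothesis phi0 : forall x, (0 <= phi x)%R.

Definition coset_sum (c : C) (x : 'rV[R]_n) : \bar R :=
  \esum_(u in Q) (phi (x - e (rep c + u)%R)%R)%:E.

(** The autocorrelation of [phi] summed along a coset. Folding turns the inner product over a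
    fundamental domain of two periodised functions into this quantity at the difference of their
    cosets. *)
Definition coset_corr (c : C) : \bar R :=
  \esum_(u in Q) vint (fun x => (phi x * phi (x - e (rep c + u)%R))%R%:E).

Lemma vmeasurable_phi_shift v : vmeasurable (fun x => (phi (x - v)%R)%:E).
Proof. exact: (vmeasurable_shift (- v)%R mphi). Qed.

Lemma vmeasurable_coset_sum c : vmeasurable (coset_sum c).
Proof.
apply: vmeasurable_esum.
- exact: countable_subset.
- by move=> u _; exact: vmeasurable_phi_shift.
- by move=> u x _; rewrite lee_fin.
Qed.

Lemma coset_sum_ge0 c x : 0 <= coset_sum c x.
Proof. by apply: esum_ge0 => u _; rewrite lee_fin. Qed.

Lemma coset_corr_ge0 c : 0 <= coset_corr c.
Proof.
by apply: esum_ge0 => u _; apply: vint_ge0 => x; rewrite lee_fin mulr_ge0.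
Qed.

Lemma coset_sum_period c x u : Q u -> coset_sum c (x - e u)%R = coset_sum c x.
Proof.
move=> Qu; rewrite /coset_sum.
rewrite [RHS](@esum_coset R E Q Q0 QB (fun v => (phi (x - e v)%R)%:E) _ (rep c + u)%R).
  apply: eq_esum => v _; congr (phi _)%:E.
  by rewrite -addrA -opprD -(embeddingD eB) addrCA addrA.
by rewrite opprD addrA subrr sub0r; exact: subgroupN.
Qed.

Lemma coset_sum_shift c c' x :
  coset_sum c' (x + e (rep c))%R = coset_sum (c' - c)%R x.
Proof.
rewrite /coset_sum.
rewrite [RHS](@esum_coset R E Q Q0 QB (fun v => (phi (x - e v)%R)%:E) _
  (rep c' - rep c)%R)//.
apply: eq_esum => v _; congr (phi _)%:E.
by rewrite [(rep c' - rep c + v)%R]addrAC eB opprB addrA.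
Qed.

Lemma vint_phi_coset_sum c :
  vint (fun x => (phi x)%:E * coset_sum c x) = coset_corr c.
Proof.
transitivity (vint (fun x => \esum_(u in Q)
    (phi x * phi (x - e (rep c + u)%R))%R%:E)).
  apply: eq_vint => x; rewrite -ge0_esumZl// => u; by rewrite lee_fin.
apply: vint_esum.
- exact: countable_subset.
- move=> u _; apply: vmeasurable_EFinM => //; exact: vmeasurable_phi_shift.
- by move=> u x _; rewrite lee_fin mulr_ge0.
Qed.

Variable D : set 'rV[R]_n.
Hypothesis fD : fundamental e Q D.

Let mD : vmeasurable_set D. Proof. by case: fD. Qed.

(** Periodicity moves [g] inside the sum over [Q], after which unfolding merges [D] and its
    translates into the whole space. *)
Lemma vint_fold (k g : 'rV[R]_n -> \bar R) : vmeasurable k -> vmeasurable g ->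
  (forall x, 0 <= k x) -> (forall x, 0 <= g x) ->
  (forall x u, Q u -> g (x - e u)%R = g x) ->
  vint (fun x => (\1_D x)%:E * ((\esum_(u in Q) k (x - e u)%R) * g x)) =
  vint (fun x => k x * g x).
Proof.
move=> mk mg k0 g0 gp.
pose h x := k x * g x.
have mh : vmeasurable h by exact: vmeasurableM.
have h0 x : 0 <= h x by exact: mule_ge0.
rewrite [RHS](vint_unfold cE fD mh h0).
pose T u := vint (fun x => (\1_D x)%:E * h (x + e u)%R).
transitivity (\esum_(u in Q) T (- u)%R); last exact: (esum_subgroupN Q0 QB T).
transitivity (vint (fun x => \esum_(u in Q) ((\1_D x)%:E * h (x - e u)%R))).
  apply: eq_vint => x; rewrite [RHS]ge0_esumZ ?lee_fin//; congr (_ * _).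
  rewrite muleC -ge0_esumZ//; apply: eq_esum => u Qu.
  by rewrite /h gp// muleC.
rewrite vint_esum; first last.
- by move=> u x _; rewrite mule_ge0// lee_fin.
- move=> u _; apply: vmeasurableM; first exact: vmeasurable_indic.
  exact: (vmeasurable_shift (- e u)%R mh).
- exact: countable_subset.
by apply: eq_esum => u _; rewrite /T (embeddingN eB).
Qed.

Lemma vint_coset_sum2 c c' :
  vint (fun x => (\1_D x)%:E * (coset_sum c x * coset_sum c' x)) =
  coset_corr (c' - c)%R.
Proof.
pose k x := (phi (x - e (rep c))%R)%:E.
transitivity (vint (fun x => k x * coset_sum c' x)).
  rewrite -(@vint_fold k (coset_sum c')); first last.
  - by move=> x u; exact: coset_sum_period.
  - exact: coset_sum_ge0.
  - by move=> x; rewrite lee_fin.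
  - exact: vmeasurable_coset_sum.
  - exact: vmeasurable_phi_shift.
  apply: eq_vint => x; congr (_ * (_ * _)); apply: eq_esum => u _.
  by rewrite /k (embeddingD eB) opprD addrA addrAC.
pose g x := k x * coset_sum c' x.
have mg : vmeasurable g.
  apply: vmeasurableM; first exact: vmeasurable_phi_shift.
  exact: vmeasurable_coset_sum.
have g0 x : 0 <= g x by rewrite mule_ge0 ?coset_sum_ge0// lee_fin.
rewrite -[LHS](ge0_vint_shift (e (rep c)) mg g0) -vint_phi_coset_sum.
by apply: eq_vint => x; rewrite /g /k addrK coset_sum_shift.
Qed.

Lemma vint_coset_sum1 c :
  vint (fun x => (\1_D x)%:E * coset_sum c x) = vint (fun x => (phi x)%:E).
Proof.
pose k x := (phi (x - e (rep c))%R)%:E.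
transitivity (vint (fun x => k x * 1)).
  rewrite -(@vint_fold k (fun=> 1)); first last.
  - by [].
  - by [].
  - by move=> x; rewrite lee_fin.
  - exact: vmeasurable_cst.
  - exact: vmeasurable_phi_shift.
  apply: eq_vint => x; rewrite mule1; congr (_ * _); apply: eq_esum => u _.
  by rewrite /k (embeddingD eB) opprD addrA addrAC.
rewrite -[RHS](ge0_vint_shift (- e (rep c))%R mphi).
  by apply: eq_vint => x; rewrite mule1.
by move=> x; rewrite lee_fin.
Qed.

Variables (W : finZmodType) (enc : W -> C).
Hypothesis encB : {morph enc : x y / (x - y)%R}.

Definition code_sum x : \bar R := \sum_(w : W) coset_sum (enc w) x.

Lemma vmeasurable_code_sum : vmeasurable code_sum.
Proof. by apply: vmeasurable_sum => w; exact: vmeasurable_coset_sum. Qed.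

Lemma code_sum_ge0 x : 0 <= code_sum x.
Proof. by apply: sume_ge0 => w _; exact: coset_sum_ge0. Qed.

(** Linearity of the encoder: after the substitution w' = w + w'' the inner sum no longer depends on
    [w]. The second moment is thus a single sum over codewords, so the average over codes only needs
    the law of one codeword at a time. *)
Lemma vint_code_sum2 : vint (fun x => (\1_D x)%:E * (code_sum x * code_sum x)) =
  #|W|%:R%:E * \sum_(w : W) coset_corr (enc w).
Proof.
transitivity (vint (fun x => \sum_(w : W) \sum_(w' : W)
    ((\1_D x)%:E * (coset_sum (enc w) x * coset_sum (enc w') x)))).
  apply: eq_vint => x; rewrite {1}/code_sum ge0_sume_distrl; last first.
    by move=> w _; exact: coset_sum_ge0.
  rewrite ge0_sume_distrr; last first.
    by move=> w _; rewrite mule_ge0 ?coset_sum_ge0 ?code_sum_ge0.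
  apply: eq_bigr => w _; rewrite /code_sum.
  rewrite ge0_sume_distrr; last by move=> *; exact: coset_sum_ge0.
  by rewrite ge0_sume_distrr// => *; rewrite mule_ge0 ?coset_sum_ge0.
have m2 w w' : vmeasurable (fun x =>
    (\1_D x)%:E * (coset_sum (enc w) x * coset_sum (enc w') x)).
  apply: vmeasurableM; first exact: vmeasurable_indic.
  by apply: vmeasurableM; exact: vmeasurable_coset_sum.
have p2 w w' x : 0 <= (\1_D x)%:E * (coset_sum (enc w) x * coset_sum (enc w') x).
  by rewrite !mule_ge0 ?coset_sum_ge0 ?lee_fin.
rewrite vint_sum; last 2 first.
- by move=> w; exact: vmeasurable_sum.
- by move=> w x; exact: sume_ge0.
rewrite (eq_bigr (fun=> \sum_(w : W) coset_corr (enc w))); last first.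
  move=> w _; rewrite vint_sum//.
  rewrite (reindex_inj (addrI w))/=; apply: eq_bigr => w' _.
  by rewrite vint_coset_sum2 -encB addrC addKr.
by apply: sume_const; apply: sume_ge0 => w _; exact: coset_corr_ge0.
Qed.

Lemma vint_code_sum1 : vint (fun x => (\1_D x)%:E * code_sum x) =
  #|W|%:R%:E * vint (fun x => (phi x)%:E).
Proof.
transitivity (vint (fun x => \sum_(w : W) ((\1_D x)%:E * coset_sum (enc w) x))).
  apply: eq_vint => x; rewrite ge0_sume_distrr// => w _; exact: coset_sum_ge0.
rewrite vint_sum; last 2 first.
- move=> w; apply: vmeasurableM; first exact: vmeasurable_indic.
  exact: vmeasurable_coset_sum.
- by move=> w x; rewrite mule_ge0 ?coset_sum_ge0 ?lee_fin.
rewrite (eq_bigr (fun=> vint (fun x => (phi x)%:E))); last first.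
  by move=> w _; exact: vint_coset_sum1.
by apply: sume_const; apply: vint_ge0 => x; rewrite lee_fin.
Qed.

(* Chebyshev's inequality for [code_sum], of mean [mu] on [D], in the form
   [f = 0] mu^2 + 2 mu f <= f^2 + mu^2. *)
Lemma vint_code_sum_eq0 (V I mu : R) :
  vint (fun x => (\1_D x)%:E) = V%:E -> vint (fun x => (phi x)%:E) = I%:E ->
  (0 <= mu)%R -> (#|W|%:R * I = mu * V)%R ->
  (mu ^+ 2)%:E * vint (fun x => (\1_(D `&` [set x | code_sum x = 0]) x)%:E) +
    (mu ^+ 2 * V)%:E <= #|W|%:R%:E * \sum_(w : W) coset_corr (enc w).
Proof.
move=> VE IE mu0 muE; set Z := [set x | code_sum x = 0].
have mZ : vmeasurable_set (D `&` Z).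
  apply: vmeasurable_setI => //.
  rewrite (_ : Z = [set x | code_sum x <= 0]).
    apply: vmeasurable_set_le; first exact: vmeasurable_code_sum.
    exact: vmeasurable_cst.
  apply/seteqP; split => x /= => [->//|fx].
  by apply/eqP; rewrite eq_le fx code_sum_ge0.
have mDi := vmeasurable_indic mD.
have D0 x : 0 <= (\1_D x)%:E :> \bar R by rewrite lee_fin.
have mf := vmeasurable_code_sum.
pose a x := (mu ^+ 2)%:E * (\1_(D `&` Z) x)%:E.
pose b x := (2 * mu)%:E * ((\1_D x)%:E * code_sum x).
pose c x := (\1_D x)%:E * (code_sum x * code_sum x).
pose d x := (mu ^+ 2)%:E * (\1_D x)%:E.
have mu20 : 0 <= (mu ^+ 2)%:E :> \bar R by rewrite lee_fin sqr_ge0.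
have mu2 : 0 <= (2 * mu)%:E :> \bar R by rewrite lee_fin mulr_ge0.
have a0 x : 0 <= a x by rewrite mule_ge0// lee_fin.
have b0 x : 0 <= b x by rewrite !mule_ge0// code_sum_ge0.
have c0 x : 0 <= c x by rewrite !mule_ge0// code_sum_ge0.
have d0 x : 0 <= d x by rewrite mule_ge0.
have ma : vmeasurable a.
  by apply: vmeasurableM; [exact: vmeasurable_cst|exact: vmeasurable_indic].
have mDf : vmeasurable (fun x => (\1_D x)%:E * code_sum x) by exact: vmeasurableM.
have mb : vmeasurable b.
  by apply: vmeasurableM => //; exact: vmeasurable_cst.
have mc : vmeasurable c by apply: vmeasurableM => //; exact: vmeasurableM.
have md : vmeasurable d.
  by apply: vmeasurableM => //; exact: vmeasurable_cst.
have : vint (fun x => a x + b x) <= vint (fun x => c x + d x).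
  apply: le_vint => x; first exact: adde_ge0.
  rewrite /a /b /c /d !indicE in_setI.
  have [Dx|_] := boolP (x \in D); last by rewrite /= !mule0 !mul0e !mule0.
  rewrite andTb !mul1e mule1; have [/set_mem/= ->|_] := boolP (x \in Z).
    by rewrite !mule0 adde0 add0e mule1.
  rewrite mule0 add0e; have := code_sum_ge0 x.
  case: (code_sum x) => [r| |]// r0.
    rewrite -!EFinM -EFinD lee_fin -subr_ge0 (_ : _ - _ = (r - mu) ^+ 2)%R ?sqr_ge0//.
    by ring.
  by rewrite mulyy addye ?leey.
rewrite !vintD//.
have i0 x : 0 <= (\1_(D `&` Z) x)%:E :> \bar R by rewrite lee_fin.
have Df0 x : 0 <= (\1_D x)%:E * code_sum x by rewrite mule_ge0// code_sum_ge0.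
rewrite [vint a](vintZ (vmeasurable_indic mZ) i0 mu20).
rewrite [vint b](vintZ mDf Df0 mu2).
rewrite [vint d](vintZ mDi D0 mu20) vint_code_sum2 vint_code_sum1 VE IE.
rewrite -!EFinM muE => H.
rewrite -(@leeD2rE _ (mu ^+ 2 * V)%:E)//; apply: le_trans H.
rewrite -addeA -EFinD leeD2l// lee_fin.
by rewrite (_ : mu ^+ 2 * V + _ = 2 * mu * (mu * V))%R//; ring.
Qed.

End Cosets.

(** * Averaging over random codes *)

Section RandomCode.
Variables (R : realType) (F : finFieldType) (N m : nat).
Local Open Scope ereal_scope.
Local Notation M := 'M[F]_(N, m).
Implicit Types (H : 'cV[F]_N -> \bar R) (w : 'cV[F]_m).

(** For w != 0 the vector G w is uniform when G is. Translating G by matrices [L c] with L c w = c,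
    built from a nonzero entry of [w], reduces this to an exchange of two sums, with no fibre to
    count. *)
Lemma sum_mulmx H w : (forall c, 0 <= H c) -> w != 0%R ->
  #|'cV[F]_N|%:R%:E * \sum_(G : M) H (G *m w)%R =
  #|M|%:R%:E * \sum_(c : 'cV[F]_N) H c.
Proof.
move=> H0 wn0.
have [i wi] : exists i, w i 0%R != 0%R.
  apply/existsP; apply: contraR wn0 => /existsPn h.
  by apply/eqP/colP => i; rewrite !mxE; apply/eqP; have := h i; rewrite negbK.
pose L (c : 'cV[F]_N) : M := (c *m ((w i 0)^-1 *: delta_mx 0 i))%R.
have Lw c : (L c *m w = c)%R.
  rewrite /L -mulmxA -scalemxAl -rowE.
  rewrite (_ : _ *: _ = 1%:M)%R ?mulmx1//.
  by apply/matrixP => j k; rewrite !ord1 !mxE mulVf.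
rewrite -sume_const; last by apply: sume_ge0 => *.
rewrite (eq_bigr (fun c => \sum_(G : M) H (G *m w + c)%R)); last first.
  move=> c _; rewrite (reindex_inj (addIr (L c))).
  by apply: eq_bigr => G _; rewrite mulmxDl Lw.
rewrite exchange_big -sume_const; last by apply: sume_ge0 => *.
apply: eq_bigr => G _; rewrite [RHS](reindex_inj (addrI (G *m w)%R)).
by apply: eq_bigr.
Qed.

Lemma sum_code_nonzero H (S : R) : (forall c, 0 <= H c) ->
  \sum_(c : 'cV[F]_N) H c <= S%:E ->
  \sum_(G : M) \sum_(w | w != 0%R) H (G *m w)%R <=
  (#|M|%:R * (#|'cV[F]_m|%:R / #|'cV[F]_N|%:R * S))%:E.
Proof.
move=> H0 HS; rewrite exchange_big /=.
have S0 : (0 <= S)%R by rewrite -lee_fin; apply: le_trans HS; exact: sume_ge0.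
have C0 : (0 < #|'cV[F]_N|%:R :> R)%R.
  by rewrite ltr0n; apply/card_gt0P; exists 0%R.
apply: (@le_trans _ _ (\sum_(w : 'cV[F]_m) (#|M|%:R / #|'cV[F]_N|%:R * S)%:E)).
  rewrite big_mkcond; apply: lee_sum => w _; case: ifPn => [wn0|_]; last first.
    by rewrite lee_fin mulr_ge0// divr_ge0.
  rewrite -(@lee_pmul2l _ #|'cV[F]_N|%:R%:E)//.
  rewrite sum_mulmx// -EFinM [X in _ <= X%:E](_ : _ = #|M|%:R * S)%R; last first.
    by field; rewrite gt_eqF.
  by rewrite EFinM lee_wpmul2l ?lee_fin.
rewrite sume_const; last by rewrite lee_fin mulr_ge0// divr_ge0.
rewrite -EFinM lee_fin [X in (_ <= X)%R](_ : _ = #|'cV[F]_m|%:R *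
  (#|M|%:R / #|'cV[F]_N|%:R * S))%R//.
by field; rewrite gt_eqF.
Qed.

Lemma exists_le_average (T : finType) (t0 : T) (f : T -> \bar R) (b : R) :
  \sum_(x : T) f x <= (#|T|%:R * b)%:E -> exists x, f x <= b%:E.
Proof.
move=> fb; apply: contrapT => /forallNP h.
have T0 : (0 < #|T|)%N by apply/card_gt0P; exists t0.
have fh x : b%:E < f x by rewrite ltNge; apply/negP/h.
have [[x fx]|/forallNP fx] := pselect (exists x, f x = +oo).
  have : \sum_(x : T) f x = +oo.
    rewrite (bigD1 x)//= fx addye//.
    rewrite gt_eqF// (lt_le_trans (ltNyr (\sum_(i | i != x) b)%R))//.
    by rewrite -sumEFin lee_sum// => i _; exact/ltW.
  by move=> fo; move: fb; rewrite fo.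
have fE x : f x = (fine (f x))%:E.
  rewrite fineK// fin_numE; apply/andP; split; last exact/eqP.
  by rewrite gt_eqF// (lt_trans _ (fh x))// ltNyr.
move: fb; rewrite (eq_bigr (fun x => (fine (f x))%:E))// sumEFin lee_fin.
apply/negP; rewrite -ltNge (_ : (#|T|%:R * b)%R = \sum_(x : T) b)%R; last first.
  by rewrite sumr_const mulr_natl.
apply: ltr_sum.
  by apply/hasP; exists t0; rewrite ?mem_index_enum.
by move=> x _; rewrite -lte_fin -fE.
Qed.

End RandomCode.

Section GoodCode.
Variables (R : realType) (n : nat) (E : zmodType) (e : E -> 'rV[R]_n).
Hypothesis eB : {morph e : x y / x - y}.
Hypothesis cE : countable [set: E].
Variable Q : set E.
Hypothesis Q0 : Q 0.
Hypothesis QB : forall x y, Q x -> Q y -> Q (x - y).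
Variables (F : finFieldType) (N m : nat) (rep : 'cV[F]_N -> E).
Hypothesis repB : forall c c', Q (rep (c - c') - (rep c - rep c')).
Hypothesis rep_ex : forall v, exists c, Q (v - rep c).
Hypothesis rep_inj : forall c c', Q (rep c - rep c') -> c = c'.
Variables (D0 D : set 'rV[R]_n) (v0 r : R).
Hypothesis fD0 : fundamental e setT D0.
Hypothesis D0r : forall u, D0 u -> sqnorm u <= r.
Hypothesis v0E : vint (fun x => (\1_D0 x)%:E) = v0%:E.
Hypothesis v0_gt0 : 0 < v0.
Hypothesis fD : fundamental e Q D.
Let q : R := #|'cV[F]_N|%:R.
Let k : R := #|'cV[F]_m|%:R.
Hypothesis VE : vint (fun x => (\1_D x)%:E) = (q * v0)%:E.
Variable phi : 'rV[R]_n -> R.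
Hypothesis mphi : vmeasurable (fun x => (phi x)%:E).
Hypothesis phi0 : forall x, (0 <= phi x)%R.
Variables (s I h0 : R).
Hypothesis s_gt0 : 0 < s.
Hypothesis phi_gauss : forall x, phi x <= gauss s x.
Hypothesis IE : vint (fun x => (phi x)%:E) = I%:E.
Hypothesis I_gt0 : 0 < I.
Hypothesis h0E : (coset_corr e Q rep phi 0%R <= h0%:E)%E.
Variables (g : E -> R) (B A : R).
Hypothesis g0 : forall v, 0 <= g v.
Hypothesis gB : (\esum_(v in [set: E]) (g v)%:E <= B%:E)%E.
Hypothesis A0 : 0 <= A.
Local Open Scope ereal_scope.

(** The cosets together make up all of [E], so the sum is the integral of [phi] times its
    periodisation along [E], which the Gaussian lattice sum bounds uniformly. *)
Lemma sum_coset_corr_le :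
  \sum_(c : 'cV[F]_N) coset_corr e Q rep phi c <= (I * (expR (s * r) / v0))%:E.
Proof.
rewrite -(esum_cosets QB rep_ex rep_inj
  (h := fun v => vint (fun x => (phi x * phi (x - e v)%R)%R%:E))); last first.
  by move=> v; apply: vint_ge0 => x; rewrite lee_fin mulr_ge0.
pose T v x := (phi x * phi (x - e v)%R)%R%:E.
have mT v : vmeasurable (T v).
  by apply: vmeasurable_EFinM => //; exact: (vmeasurable_phi_shift mphi (e v)).
have T0 v x : 0 <= T v x by rewrite lee_fin mulr_ge0.
rewrite -(vint_esum cE (fun v _ => mT v) (fun v x _ => T0 v x)).
rewrite EFinM muleC -IE -vintZ//; last first.
  by rewrite lee_fin divr_ge0 ?expR_ge0// ltW.
apply: le_vint => x; first exact: esum_ge0.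
rewrite [X in _ <= X]muleC (_ : \esum_(i in _) _ =
    (phi x)%:E * \esum_(v in [set: E]) (phi (x - e v)%R)%:E); last first.
  by rewrite -ge0_esumZl// => v; rewrite lee_fin.
rewrite lee_wpmul2l ?lee_fin//.
apply: le_trans (esum_gauss_le eB cE _ _ fD0 x s_gt0 D0r v0E v0_gt0) => //.
by apply: le_esum => v _; rewrite lee_fin.
Qed.

Let enc (G : 'M[F]_(N, m)) (w : 'cV[F]_m) := (G *m w)%R.
Let J G := vint (fun x =>
  (\1_(D `&` [set x | code_sum e Q rep phi (enc G) x = 0]) x)%:E).
Let H c := \esum_(u in Q) (g (rep c + u)%R)%:E.

(* [J G] measures the points of D not covered by the shells around the code
   points; the term [enc G w == 0] forces G to be injective as soon as the
   bound is less than 1. *)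
Lemma exists_good_code : exists G : 'M[F]_(N, m),
  A%:E * J G + \sum_(w | w != 0%R) (H (enc G w) + (enc G w == 0%R)%:R%:E) <=
  (A * (q * v0) * (q * v0 * h0 / (k * I ^+ 2) + expR (s * r) / I - 1) +
   k / q * (B + 1))%:E.
Proof.
have q0 : (0 < q)%R by rewrite ltr0n; apply/card_gt0P; exists 0%R.
have k0 : (0 < k)%R by rewrite ltr0n; apply/card_gt0P; exists 0%R.
(* The mean of [code_sum] over [D], whose volume is q v0. *)
pose mu := (k * I / (q * v0))%R.
have mu0 : (0 < mu)%R by rewrite !mulr_gt0// invr_gt0 mulr_gt0.
have muE : (k * I = mu * (q * v0))%R by rewrite divfK// gt_eqF// mulr_gt0.
have Hc0 c := coset_corr_ge0 e Q rep phi0 c.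
have H0 c : 0 <= H c by apply: esum_ge0 => u _; rewrite lee_fin.
pose H2 c := H c + (c == 0%R)%:R%:E.
have H20 c : 0 <= H2 c by rewrite adde_ge0// lee_fin.
have sumH2 : \sum_(c : 'cV[F]_N) H2 c <= (B + 1)%:E.
  rewrite big_split/= EFinD leeD//.
    by rewrite -(esum_cosets QB rep_ex rep_inj (h := fun v => (g v)%:E)).
  by rewrite (bigD1 0%R)//= eqxx big1 ?adde0// => c /negbTE ->.
pose a := (A * k / mu ^+ 2)%R.
have a0 : (0 <= a)%R by rewrite !mulr_ge0 ?invr_ge0 ?sqr_ge0 ?(ltW k0).
have JG G : A%:E * J G + (A * (q * v0))%:E <=
    a%:E * \sum_(w : 'cV[F]_m) coset_corr e Q rep phi (enc G w).
  have encB : {morph enc G : x y / (x - y)%R} by move=> x y; exact: mulmxBr.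
  have := vint_code_sum_eq0 eB cE Q0 QB repB mphi phi0 fD encB VE IE (ltW mu0) muE.
  rewrite -/(J G) => hJ.
  have c0 : 0 <= (A / mu ^+ 2)%:E :> \bar R by rewrite lee_fin divr_ge0 ?sqr_ge0.
  move: hJ; rewrite -[X in _ <= X%:E * _]/k => /(lee_wpmul2l c0).
  rewrite ge0_muleDr; last 2 first.
  - rewrite mule_ge0 ?lee_fin ?sqr_ge0//.
    by apply: vint_ge0 => x; rewrite lee_fin.
  - by rewrite lee_fin mulr_ge0 ?sqr_ge0// mulr_ge0// ltW.
  rewrite !muleA -!EFinM.
  rewrite (_ : A / mu ^+ 2 * mu ^+ 2 = A)%R; last by rewrite divfK// gt_eqF// exprn_gt0.
  rewrite (_ : A / mu ^+ 2 * (mu ^+ 2 * (q * v0)) = A * (q * v0))%R; last first.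
    by rewrite mulrA divfK// gt_eqF// exprn_gt0.
  by rewrite (_ : A / mu ^+ 2 * k = a)%R// /a mulrAC.
(* The term [h0] comes from the zero word; the other [k] words at most are uniform over the [q]
   cosets. *)
pose Y := (h0 + k / q * (I * (expR (s * r) / v0)))%R.
have [G hG] : exists G : 'M[F]_(N, m),
   A%:E * J G + (A * (q * v0))%:E + \sum_(w | w != 0%R) H2 (enc G w) <=
   (a * Y + k / q * (B + 1))%:E.
  apply: (exists_le_average (0%R : 'M[F]_(N, m))).
  rewrite big_split /= mulrDr EFinD leeD//; last exact: sum_code_nonzero.
  apply: le_trans (lee_sum _ (fun G _ => JG G)) _.
  rewrite -ge0_sume_distrr; last by move=> G _; exact: sume_ge0.
  rewrite [X in _ <= X%:E]mulrCA [X in _ <= X]EFinM; apply: lee_wpmul2l; first by rewrite lee_fin.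
  rewrite (eq_bigr (fun G => coset_corr e Q rep phi 0%R +
     \sum_(w | w != 0%R) coset_corr e Q rep phi (enc G w))); last first.
    move=> G _; rewrite [LHS](bigD1 (0%R : 'cV[F]_m) isT).
    by have -> : enc G 0%R = 0%R by exact: mulmx0.
  rewrite big_split/= sume_const// mulrDr EFinD leeD//.
    by rewrite EFinM lee_wpmul2l ?lee_fin.
  apply: sum_code_nonzero => //; exact: sum_coset_corr_le.
exists G; rewrite -(@leeD2lE _ (A * (q * v0))%:E)// addeA [X in X + _]addeC.
apply: le_trans hG _; rewrite -EFinD lee_fin le_eqVlt; apply/orP; left; apply/eqP.
by rewrite /a /Y /mu; field; rewrite !gt_eqF.
Qed.

End GoodCode.

(** * Voronoi regions *)

Lemma esum_lty_finite (R : realType) (T : choiceType) (S : set T)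
    (a : T -> R) (c : R) : 0 < c -> (forall i, 0 <= a i) ->
  (\esum_(i in S) (a i)%:E < +oo)%E -> finite_set (S `&` [set i | c <= a i]).
Proof.
move=> c0 a0 Slt; apply: contrapT => infS.
have [b bE] : exists b : R, (\esum_(i in S) (a i)%:E = b%:E)%E.
  exists (fine (\esum_(i in S) (a i)%:E)%E); rewrite fineK// ge0_fin_numE//.
  by apply: esum_ge0 => i _; rewrite lee_fin.
have := @infinite_set_fset _ (S `&` [set i | c <= a i])
  (Num.truncn (b / c)).+1 infS.
move=> [X XS cardX].
have : (\sum_(i \in [set` X]%classic) (a i)%:E <= b%:E)%E.
  rewrite -bE; apply: ereal_sup_ubound; exists [set` X]%classic => //.
  by split => // i /XS[].
rewrite fsbig_finite//= set_fsetK sumEFin lee_fin; apply/negP; rewrite -ltNge.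
apply: (@lt_le_trans _ _ (\sum_(i <- X) c)).
  rewrite big_const_seq count_predT iter_addr_0.
  rewrite -mulr_natl -ltr_pdivrMr//.
  apply: lt_le_trans (truncnS_gt _) _; rewrite ler_nat.
  exact: cardX.
by rewrite !big_seq; apply: ler_sum => i /XS[].
Qed.

Lemma finite_set_min (R : realType) (T : choiceType) (S : set T) (f : T -> R) x :
  S x -> finite_set (S `&` [set y | f y <= f x]) ->
  exists2 y, S y & forall z, S z -> f y <= f z.
Proof.
move=> Sx finS; pose X := fset_set (S `&` [set y | f y <= f x]).
have Xx : x \in X by rewrite in_fset_set//; apply/mem_set; split => /=.
pose y := [arg min_(y < [` Xx]%fset in predT) f (val y)]%O.
have yX : val y \in X by exact: valP.
have Sy : S (val y) by move: yX; rewrite in_fset_set// => /set_mem[].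
have ymin (z : X) : f (val y) <= f (val z).
  by rewrite /y; case: arg_minP => // i _; apply.
exists (val y) => // z Sz; have [fzx|/ltW fxz] := leP (f z) (f x).
  have Xz : z \in X by rewrite in_fset_set//; apply/mem_set; split => /=.
  exact: (ymin [` Xz]%fset).
by apply: le_trans fxz; exact: (ymin [` Xx]%fset).
Qed.

(** The quadratic terms cancel, so the bisector is a hyperplane. *)
Lemma vint_bisector (R : realType) n (a b : 'rV[R]_n) : a <> b ->
  vint (fun x => (\1_[set x | sqnorm (x - a) = sqnorm (x - b)] x)%:E) = 0%E.
Proof.
move=> ab.
have [i bai] : exists i, 2 * (b 0 i - a 0 i) != 0.
  apply: contrapT => /forallNP h; apply: ab; apply/rowP => i.
  have /negP := h i; rewrite negbK mulf_eq0 pnatr_eq0/= subr_eq0.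
  by move/eqP.
rewrite -[RHS](@integral_hyperplane R n (fun i => 2 * (b 0 i - a 0 i))
  (sqnorm b - sqnorm a)); last by exists i.
apply: eq_integral => t _; rewrite !indicE; congr ((nat_of_bool _)%:R%:E).
have key : \sum_(i < n) 2 * (b 0 i - a 0 i) * tnth t i =
    sqnorm (tuple_row t - a) - sqnorm (tuple_row t - b) + (sqnorm b - sqnorm a).
  rewrite /sqnorm -!sumrB -big_split; apply: eq_bigr => j _ /=.
  by rewrite !mxE; ring.
apply/idP/idP => /set_mem/= h; apply/mem_set => /=.
  by rewrite key h subrr add0r.
by move: h; rewrite key -[X in _ = X]add0r => /addIr/eqP; rewrite subr_eq0 => /eqP.
Qed.

Section Voronoi.
Variables (R : realType) (n : nat) (E : zmodType) (e : E -> 'rV[R]_n).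
Hypothesis eB : {morph e : x y / x - y}.
Hypothesis e_inj : injective e.
Hypothesis cE : countable [set: E].
Hypothesis finE : forall x rho, finite_set [set v | sqnorm (x - e v) <= rho].
Variable Q : set E.
Hypothesis Q0 : Q 0.
Hypothesis QB : forall x y, Q x -> Q y -> Q (x - y).
Variables (C : finZmodType) (rep : C -> E).
Hypothesis repB : forall c c', Q (rep (c - c') - (rep c - rep c')).
Hypothesis rep_inj : forall c c', Q (rep c - rep c') -> c = c'.
Variable D : set 'rV[R]_n.
Hypothesis fD : fundamental e Q D.
Variables (W : finZmodType) (enc : W -> C).
Hypothesis encB : {morph enc : x y / (x - y)%R}.
Hypothesis enc_inj : injective enc.

Definition code_lattice : set E := [set v | exists w, Q (v - rep (enc w))].
Local Notation SL := code_lattice.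
Local Notation vor := (voronoi (e @` SL)).
Local Open Scope ereal_scope.

Lemma code_latticeB x y : SL x -> SL y -> SL (x - y)%R.
Proof.
move=> [w Qw] [w' Qw']; exists (w - w')%R; rewrite encB.
have -> : (x - y - rep (enc w - enc w') =
    ((x - rep (enc w)) - (y - rep (enc w')))
    - (rep (enc w - enc w') - (rep (enc w) - rep (enc w'))))%R.
  have -> : (x - rep (enc w) - (y - rep (enc w')) =
      x - y - (rep (enc w) - rep (enc w')))%R.
    by rewrite !opprB [(rep _ - y)%R]addrC addrACA [(- rep _ + _)%R]addrC.
  by rewrite [(- (rep (_ - _)%R - _))%R]opprB addrA subrK.
by apply: (QB (QB Qw Qw')); exact: repB.
Qed.

Lemma sub_code_lattice u : Q u -> SL u.
Proof.
move=> Qu; exists 0%R.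
have -> : enc 0%R = 0%R by rewrite -(subrr (0%R : W)) encB subrr.
apply: QB => //; have := repB 0%R 0%R.
by rewrite !subrr subr0.
Qed.

Lemma esum_code_lattice (h : E -> \bar R) : (forall v, 0 <= h v) ->
  \esum_(v in SL) h v = \sum_(w : W) \esum_(u in Q) h (rep (enc w) + u)%R.
Proof.
move=> h0.
transitivity (\esum_(v in SL)
    \sum_(w : W) (if v \in [set v | Q (v - rep (enc w))%R] then h v else 0)).
  apply: eq_esum => v [w Qw].
  rewrite (bigD1 w)//= mem_set// big1 ?adde0// => w' w'w.
  rewrite memNset//= => Qw'; move/eqP: w'w; apply.
  apply/enc_inj/rep_inj.
  have -> : (rep (enc w') - rep (enc w) =
      (v - rep (enc w)) - (v - rep (enc w')))%R.
    by rewrite opprB [RHS]addrC subrKA.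
  exact: QB.
rewrite esum_sum; last by move=> v w _ _; case: ifP.
apply: eq_bigr => w _; rewrite -esum_mkcondr.
rewrite (reindex_esum Q _ (fun u => rep (enc w) + u)%R)//; split.
- move=> u Qu /=; split; last by rewrite addrC addKr.
  by exists w; rewrite addrC addKr.
- by move=> x y _ _ /addrI.
- by move=> v /= [_ Qv]; exists (v - rep (enc w))%R => //; rewrite addrC subrK.
Qed.

Lemma voronoi_cover x : exists2 v, SL v & vor (x - e v)%R.
Proof.
have SL0 : SL 0%R by exact: sub_code_lattice.
have [|v Sv vmin] := @finite_set_min R E SL (fun v => sqnorm (x - e v)) 0%R SL0.
  exact: sub_finite_set (finE x (sqnorm (x - e 0))%R) => v [].
exists v => // _ [w Sw <-] /=; rewrite -addrA -opprD -(embeddingD eB).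
apply: vmin; rewrite -[w]opprK; apply: code_latticeB => //.
by rewrite -sub0r; exact: code_latticeB.
Qed.

(** A countable intersection of half-spaces, written as the zero set of the sum of the indicators of
    their complements. *)
Lemma vmeasurable_voronoi : vmeasurable_set vor.
Proof.
pose A v : set 'rV[R]_n := [set x | sqnorm x <= sqnorm (x - e v)]%R.
have mA v : vmeasurable_set (A v).
  have := vmeasurable_set_le (@vmeasurable_sqnorm R n)
    (vmeasurable_shift (- e v)%R (@vmeasurable_sqnorm R n)).
  by under eq_set do rewrite lee_fin.
pose f (v : E) (x : 'rV[R]_n) : \bar R := (\1_(~` A v) x)%:E.
have f0 v x : 0 <= f v x by rewrite lee_fin.
have -> : vor = [set x | \esum_(v in SL) f v x <= 0].
  apply/seteqP; split => x /=.
    move=> xV; rewrite esum1// => v Sv; rewrite /f indicE memNset// => /=; apply.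
    by apply: xV; exists v.
  move=> h _ [v Sv <-]; rewrite leNgt; apply/negP => vx.
  have : f v x <= 0 by apply: le_trans h; apply: (@esum_ge_term _ _ SL (f ^~ x)).
  rewrite /f indicE mem_set/=; last by apply/negP; rewrite -ltNge.
  by rewrite lee_fin ler10.
apply: vmeasurable_set_le; last exact: vmeasurable_cst.
apply: vmeasurable_esum => //; first exact: countable_subset.
by move=> v _; apply: vmeasurable_indic; exact: vmeasurable_setC.
Qed.

(* Almost everywhere zero, and infinite at the points with several nearest
   lattice points: adding it to an integrand makes these points harmless. *)
Definition ties (x : 'rV[R]_n) : \bar R :=
  \esum_(p in [set p : E * E | p.1 <> p.2]) (+oo *
    (\1_[set x | sqnorm (x - e p.1) = sqnorm (x - e p.2)]%R x)%:E).

Lemma vmeasurable_bisector (a b : 'rV[R]_n) :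
  vmeasurable_set [set x | sqnorm (x - a) = sqnorm (x - b)]%R.
Proof.
pose A (a b : 'rV[R]_n) := [set x | (sqnorm (x - a)%R)%:E <= (sqnorm (x - b)%R)%:E].
rewrite (_ : [set x | _] = A a b `&` A b a).
  by apply: vmeasurable_setI; apply: vmeasurable_set_le;
    exact: (vmeasurable_shift _ (@vmeasurable_sqnorm R n)).
apply/seteqP; split => x; rewrite /A /= !lee_fin.
  by move=> ->.
by move=> [ab ba]; apply/eqP; rewrite eq_le ab.
Qed.

Let countEE : countable [set p : E * E | p.1 <> p.2].
Proof.
apply: (@sub_countable _ _ _ ([set: E] `*` [set: E])); last exact: countableX.
by apply: subset_card_le.
Qed.

Let mtie p : vmeasurable (fun x => +oo *
    (\1_[set x | sqnorm (x - e p.1) = sqnorm (x - e p.2)]%R x)%:E).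
Proof.
apply: vmeasurableM; first exact: vmeasurable_cst.
by apply: vmeasurable_indic; exact: vmeasurable_bisector.
Qed.

Lemma vmeasurable_ties : vmeasurable ties.
Proof.
by apply: vmeasurable_esum.
Qed.

Lemma ties_ge0 x : 0 <= ties x.
Proof. by apply: esum_ge0 => p _; rewrite mule_ge0// lee_fin. Qed.

Lemma vint_ties : vint ties = 0.
Proof.
rewrite vint_esum//.
rewrite esum1// => p /= pp; rewrite vintZ//.
- by rewrite vint_bisector ?mule0// => /e_inj.
- by apply: vmeasurable_indic; exact: vmeasurable_bisector.
Qed.

Lemma voronoi_ties x v w : SL v -> SL w -> v <> w ->
  vor (x - e v)%R -> vor (x - e w)%R -> ties x = +oo.
Proof.
move=> Sv Sw vw Vv Vw; apply/eqP; rewrite -leye_eq.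
have h : sqnorm (x - e v)%R = sqnorm (x - e w)%R.
  have le1 (a b : E) : SL a -> SL b -> vor (x - e a)%R ->
      (sqnorm (x - e a) <= sqnorm (x - e b))%R.
    move=> Sa Sb /(_ (e (b - a)%R)); rewrite -addrA -opprD -(embeddingD eB).
    rewrite [(a + _)%R]addrC subrK; apply; exists (b - a)%R => //; exact: code_latticeB.
  by apply/eqP; rewrite eq_le !le1.
rewrite -[X in X <= _](_ : +oo * (\1_[set x | sqnorm (x - e (v, w).1) = sqnorm (x - e (v, w).2)]%R x)%:E = +oo); last first.
  by rewrite indicE mem_set// mule1.
apply: (@esum_ge_term _ _ [set p : E * E | p.1 <> p.2] (fun p => (+oo *
    (\1_[set x | sqnorm (x - e p.1) = sqnorm (x - e p.2)]%R x)%:E))) => // p _.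
Qed.

Section WeightedVoronoi.
Variable c : 'rV[R]_n -> R.
Hypothesis mc : vmeasurable (fun x => (c x)%:E).
Hypothesis c0 : forall x, (0 <= c x)%R.
Let k x := (\1_vor x * c x)%R.

Let mk : vmeasurable (fun x => (k x)%:E).
Proof.
apply: vmeasurable_EFinM => //.
by apply: vmeasurable_indic; exact: vmeasurable_voronoi.
Qed.

Let k0 x : (0 <= k x)%R. Proof. by rewrite mulr_ge0. Qed.

Let TE x : code_sum e Q rep k enc x = \esum_(v in SL) (k (x - e v)%R)%:E.
Proof.
rewrite (esum_code_lattice (h := fun v => (k (x - e v)%R)%:E))// => v.
by rewrite lee_fin; exact: k0.
Qed.

(** By folding, the left-hand side is the integral over [D] of the sum of [k] over all lattice
    translates. Off the ties this sum has one term, the value of [c] at [x] minus its nearest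
    lattice point; [ties] absorbs the remaining points at no cost, its integral being 0. *)
Lemma vint_voronoi_le (B : 'rV[R]_n -> \bar R) : vmeasurable B ->
  (forall x, 0 <= B x) ->
  (forall x v, SL v -> vor (x - e v)%R -> (c (x - e v)%R)%:E <= B x) ->
  #|W|%:R%:E * vint (fun x => (k x)%:E) <= vint (fun x => (\1_D x)%:E * B x).
Proof.
move=> mB B0 cB; have [mD _ _] := fD.
rewrite -(vint_code_sum1 eB cE Q0 QB rep mk k0 fD enc).
have mDB : vmeasurable (fun x => (\1_D x)%:E * B x).
  by apply: vmeasurableM => //; exact: vmeasurable_indic.
have DB0 x : 0 <= (\1_D x)%:E * B x by rewrite mule_ge0// lee_fin.
rewrite -[X in _ <= X]adde0 -vint_ties -(vintD mDB vmeasurable_ties DB0 ties_ge0).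
apply: le_vint => x; first by rewrite mule_ge0 ?code_sum_ge0// lee_fin.
have [tx|tx] := pselect (ties x = +oo).
  by rewrite tx addey ?leey// gt_eqF// (lt_le_trans (ltNyr 0%R))// mule_ge0// lee_fin.
apply: (@le_trans _ _ ((\1_D x)%:E * B x)); last by rewrite leeDl// ties_ge0.
rewrite lee_wpmul2l ?lee_fin// TE.
have [v Sv Vv] := voronoi_cover x.
rewrite (esum_single (v := v))//.
- by rewrite /k indicE mem_set// mul1r; exact: cB.
- by move=> w _; rewrite lee_fin; exact: k0.
- move=> w Sw wv; rewrite /k indicE memNset ?mul0r// => Vw; apply: tx.
  exact: voronoi_ties wv Vw Vv.
Qed.

(** For a lower bound it is enough to keep one nearest lattice point, so ties need no care. *)
Lemma vint_voronoi_ge (b : R) : (0 <= b)%R ->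
  (forall x v, SL v -> vor (x - e v)%R -> b <= c (x - e v))%R ->
  vint (fun x => (\1_D x)%:E * b%:E) <= #|W|%:R%:E * vint (fun x => (k x)%:E).
Proof.
move=> b0 cB; have [mD _ _] := fD.
rewrite -(vint_code_sum1 eB cE Q0 QB rep mk k0 fD enc).
apply: le_vint => x; first by rewrite mule_ge0// lee_fin.
rewrite lee_wpmul2l ?lee_fin// TE.
have [v Sv Vv] := voronoi_cover x.
apply: (@le_trans _ _ (k (x - e v)%R)%:E).
  by rewrite /k indicE mem_set// mul1r lee_fin; exact: cB.
by apply: (@esum_ge_term _ _ SL (fun v => (k (x - e v)%R)%:E)) => // w _; rewrite lee_fin.
Qed.

End WeightedVoronoi.

End Voronoi.

(** * Coordinate boxes and construction A *)

Section BaseRing.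
Variables (R : realType) (B : base_ring R).
Local Notation d := (bdim B).
Variable beta : 'I_d -> R.
Hypothesis beta_gt0 : forall j, 0 < beta j.
Hypothesis beta_le1 : forall j, beta j <= 1.
Hypothesis embB : {morph @embed R B : x y / x - y}.
Hypothesis emb_min : forall z : B, z <> 0 -> 1 <= sqnorm (embed z).
Hypothesis emb_ex : forall x : 'rV[R]_d, exists z : B,
  forall j, 0 <= (x - embed z) 0 j < beta j.
Hypothesis emb_un : forall (x : 'rV[R]_d) (z z' : B),
  (forall j, 0 <= (x - embed z) 0 j < beta j) ->
  (forall j, 0 <= (x - embed z') 0 j < beta j) -> z = z'.
Variable N : nat.
Local Notation n := (N * d)%N.
Local Notation E := 'cV[B]_N.
Local Notation e := (@embed_vector R B N).

Lemma embed_vectorB : {morph e : x y / x - y}.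
Proof.
move=> x y; apply/rowP => k; case/mxvec_indexP: k => i j.
by rewrite [RHS]mxE [in RHS]mxE !mxvecE !mxE embB !mxE.
Qed.

Lemma sqnorm_embed_vector (v : E) :
  sqnorm (e v) = \sum_(i < N) sqnorm (embed (v i 0)).
Proof.
rewrite /sqnorm pair_big (reindex _ (curry_mxvec_bij _ _))/=.
by apply: eq_bigr => -[i j] _ /=; rewrite mxvecE mxE.
Qed.

Lemma sqnorm_embed_vector_ge1 (v : E) : v <> 0 -> 1 <= sqnorm (e v).
Proof.
move=> v0; have [i vi] : exists i, v i 0 <> 0.
  apply: contrapT => /forallNP h; apply: v0; apply/colP => i.
  by rewrite mxE; have /contrapT := h i.
rewrite sqnorm_embed_vector (bigD1 i)//= (le_trans (emb_min vi))// lerDl.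
by apply: sumr_ge0 => j _; exact: sqnorm_ge0.
Qed.

Lemma embed_vector_inj : injective e.
Proof.
move=> x y exy; apply/eqP; rewrite -subr_eq0; apply: contraT => /eqP xy.
have := sqnorm_embed_vector_ge1 xy; rewrite embed_vectorB exy subrr.
by rewrite /sqnorm big1 ?ler10// => i _; rewrite mxE expr0n.
Qed.

(** A rectangular cell is fundamental even for the Eisenstein integers: these lie in rows at heights
    multiple of sqrt 3 / 2, each row being a translate of Z. *)
Definition box : set 'rV[R]_n := [set x | forall (i : 'I_N) (j : 'I_d),
  0 <= x 0 (mxvec_index i j) < beta j].

Lemma box_sqnorm x : box x -> sqnorm x <= n%:R.
Proof.
move=> bx; rewrite /sqnorm -[X in X%:R]card_ord -sumr_const.
apply: ler_sum => k _; case/mxvec_indexP: k => i j.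
have /andP[x0 /ltW x1] := bx i j.
by rewrite expr_le1// (le_trans x1).
Qed.

Lemma vmeasurable_box : vmeasurable_set box.
Proof.
rewrite /vmeasurable_set.
have -> : [set t | box (tuple_row t)] = \bigcap_(k in [set: 'I_N * 'I_d])
   ((fun t : n.-tuple (measurableTypeR R) => tnth t (mxvec_index k.1 k.2))
     @^-1` `[0, beta k.2[%classic).
  apply/seteqP; split => t /=.
    by move=> bt [i j] _ /=; have := bt i j; rewrite mxE in_itv.
  by move=> bt i j; have := bt (i, j) I; rewrite /= mxE in_itv.
apply: fin_bigcap_measurable => // k _.
rewrite -[X in measurable X]setTI; apply: measurable_tnth => //.
Qed.

Lemma vint_box : vint (fun x => (\1_box x)%:E) = ((\prod_j beta j) ^+ N)%:E.
Proof.
pose bk (k : 'I_n) : R := (mxvec (\matrix_(i < N, j < d) beta j)) 0 k.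
have bk0 k : 0 < bk k.
  by case/mxvec_indexP: k => i j; rewrite /bk mxvecE mxE.
transitivity (\int[lebesgue_tuple R n]_t
   (\prod_(k < n) (\1_(`[0, bk k[%classic) (tnth t k) : R))%:E)%E.
  apply: eq_integral => t _; congr EFin.
  rewrite [LHS]indicE; have [/set_mem bt|bt] := boolP (_ \in box).
    rewrite big1// => k _; rewrite indicE mem_set//=.
    case/mxvec_indexP: k => i j.
    by have := bt i j; rewrite !mxE in_itv/= /bk mxvecE mxE.
  apply/esym/eqP/prodf_eq0; apply: contrapT => h.
  move/negP: bt; apply; apply/mem_set => i j.
  have [|xk] := boolP (tnth t (mxvec_index i j) \in `[0, bk (mxvec_index i j)[%classic).
    by move/set_mem; rewrite /= in_itv/= /bk mxvecE !mxE.
  by case: h; exists (mxvec_index i j) => //; rewrite indicE (negbTE xk).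
rewrite (@ge0_integral_tuple_prod R n (fun k => \1_(`[0, bk k[%classic)))//.
rewrite [LHS](eq_bigr (fun k => (bk k)%:E)); last first.
  move=> k _; rewrite integral_indic// setIT.
  have := @lebesgue_measure_itv R `[0, bk k[%R.
  by rewrite /= lte_fin bk0 sube0.
rewrite prodEFin; congr EFin.
rewrite (reindex _ (curry_mxvec_bij _ _))/=.
rewrite -[X in _ ^+ X](card_ord N) -prodr_const pair_big/=.
by apply: eq_bigr => -[i j] _; rewrite /bk mxvecE mxE.
Qed.

Lemma embed_vector_coord (x : 'rV[R]_n) (v : E) i j :
  (x - e v) 0 (mxvec_index i j) = (row i (vec_mx x) - embed (v i 0)) 0 j.
Proof. by rewrite mxE [in LHS]mxE mxvecE !mxE. Qed.

Lemma fundamental_box : fundamental e [set: E] box.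
Proof.
split; first exact: vmeasurable_box.
  move=> x; pose X := vec_mx x.
  have /choice[f fP] : forall i, exists z : B,
      forall j, 0 <= (row i X - embed z) 0 j < beta j by move=> i; exact: emb_ex.
  exists (\col_i f i) => // i j.
  by rewrite embed_vector_coord mxE; exact: fP.
move=> x v w _ _ bv bw; apply/colP => i.
by apply: (emb_un (x := row i (vec_mx x))) => j; rewrite -embed_vector_coord.
Qed.

Variable p : nat.
Hypothesis p_gt0 : (0 < p)%N.

Definition coarse : set E := [set v | exists u : E, v = p%:R *: u].

Lemma coarse0 : coarse 0. Proof. by exists 0; rewrite scaler0. Qed.

Lemma coarseB x y : coarse x -> coarse y -> coarse (x - y).
Proof. by move=> [u ->] [v ->]; exists (u - v); rewrite scalerBr. Qed.

Lemma embed_vector_coarse (u : E) : e (p%:R *: u) = p%:R *: e u.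
Proof.
rewrite !scaler_nat.
elim: p => [|k IH]; first by rewrite !mulr0n (embedding0 embed_vectorB).
by rewrite !mulrS (embeddingD embed_vectorB) IH.
Qed.

Lemma sqnorm_coarse u : coarse u -> u <> 0 -> p%:R ^+ 2 <= sqnorm (e u).
Proof.
move=> [v ->] pv0; rewrite embed_vector_coarse sqnormZ.
rewrite ler_peMr ?sqr_ge0//; apply: sqnorm_embed_vector_ge1 => v0.
by apply: pv0; rewrite v0 scaler0.
Qed.

Definition coarse_box : set 'rV[R]_n := [set x | box (p%:R^-1 *: x)].

Let pR : p%:R != 0 :> R. Proof. by rewrite pnatr_eq0 -lt0n. Qed.

Lemma coarse_boxE x u : coarse_box (x - e (p%:R *: u)) = box (p%:R^-1 *: x - e u).
Proof.
rewrite /coarse_box /= embed_vector_coarse scalerBr scalerA mulVf//.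
by rewrite scale1r.
Qed.

Lemma fundamental_coarse_box : fundamental e coarse coarse_box.
Proof.
have [mb ex un] := fundamental_box; split.
- have := vmeasurable_affine_set p%:R^-1 0 mb.
  by under eq_set do rewrite addr0.
- move=> x; have [u _ bu] := ex (p%:R^-1 *: x).
  by exists (p%:R *: u); [exists u|rewrite coarse_boxE].
- move=> x _ _ [u ->] [v ->]; rewrite !coarse_boxE => bu bv.
  by congr (_ *: _); exact: un bu bv.
Qed.

Lemma vint_coarse_box :
  vint (fun x => (\1_coarse_box x)%:E) = (p%:R ^+ n * (\prod_j beta j) ^+ N)%:E.
Proof.
have p0 : 0 < p%:R :> R by rewrite ltr0n.
have [mD _ _] := fundamental_coarse_box.
rewrite (ge0_vint_affine 0 p0 (vmeasurable_indic mD)); last first.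
  by move=> x; rewrite lee_fin.
rewrite EFinM -vint_box; congr (_ * _)%E; apply: eq_vint => x.
rewrite addr0 !indicE; congr ((nat_of_bool _)%:R%:E).
by apply/idP/idP => /set_mem h; apply/mem_set; move: h;
  rewrite /coarse_box /= scalerA mulVf// scale1r.
Qed.

Lemma coarse_cover x : exists2 u, coarse u & sqnorm (x - e u) <= p%:R ^+ 2 * n%:R.
Proof.
have [_ ex _] := fundamental_box; have [u _ bu] := ex (p%:R^-1 *: x).
exists (p%:R *: u); first by exists u.
rewrite embed_vector_coarse.
have -> : x - p%:R *: e u = p%:R *: (p%:R^-1 *: x - e u).
  by rewrite scalerBr scalerA mulfV// scale1r.
by rewrite sqnormZ ler_wpM2l ?sqr_ge0// box_sqnorm.
Qed.

Hypothesis countB : countable [set: B].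

Lemma countable_vectors : countable [set: E].
Proof.
have /countable_injP[f finj] := countB.
apply/countable_injP; exists (fun v => choice.pickle (map_mx f v)) => v w _ _.
move=> /(pcan_inj choice.pickleK)/matrixP h; apply/matrixP => i j.
by apply: finj; rewrite ?in_setT//; have := h i j; rewrite !mxE.
Qed.

(** The Gaussian sum over the lattice is finite, and every point of the ball contributes at least a
    fixed positive amount to it. *)
Lemma finite_vector_ball (x : 'rV[R]_n) rho :
  finite_set [set v : E | sqnorm (x - e v) <= rho].
Proof.
have v0 : 0 < (\prod_j beta j) ^+ N by rewrite exprn_gt0// prodr_gt0.
have := esum_gauss_le embed_vectorB countable_vectors (S := [set: E]) I
  (fun _ _ _ _ => I) fundamental_box x ltr01 box_sqnorm vint_box v0.
move=> /le_lt_trans => /(_ _ (ltry _)) lty.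
pose c := Num.sqrt (1 / pi) ^+ n * expR (- rho) : R.
have c0 : 0 < c by rewrite mulr_gt0 ?expR_gt0// exprn_gt0// sqrtr_gt0 divr_gt0// pi_gt0.
have := esum_lty_finite c0 (fun v => gauss_ge0 1 (x - e v)) lty.
apply: sub_finite_set => v /= vr; split=> //=.
rewrite /gauss ler_wpM2l ?exprn_ge0 ?sqrtr_ge0//.
by rewrite ler_expR mulN1r lerN2.
Qed.

End BaseRing.

Lemma min_energy_rep (T U : Type) (f : T -> U) (h : T -> nat) :
  (forall y, exists x, f x = y) ->
  exists M : U -> T, (forall y, f (M y) = y) /\
    forall y z, f z = y -> (h (M y) <= h z)%N.
Proof.
move=> fsurj.
have /choice[M MP] : forall y, exists x, f x = y /\ forall z, f z = y -> (h x <= h z)%N.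
  move=> y; have [x0 fx0] := fsurj y.
  have ex : exists k, `[< exists x, f x = y /\ h x = k >].
    by exists (h x0); apply/asboolP; exists x0.
  have [k /asboolP[x [fx hx]] kmin] := ex_minnP ex.
  exists x; split=> // z fz; rewrite hx; apply: kmin.
  by apply/asboolP; exists z.
by exists M; split => [y|y z]; have [MP1 MP2] := MP y; [exact: MP1|exact: MP2].
Qed.

(** * Construction A and its decoder *)

Section ConstructionA.
Variables (R : realType) (B : base_ring R) (p : nat) (F : finFieldType).
Hypothesis adm : @admissible_primes R B 1 (fun=> p%:R).
Hypothesis cardF : #|F| = bnorm (p%:R : B).
Variable pi : B -> F.
Hypothesis piB : {morph pi : x y / x - y}.
Hypothesis piM : {morph pi : x y / x * y}.
Hypothesis pi1 : pi 1 = 1.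
Hypothesis pi_ker : forall x, pi x = 0 <-> ring_dvd (p%:R : B) x.
Variable M : F -> B.
Hypothesis MK : forall y, pi (M y) = y.
Hypothesis Mmin : forall y z, pi z = y -> (bnorm (M y) <= bnorm z)%N.

Lemma congr_modP (x y : B) : congr_mod (p%:R : B) x y <-> pi x = pi y.
Proof.
rewrite /congr_mod -pi_ker piB; split=> [/eqP|->]; last exact: subrr.
by rewrite subr_eq0 => /eqP.
Qed.

Let piD : {morph pi : x y / x + y}.
Proof.
move=> x y; have pi0 : pi 0 = 0 by rewrite -(subrr 0) piB subrr.
by rewrite -[y in LHS]opprK piB -[in LHS](sub0r y) piB pi0 sub0r opprK.
Qed.

Lemma construction_A_iso : @ring_iso_mod B (\prod_(l < 1) (p%:R : B)) 'I_1
  (fun=> F) (fun x => M (x ord0)).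
Proof.
rewrite big_ord1; split; first by apply/congr_modP; rewrite MK pi1.
split; first by move=> x y; apply/congr_modP; rewrite piD !MK.
split; first by move=> x y; apply/congr_modP; rewrite piM !MK.
split.
  move=> x y /congr_modP; rewrite !MK => xy.
  by apply/funext => l; rewrite (ord1 l).
by move=> z; exists (fun=> pi z); apply/congr_modP; rewrite MK.
Qed.

Lemma construction_A_min (x : 'I_1 -> F) (z : B) :
  congr_mod (\prod_(l < 1) (p%:R : B)) (M (x ord0)) z ->
  (bnorm (M (x ord0)) <= bnorm z)%N.
Proof. by rewrite big_ord1 => /congr_modP; rewrite MK => h; exact: Mmin. Qed.

Variables (N m : nat).

Definition construction_A (G : 'M[F]_(N, m)) : product_data B N :=
  @ProductData R B N 1 isT (fun=> p%:R) adm (fun=> F) (fun=> cardF)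
    (fun x => M (x ord0)) construction_A_iso construction_A_min
    (fun=> m) (fun=> G).

Definition word_rep (c : 'cV[F]_N) : 'cV[B]_N := \col_i M (c i 0).

Local Notation Q := (@coarse R B N p).

Lemma coarseP (v : 'cV[B]_N) : Q v <-> forall i, pi (v i 0) = 0.
Proof.
split=> [[u ->] i|h].
  by rewrite mxE; apply/pi_ker; exists (u i 0); rewrite mulrC.
have /choice[u uP] : forall i, exists z, v i 0 = z * p%:R.
  by move=> i; have /pi_ker := h i.
exists (\col_i u i); apply/colP => i; rewrite !mxE mulrC; exact: uP.
Qed.

Lemma word_repB c c' : Q (word_rep (c - c') - (word_rep c - word_rep c')).
Proof. by apply/coarseP => i; rewrite !mxE !piB !MK subrr. Qed.

Lemma word_rep_ex v : exists c, Q (v - word_rep c).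
Proof.
exists (\col_i pi (v i 0)); apply/coarseP => i.
by rewrite !mxE piB MK subrr.
Qed.

Lemma word_rep_inj c c' : Q (word_rep c - word_rep c') -> c = c'.
Proof.
move/coarseP => h; apply/colP => i; have := h i; rewrite !mxE piB !MK.
by move/eqP; rewrite subr_eq0 => /eqP.
Qed.

Variable G : 'M[F]_(N, m).
(** Seen from the sent point [v], the decoded coset is that of the codeword G (wh - w) up to [Q]:
    linearity makes it one of the nonzero terms on the right. *)
Lemma coset_fold_le (h : 'cV[B]_N -> \bar R) v (w wh : 'cV[F]_m) u0 :
  (forall v', 0 <= h v')%E -> Q u0 -> v = word_rep (G *m w) + u0 ->
  G *m (wh - w) != 0 ->
  (\esum_(u in Q) h (word_rep (G *m wh) + u - v)%R <=
   \sum_(w' : 'cV[F]_m | G *m w' != 0%R) \esum_(u in Q) h (word_rep (G *m w') + u)%R)%E.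
Proof.
move=> h0 Qu0 vE neqw.
pose H w := (\esum_(u in Q) h (word_rep (G *m w) + u)%R)%E.
have H0 w' : (0 <= H w')%E by apply: esum_ge0 => u1 _; exact: h0.
have cosets_eq : Q (word_rep (G *m wh) - v - word_rep (G *m (wh - w))).
  have -> : word_rep (G *m wh) - v - word_rep (G *m (wh - w)) =
      - (word_rep (G *m wh - G *m w) - (word_rep (G *m wh) - word_rep (G *m w))) - u0.
    rewrite vE mulmxBr opprD opprB.
    by rewrite !addrA [in RHS]addrAC; congr (_ - _); rewrite addrAC.
  apply: coarseB => //; rewrite -sub0r; apply: coarseB; first exact: coarse0.
  exact: word_repB.
have cosE := esum_coset (@coarse0 R B N p) (@coarseB R B N p) h cosets_eq.
apply: (@le_trans _ _ (H (wh - w))).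
  rewrite /H -cosE le_eqVlt; apply/orP; left; apply/eqP.
  by apply: eq_esum => u _; rewrite addrAC.
rewrite -[leRHS]/(\sum_(w' | G *m w' != 0%R) H w')%E.
by rewrite (bigD1 (wh - w) neqw) leeDl//; apply: sume_ge0.
Qed.

Local Notation P := (construction_A G).
Local Notation e := (@embed_vector R B N).
Local Notation n := (N * bdim B)%N.

Lemma construction_A_coarse : coarse_vectors P = Q.
Proof.
by apply/seteqP; split => v [u ->]; exists u; rewrite /modulus big_ord1.
Qed.

Lemma construction_A_map_words (c : words P) : map_words c = word_rep (c ord0).
Proof. by apply/colP => i; rewrite !mxE. Qed.

Definition const_word (c : 'cV[F]_N) : words P := [ffun=> c].

Lemma construction_A_code (l : 'I_1) (c : 'cV[F]_N) :
  (c \in linear_code P l) <-> exists w : 'cV[F]_m, c = G *m w.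
Proof.
split; first by move=> /imsetP[w _ ->]; exists w.
by move=> [w ->]; apply/imsetP; exists w.
Qed.

Lemma construction_A_lattice : product_lattice P =
  e @` code_lattice Q word_rep (fun w : 'cV[F]_m => G *m w).
Proof.
rewrite /product_lattice /product_vectors construction_A_coarse.
congr (_ @` _); apply/seteqP; split => v.
  move=> [c [cC [u Qu ->]]].
  have /construction_A_code[w wE] := cC ord0.
  exists w; rewrite construction_A_map_words wE addrC addKr//.
move=> [w Qw]; exists (const_word (G *m w)); split.
  by move=> l; apply/construction_A_code; exists w; rewrite ffunE.
exists (v - word_rep (G *m w)) => //.
by rewrite construction_A_map_words ffunE addrC subrK.
Qed.

(** With one level no word is already decoded and none is left unknown, so exactly one word is
    compatible with [c]. *)
Lemma construction_A_likelihood a eta y (l : 'I_1) (prev : words P)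
    (c : 'cV[F]_N) :
  @level_likelihood R B N P a eta y l prev c =
  folded_density P a eta y (word_rep c).
Proof.
rewrite /level_likelihood.
have -> : @compatible R B N P l prev c = [set const_word c]%SET.
  apply/setP => w; rewrite !inE; apply/andP/eqP => [[_ /eqP wl]|->].
    by apply/ffunP => j; rewrite ffunE -wl (ord1 j) (ord1 l).
  split; last by rewrite ffunE.
  by apply/forallP => j; rewrite (ord1 j) (ord1 l).
rewrite cards1 invr1 mul1e big_set1 construction_A_map_words.
by rewrite ffunE.
Qed.

Hypothesis embB : {morph @embed R B : x y / x - y}.
Hypothesis emb_min : forall z : B, z <> 0 -> 1 <= sqnorm (embed z).
Hypothesis p_gt0 : (0 < p)%N.

Lemma code_lattice_factor v : code_lattice Q word_rep (fun w : 'cV[F]_m => G *m w) v ->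
  exists w u, Q u /\ v = word_rep (G *m w) + u.
Proof.
move=> [w Qw]; exists w, (v - word_rep (G *m w)); split=> //.
by rewrite addrC subrK.
Qed.

Definition decoding_failure a eta : set 'rV[R]_n := [set z |
  ((gaussian_density eta z)%:E <= \sum_(w : 'cV[F]_m | G *m w != 0%R)
    \esum_(u in Q) (gaussian_density eta (z - a *: e (word_rep (G *m w) + u)))%:E)%E].

(** If the decoded codeword is right, the last step has chosen a wrong point of the scaled Lambda',
    so the noise is at least half as long as its shortest nonzero vectors. Otherwise maximum
    likelihood bounds the noise density, one term of the folded density of the true coset, by the
    folded density of another coset. Neither event depends on the sent point. *)
Lemma decoder_error_sub a eta x :
  0 < a -> scale_set a (product_lattice P) x ->
  [set z | exists2 xhat, decoder_output P a eta (x + z) xhat & xhat <> x]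
  `<=` [set z | (a * p%:R) ^+ 2 / 4 <= sqnorm z] `|` decoding_failure a eta.
Proof.
move=> a0 [xl]; rewrite construction_A_lattice => -[v Sv <-] <-.
move=> z [_ [chat dec [u Qu [-> near]]] neq].
have eB : {morph e : x y / x - y} := embed_vectorB embB (N := N).
have [w [u0 [Qu0 vE]]] := code_lattice_factor Sv.
have [/construction_A_code[wh chE] chmax] := dec ord0.
rewrite construction_A_coarse in Qu near.
rewrite construction_A_map_words chE in neq near.
pose y := a *: e v + z.
have yE v' : y - a *: e v' = z - a *: e (v' - v).
  by rewrite /y eB scalerBr opprB [a *: e v + z]addrC addrA.
have [eqw|neqw] := eqVneq (G *m (wh - w)) 0.
  left => /=.
  have whw : G *m wh = G *m w by apply/eqP; rewrite -subr_eq0 -mulmxBr eqw.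
  have uu0 : u - u0 <> 0.
    by move/eqP; rewrite subr_eq0 => /eqP uu0; apply: neq; rewrite vE whw uu0.
  pose lam := a *: e (u - u0).
  have zlam : sqnorm (z - lam) <= sqnorm z.
    have := near u0 Qu0; rewrite -/y !yE whw -vE subrr (embedding0 eB) scaler0 subr0.
    by rewrite vE opprD addrACA subrr add0r.
  have lam4 : sqnorm lam <= 4 * sqnorm z.
    have -> : lam = z - (z - lam) by rewrite opprB addrC subrK.
    apply: le_trans (sqnormB_le _ _) _.
    by move: zlam; set s := sqnorm z; set t := sqnorm _; lra.
  rewrite ler_pdivrMr// [leRHS]mulrC; apply: le_trans lam4.
  rewrite sqnormZ exprMn ler_wpM2l ?sqr_ge0//.
  by apply: (@sqnorm_coarse R B embB emb_min N p (u - u0)) => //; exact: coarseB.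
right => /=.
pose h v' : \bar R := (gaussian_density eta (z - a *: e v'))%:E.
have h0 v' : (0 <= h v')%E.
  by rewrite lee_fin; apply: prodr_ge0 => k _; exact: normal_pdf_ge0.
have foldE c : folded_density P a eta y (word_rep c) =
    (\esum_(u in Q) h (word_rep c + u - v)%R)%E.
  rewrite /folded_density construction_A_coarse; apply: eq_esum => u' _.
  by rewrite yE.
have Cw : G *m w \in linear_code P ord0 by apply/construction_A_code; exists w.
have := chmax _ Cw; rewrite !construction_A_likelihood chE -/y !foldE => le_fold.
have hz : h (word_rep (G *m w) + u0 - v) = (gaussian_density eta z)%:E.
  by rewrite /h -vE subrr (embedding0 eB) scaler0 subr0.
rewrite /decoding_failure /= -hz.
apply: (@le_trans _ _ (\esum_(u in Q) h (word_rep (G *m w) + u - v)%R)%E).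
  by apply: (@esum_ge_term _ _ Q (fun u => h (word_rep (G *m w) + u - v))).
apply: le_trans le_fold _.
exact: (coset_fold_le h0 Qu0 vE neqw).
Qed.
End ConstructionA.

(** * Union bound for the decoder *)

Section NoiseBound.
Variables (R : realType) (n : nat) (E : choiceType) (S : set E).
Hypothesis cS : countable S.
Variables (I : finType) (Pr : pred I) (lam : I -> E -> 'rV[R]_n).
Variables (eta rho : R).
Hypothesis eta_gt0 : 0 < eta.
Hypothesis rho_gt1 : 1 < rho.
Let s := (2 * eta ^+ 2)^-1.
Let s_gt0 : 0 < s. Proof. by rewrite invr_gt0 mulr_gt0// exprn_gt0. Qed.
Local Open Scope ereal_scope.

(** For s' = s this is t^-1 * gauss (s / 2) v, with [t] the noise density on the sphere of squared
    radius n rho eta^2. The powers of s / pi cancel, which leaves a function nonincreasing in the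
    parameter: a larger [s'], that is a weaker noise, only improves the bound. *)
Definition theta_weight (s' : R) (v : 'rV[R]_n) : R :=
  (Num.sqrt 2^-1 ^+ n * expR (n%:R * rho / 2) * expR (- (s' / 2) * sqnorm v))%R.

Lemma theta_weight_ge0 s' v : (0 <= theta_weight s' v)%R.
Proof. by rewrite !mulr_ge0 ?expR_ge0// exprn_ge0// sqrtr_ge0. Qed.

Let t := (Num.sqrt (s / pi) ^+ n * expR (- (n%:R * rho / 2)))%R.
Let t_gt0 : (0 < t)%R.
Proof. by rewrite mulr_gt0 ?expR_gt0// exprn_gt0// sqrtr_gt0 divr_gt0// pi_gt0. Qed.

Lemma gauss_half_theta (v : 'rV[R]_n) : (t^-1 * gauss (s / 2) v)%R = theta_weight s v.
Proof.
rewrite /t /gauss /theta_weight invfM -expRN opprK.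
rewrite (_ : Num.sqrt (s / 2 / pi) = Num.sqrt (s / pi) * Num.sqrt 2^-1)%R.
  rewrite exprMn; set k := (Num.sqrt (s / pi) ^+ n)%R.
  have k0 : k != 0%R.
    by rewrite gt_eqF// exprn_gt0// sqrtr_gt0 divr_gt0// pi_gt0.
  by field.
by rewrite -sqrtrM ?divr_ge0 ?(ltW s_gt0) ?pi_ge0//; congr Num.sqrt; rewrite mulrAC.
Qed.

Let F z : \bar R := \sum_(i | Pr i) \esum_(u in S)
  (gaussian_density eta (z - lam i u)%R)%:E.

Let mg v : vmeasurable (fun z : 'rV[R]_n => (gauss s (z - v)%R)%:E).
Proof. exact: (vmeasurable_shift (- v)%R (@vmeasurable_gauss R n s)). Qed.

(* On the ball where the noise density g is at least [t], the failure event
   g z <= F z gives g z <= t^-1 * g z * F z, and the integral of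
   z |-> gauss s z * gauss s (z - v) is gauss (s / 2) v. *)
Lemma gaussian_noise_union_le :
  gaussian_noise eta ([set z | n%:R * rho * eta ^+ 2 <= sqnorm z]%R `|`
    [set z | (gaussian_density eta z)%:E <= F z]) <=
  (Num.sqrt (rho * expR (1 - rho)) ^+ n)%:E +
  \sum_(i | Pr i) \esum_(u in S) (theta_weight s (lam i u))%:E.
Proof.
have FE z : F z = \sum_(i | Pr i) \esum_(u in S) (gauss s (z - lam i u)%R)%:E.
  by apply: eq_bigr => i _; apply: eq_esum => u _; rewrite gaussian_densityE.
have nE : (n%:R * rho * eta ^+ 2 = n%:R * rho / (2 * s))%R.
  by rewrite /s; field; rewrite gt_eqF.
pose S1 : set 'rV[R]_n := [set z | (n%:R * rho / (2 * s))%:E <= (sqnorm z)%:E].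
have mF : vmeasurable F.
  have -> : F = fun z => \sum_(i : I) (if Pr i then
      \esum_(u in S) (gauss s (z - lam i u)%R)%:E else 0).
    by apply/funext => z; rewrite FE big_mkcond.
  apply: vmeasurable_sum => i; case: (Pr i); last exact: vmeasurable_cst.
  by apply: vmeasurable_esum => // u z _; rewrite lee_fin gauss_ge0.
have F0 z : 0 <= F z.
  by rewrite FE; apply: sume_ge0 => i _; apply: esum_ge0 => u _; rewrite lee_fin gauss_ge0.
pose S2 : set 'rV[R]_n := [set z | t%:E <= F z].
have mS1 : vmeasurable_set S1.
  by apply: vmeasurable_set_le; [exact: vmeasurable_cst|exact: vmeasurable_sqnorm].
have mS2 : vmeasurable_set S2.
  by apply: vmeasurable_set_le => //; exact: vmeasurable_cst.
pose U := S1 `|` S2.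
have mU : vmeasurable_set U by exact: measurableU.
apply: (@le_trans _ _ (gaussian_noise eta U)).
  apply: le_gaussian_noise => z [/= nz|/= gF].
    by left; rewrite /S1 /= lee_fin -nE.
  have [z1|z1] := leP (n%:R * rho / (2 * s))%R (sqnorm z).
    by left; rewrite /S1 /= lee_fin.
  right; rewrite /S2 /=; apply: le_trans gF; rewrite lee_fin gaussian_densityE//.
  rewrite /t /gauss ler_wpM2l ?exprn_ge0 ?sqrtr_ge0// ler_expR mulNr lerN2.
  have -> : (n%:R * rho / 2 = s * (n%:R * rho / (2 * s)))%R by field; rewrite gt_eqF.
  by rewrite ler_pM2l// ltW.
rewrite gaussian_noiseE//.
pose K := (Num.sqrt (rho * expR (1 - rho)) ^+ n)%R.
have K0 : (0 <= K)%R by rewrite exprn_ge0// sqrtr_ge0.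
have rho0 : (0 < rho)%R by exact: lt_trans rho_gt1.
have mgF : vmeasurable (fun z => (gauss s z)%:E * F z).
  by apply: vmeasurableM => //; exact: vmeasurable_gauss.
have gF0 z : 0 <= (gauss s z)%:E * F z by rewrite mule_ge0// lee_fin gauss_ge0.
apply: (@le_trans _ _ (vint (fun z => K%:E * (gauss (s / rho) z)%:E +
    t^-1%:E * ((gauss s z)%:E * F z)))).
  apply: le_vint => z.
    by rewrite mule_ge0 ?lee_fin//; apply: prodr_ge0 => i _; exact: normal_pdf_ge0.
  have a0 : 0 <= K%:E * (gauss (s / rho) z)%:E.
    by rewrite mule_ge0// lee_fin// gauss_ge0.
  have b0 : 0 <= t^-1%:E * ((gauss s z)%:E * F z).
    by rewrite mule_ge0// lee_fin// invr_ge0 ltW.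
  rewrite gaussian_densityE// indicE; have [/set_mem zU|_] := boolP (z \in U).
    rewrite mule1; case: zU => [z1|z2].
      apply: le_trans (leeDl _ b0); rewrite -EFinM lee_fin.
      apply: gauss_chernoff => //; rewrite mulr_ge0 ?subr_ge0 ?(ltW rho_gt1)//.
    apply: le_trans (leeDr _ a0).
    rewrite muleCA -[X in X <= _]mule1 lee_wpmul2l ?lee_fin ?gauss_ge0//.
    by rewrite lee_pdivlMl// mule1.
  by rewrite mule0 adde_ge0.
rewrite vintD; first last.
- by move=> z; rewrite mule_ge0// lee_fin// invr_ge0 ltW.
- by move=> z; rewrite mule_ge0// lee_fin// gauss_ge0.
- by apply: vmeasurableM => //; exact: vmeasurable_cst.
- by apply: vmeasurableM; [exact: vmeasurable_cst|exact: vmeasurable_gauss].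
rewrite (vintZ (@vmeasurable_gauss R n (s / rho))); last 2 first.
- by move=> z; rewrite lee_fin gauss_ge0.
- by rewrite lee_fin.
rewrite vint_gauss ?divr_gt0// mule1 leeD//.
rewrite (vintZ mgF gF0); last by rewrite lee_fin invr_ge0 ltW.
have -> : vint (fun z => (gauss s z)%:E * F z) =
   \sum_(i | Pr i) \esum_(u in S) (gauss (s / 2) (lam i u))%:E.
  transitivity (vint (fun z => \sum_(i : I) (if Pr i then \esum_(u in S)
      (gauss s z * gauss s (z - lam i u)%R)%R%:E else 0))).
    apply: eq_vint => z; rewrite FE [in RHS]big_mkcond/= -[RHS]big_mkcond/=.
    rewrite ge0_sume_distrr; last first.
      by move=> i _; apply: esum_ge0 => u _; rewrite lee_fin gauss_ge0.
    apply: eq_bigr => i _; rewrite -ge0_esumZ ?lee_fin ?gauss_ge0// => u.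
    by rewrite lee_fin gauss_ge0.
  have mgg i u : vmeasurable (fun z => (gauss s z * gauss s (z - lam i u)%R)%R%:E).
    by apply: vmeasurable_EFinM => //; exact: vmeasurable_gauss.
  have gg0 i u z : 0 <= (gauss s z * gauss s (z - lam i u)%R)%R%:E.
    by rewrite lee_fin mulr_ge0// gauss_ge0.
  rewrite vint_sum; last 2 first.
  - move=> i; case: (Pr i); last exact: vmeasurable_cst.
    by apply: vmeasurable_esum => // u z _.
  - by move=> i z; case: ifP => // _; exact: esum_ge0.
  rewrite [RHS]big_mkcond; apply: eq_bigr => i _; case: ifP => Pi.
    rewrite vint_esum//; apply: eq_esum => u _; exact: vint_gauss_conv.
  by rewrite /vint integral0.
rewrite ge0_sume_distrr; last first.
  by move=> i _; apply: esum_ge0 => u _; rewrite lee_fin gauss_ge0.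
apply: lee_sum => i _; rewrite -ge0_esumZ; last 2 first.
- by rewrite lee_fin invr_ge0 ltW.
- by move=> u; rewrite lee_fin gauss_ge0.
by apply: le_esum => u _; rewrite -EFinM gauss_half_theta.
Qed.

End NoiseBound.

(** * Gaussian functions restricted to a typical shell *)

Section TypicalGauss.
Variables (R : realType) (n : nat) (s delta : R).
Hypothesis s_gt0 : 0 < s.
Hypothesis delta_gt0 : 0 < delta.
Hypothesis delta_lt1 : delta < 1.

Definition typical_shell : set 'rV[R]_n :=
  [set x | n%:R * (1 - delta) / (2 * s) <= sqnorm x <= n%:R * (1 + delta) / (2 * s)].

Definition typical_gauss (x : 'rV[R]_n) : R := gauss s x * \1_typical_shell x.

Lemma vmeasurable_typical_shell : vmeasurable_set typical_shell.
Proof.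
have := vmeasurable_setI
  (vmeasurable_set_le (@vmeasurable_cst R n (n%:R * (1 - delta) / (2 * s))%:E)
    (@vmeasurable_sqnorm R n))
  (vmeasurable_set_le (@vmeasurable_sqnorm R n)
    (@vmeasurable_cst R n (n%:R * (1 + delta) / (2 * s))%:E)).
rewrite (_ : _ `&` _ = typical_shell)//.
apply/seteqP; split => x /=; rewrite !lee_fin.
  by move=> [h1 h2]; apply/andP.
by move=> /andP[].
Qed.

Lemma typical_gauss_ge0 x : 0 <= typical_gauss x.
Proof. by rewrite mulr_ge0// gauss_ge0. Qed.

Lemma typical_gauss_le x : typical_gauss x <= gauss s x.
Proof. by rewrite ler_piMr ?gauss_ge0// indicE; case: (_ \in _). Qed.

Lemma vmeasurable_typical_gauss : vmeasurable (fun x => (typical_gauss x)%:E).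
Proof.
apply: vmeasurable_EFinM; first exact: vmeasurable_gauss.
by apply: vmeasurable_indic; exact: vmeasurable_typical_shell.
Qed.

Lemma typical_gauss_sqnorm x : typical_gauss x != 0 ->
  sqnorm x <= n%:R * (1 + delta) / (2 * s).
Proof.
rewrite /typical_gauss indicE; have [/set_mem/andP[]//|_] := boolP (_ \in _).
by rewrite mulr0 eqxx.
Qed.

(** The value of the Gaussian on the inner sphere of the shell. *)
Definition typical_max : R := Num.sqrt (s / pi) ^+ n * expR (- (n%:R * (1 - delta) / 2)).

Lemma typical_gauss_le_max x : typical_gauss x <= typical_max.
Proof.
have h0 : 0 <= typical_max by rewrite mulr_ge0 ?expR_ge0// exprn_ge0// sqrtr_ge0.
rewrite /typical_gauss indicE; have [/set_mem/andP[xl _]|_] := boolP (_ \in _); last by rewrite mulr0.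
rewrite mulr1 ler_wpM2l ?exprn_ge0 ?sqrtr_ge0// ler_expR mulNr lerN2.
have -> : n%:R * (1 - delta) / 2 = s * (n%:R * (1 - delta) / (2 * s)).
  by field; rewrite gt_eqF.
by rewrite ler_pM2l.
Qed.

(** The Chernoff rate per coordinate for the squared norm of a Gaussian vector to deviate from its
    mean by a factor [rho]. *)
Definition atypical_rate (rho : R) : R := Num.sqrt (rho * expR (1 - rho)).

(** Off the shell one of two tilted Gaussians dominates, so the lower bound follows by integrating a
    pointwise inequality, without computing a tail. *)
Lemma vint_typical_gauss : exists2 I : R,
  vint (fun x => (typical_gauss x)%:E) = I%:E &
  1 - atypical_rate (1 + delta) ^+ n - atypical_rate (1 - delta) ^+ n <= I <= 1.
Proof.
have ub : (vint (fun x => (typical_gauss x)%:E) <= 1)%E.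
  rewrite -(vint_gauss n s_gt0); apply: le_vint => x.
    by rewrite lee_fin typical_gauss_ge0.
  by rewrite lee_fin typical_gauss_le.
have lb0 : (0 <= vint (fun x => (typical_gauss x)%:E))%E.
  by apply: vint_ge0 => x; rewrite lee_fin typical_gauss_ge0.
have fE : vint (fun x => (typical_gauss x)%:E) \is a fin_num.
  by rewrite ge0_fin_numE// (le_lt_trans ub)// ltry.
exists (fine (vint (fun x => (typical_gauss x)%:E))); first by rewrite fineK.
set I := fine _; have IE : vint (fun x => (typical_gauss x)%:E) = I%:E by rewrite fineK.
apply/andP; split; last by rewrite -lee_fin -IE.
pose K1 := atypical_rate (1 + delta) ^+ n; pose K2 := atypical_rate (1 - delta) ^+ n.
have K10 : 0 <= K1 by rewrite exprn_ge0// sqrtr_ge0.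
have K20 : 0 <= K2 by rewrite exprn_ge0// sqrtr_ge0.
have r1 : 0 < 1 + delta by rewrite addr_gt0.
have r2 : 0 < 1 - delta by rewrite subr_gt0.
have : (1 <= vint (fun x => (typical_gauss x)%:E + (K1%:E * (gauss (s / (1 + delta)) x)%:E
    + K2%:E * (gauss (s / (1 - delta)) x)%:E)))%E.
  rewrite -(vint_gauss n s_gt0); apply: le_vint => x.
    by rewrite lee_fin gauss_ge0.
  rewrite -!EFinM -!EFinD lee_fin.
  have a0 := gauss_ge0 (s / (1 + delta)) x.
  have b0 := gauss_ge0 (s / (1 - delta)) x.
  rewrite /typical_gauss indicE; have [_|/negP xN] := boolP (x \in typical_shell).
    by rewrite mulr1 lerDl addr_ge0// mulr_ge0.
  rewrite mulr0 add0r.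
  have [h|h] := leP (n%:R * (1 + delta) / (2 * s)) (sqnorm x).
    apply: le_trans (_ : K1 * gauss (s / (1 + delta)) x <= _); last first.
      by rewrite lerDl mulr_ge0.
    apply: gauss_chernoff => //.
    have -> : 1 + delta - 1 = delta by ring. by rewrite mulr_ge0 ?subr_ge0 ?(ltW delta_gt0)//.
  apply: le_trans (_ : K2 * gauss (s / (1 - delta)) x <= _); last first.
    by rewrite lerDr mulr_ge0.
  apply: gauss_chernoff => //.
  rewrite [1 - delta - 1]addrAC subrr add0r mulNr -mulrN mulr_ge0 ?(ltW delta_gt0)//.
  rewrite opprB subr_ge0 leNgt; apply/negP => h'; apply: xN; apply/mem_set => /=.
  by apply/andP; split; exact: ltW.
have mG t : vmeasurable (fun x : 'rV[R]_n => (gauss t x)%:E) by exact: vmeasurable_gauss.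
have G0 t (x : 'rV[R]_n) : (0 <= (gauss t x)%:E)%E by rewrite lee_fin gauss_ge0.
have mKG (K t : R) : vmeasurable (fun x : 'rV[R]_n => K%:E * (gauss t x)%:E)%E.
  by apply: vmeasurableM => //; exact: vmeasurable_cst.
have KG0 (K t : R) (x : 'rV[R]_n) : 0 <= K -> (0 <= K%:E * (gauss t x)%:E)%E.
  by move=> ?; rewrite mule_ge0// lee_fin.
rewrite vintD; first last.
- by move=> x; rewrite adde_ge0// KG0.
- by move=> x; rewrite lee_fin typical_gauss_ge0.
- by apply: vmeasurableD; exact: mKG.
- exact: vmeasurable_typical_gauss.
rewrite (vintD (mKG K1 (s / (1 + delta))) (mKG K2 (s / (1 - delta)))); last 2 first.
- by move=> x; exact: KG0.
- by move=> x; exact: KG0.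
rewrite (vintZ (mG (s / (1 + delta))) (G0 _)) ?lee_fin//.
rewrite (vintZ (mG (s / (1 - delta))) (G0 _)) ?lee_fin//.
rewrite IE !vint_gauss ?divr_gt0// !mule1 -!EFinD lee_fin -/K1 -/K2.
lra.
Qed.

End TypicalGauss.

Section TypicalCorrelation.
Variables (R : realType) (n : nat) (E : zmodType) (e : E -> 'rV[R]_n).
Hypothesis eB : {morph e : x y / x - y}.
Variable Q : set E.
Hypothesis Q0 : Q 0.
Hypothesis QB : forall x y, Q x -> Q y -> Q (x - y).
Variables (C : finZmodType) (rep : C -> E).
Hypothesis repB : forall c c', Q (rep (c - c') - (rep c - rep c')).
Variables (s delta : R).
Hypothesis s_gt0 : 0 < s.
Hypothesis delta_gt0 : 0 < delta.
Hypothesis delta_lt1 : delta < 1.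
Hypothesis Q_sep : forall u, Q u -> u <> 0 ->
  4 * (n%:R * (1 + delta) / (2 * s)) < sqnorm (e u).
Local Notation phi := (@typical_gauss R n s delta).

(** Two points of a ball of squared radius r have squared distance at most 4 r. *)
Lemma typical_disjoint (u : E) x : Q u -> u <> 0 -> phi x * phi (x - e u) = 0.
Proof.
move=> Qu u0; have [->|x0] := eqVneq (phi x) 0; first by rewrite mul0r.
have [->|xu0] := eqVneq (phi (x - e u)) 0; first by rewrite mulr0.
have := Q_sep Qu u0.
have h1 := typical_gauss_sqnorm x0; have h2 := typical_gauss_sqnorm xu0.
have := sqnormB_le x (x - e u); rewrite opprB addrC subrK => h3 h4.
by exfalso; move: h1 h2 h3 h4; set A := sqnorm x; set B' := sqnorm (x - _);
   set C' := sqnorm _; set D := _ / _; lra.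
Qed.

(* Translates of the shell by nonzero points of Q do not meet it, so only the
   zero shift contributes. *)
Lemma typical_coset_corr :
  (coset_corr e Q rep phi 0%R <= (typical_max n s delta)%:E)%E.
Proof.
have Qr : Q (rep 0 - 0).
  by rewrite subr0; have := repB 0 0; rewrite !subrr subr0.
pose T v := vint (fun x => (phi x * phi (x - e v))%:E).
have phi0 x : 0 <= phi x by exact: typical_gauss_ge0.
have -> : coset_corr e Q rep phi 0 = T 0.
  rewrite /coset_corr (esum_coset Q0 QB T Qr).
  rewrite (eq_esum (b := T)); last by move=> u _; rewrite add0r.
  apply: esum_single => //.
    by move=> u _; apply: vint_ge0 => x; rewrite lee_fin mulr_ge0.
  move=> u Qu u0; rewrite /T (eq_vint (g := fun=> 0%E)).
    by rewrite /vint; exact: integral0.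
  by move=> x; rewrite typical_disjoint.
have m0 : 0 <= typical_max n s delta.
  by rewrite mulr_ge0 ?expR_ge0// exprn_ge0// sqrtr_ge0.
have [I IE /andP[_ I1]] := vint_typical_gauss n s_gt0 delta_gt0 delta_lt1.
apply: (@le_trans _ _ (vint (fun x => (typical_max n s delta)%:E * (phi x)%:E)%E)).
  apply: le_vint => x; first by rewrite lee_fin mulr_ge0.
  rewrite -EFinM lee_fin mulrC (embedding0 eB) subr0 ler_wpM2r//.
  exact: typical_gauss_le_max.
rewrite vintZ ?lee_fin//; first by rewrite IE -EFinM lee_fin ler_piMr.
exact: vmeasurable_typical_gauss.
Qed.

End TypicalCorrelation.

(** * Volume and second moment of the Voronoi region *)

Section VoronoiMoments.
Variables (R : realType) (n : nat) (E : zmodType) (e : E -> 'rV[R]_n).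
Hypothesis eB : {morph e : x y / x - y}.
Hypothesis e_inj : injective e.
Hypothesis cE : countable [set: E].
Hypothesis finE : forall x rho, finite_set [set v | sqnorm (x - e v) <= rho].
Variable Q : set E.
Hypothesis Q0 : Q 0.
Hypothesis QB : forall x y, Q x -> Q y -> Q (x - y).
Variables (C : finZmodType) (rep : C -> E).
Hypothesis repB : forall c c', Q (rep (c - c') - (rep c - rep c')).
Hypothesis rep_inj : forall c c', Q (rep c - rep c') -> c = c'.
Variables (D : set 'rV[R]_n) (V' : R).
Hypothesis fD : fundamental e Q D.
Hypothesis VE : vint (fun x => (\1_D x)%:E) = V'%:E.
Variables (W : finZmodType) (enc : W -> C).
Hypothesis encB : {morph enc : x y / x - y}.
Hypothesis enc_inj : injective enc.
Local Notation k := (#|W|%:R : R).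
Local Notation SL := (code_lattice Q rep enc).
Local Notation vor := (voronoi (e @` SL)).

Let k_gt0 : 0 < k. Proof. by rewrite ltr0n; apply/card_gt0P; exists 0. Qed.

(** The weighted bounds from above and from below coincide for the weight 1: [D] has the measure of
    [k] Voronoi regions. *)
Lemma vint_voronoi : vint (fun x => (\1_vor x)%:E) = (V' / k)%:E.
Proof.
have m1 : vmeasurable (fun _ : 'rV[R]_n => 1%:E) by exact: vmeasurable_cst.
have := vint_voronoi_le eB e_inj cE finE Q0 QB repB rep_inj fD encB enc_inj
  (c := fun=> 1) m1 (fun=> ler01) m1 (fun=> lee01) (fun _ _ _ _ => lexx _).
have := vint_voronoi_ge eB cE finE Q0 QB repB rep_inj fD encB enc_inj
  (c := fun=> 1) m1 (fun=> ler01) ler01 (fun _ _ _ _ => lexx _).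
under [vint (fun x => (\1_D x)%:E * 1%:E)%E]eq_vint do rewrite mule1.
under [vint (fun x => (_ * 1)%:E)]eq_vint do rewrite mulr1.
rewrite VE => h1 h2.
have kk : (k^-1%:E * k%:E = 1)%E by rewrite -EFinM mulVf// gt_eqF.
rewrite -[LHS]mul1e -kk -muleA [V' / k]mulrC EFinM; congr (_ * _)%E.
by apply/eqP; rewrite eq_le h1 h2.
Qed.

Variables (phi : 'rV[R]_n -> R) (r T : R).
Hypothesis mphi : vmeasurable (fun x => (phi x)%:E).
Hypothesis phi0 : forall x, 0 <= phi x.
Hypothesis phi_r : forall x, phi x != 0 -> sqnorm x <= r.
Hypothesis r0 : 0 <= r.
Hypothesis T0 : 0 <= T.
Hypothesis Q_cover : forall x, exists2 u, Q u & sqnorm (x - e u) <= T.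
Let U := [set x | code_sum e Q rep phi enc x = 0%E].
Variable J : R.
Hypothesis JE : (vint (fun x => (\1_(D `&` U) x)%:E) <= J%:E)%E.

Lemma code_sum_neq0 x : code_sum e Q rep phi enc x <> 0%E ->
  exists2 v, SL v & phi (x - e v) != 0.
Proof.
move=> h; apply: contrapT => hn; apply: h.
rewrite /code_sum big1// => w _; rewrite /coset_sum esum1// => u Qu.
apply/eqP; rewrite eqe; apply: contraT => ne.
exfalso; apply: hn; exists (rep (enc w) + u) => //.
by exists w; rewrite addrC addKr.
Qed.

Lemma voronoi_sqnorm_le x v : SL v -> vor (x - e v) ->
  sqnorm (x - e v) <= r + T * \1_U x.
Proof.
move=> Sv vorx.
have le v' : SL v' -> sqnorm (x - e v) <= sqnorm (x - e v').
  move=> Sv'; have /= := vorx (e (v' - v)) (imageP _ (code_latticeB QB repB encB Sv' Sv)).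
  rewrite eB (_ : x - e v - (e v' - e v) = x - e v')//.
  by rewrite opprB addrA subrK.
rewrite indicE; have [xU|xU] := boolP (x \in U).
  have [u Qu uT] := Q_cover x.
  rewrite mulr1; apply: le_trans (le _ (sub_code_lattice QB repB encB Qu)) _.
  by apply: le_trans uT _; rewrite lerDr.
have [|v' Sv' /phi_r] := @code_sum_neq0 x; first by move/mem_set; exact/negP.
by rewrite mulr0 addr0; exact/le_trans/le.
Qed.

Lemma vint_voronoi_sqnorm_le :
  (vint (fun x => (\1_vor x * sqnorm x)%:E) <= (V' / k * r + T * J / k)%:E)%E.
Proof.
have mU : vmeasurable_set U.
  have -> : U = [set x | (code_sum e Q rep phi enc x <= 0%:E)%E].
    apply/seteqP; split => x /= h; first by rewrite h.
    by apply/eqP; rewrite eq_le h code_sum_ge0.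
  by apply: vmeasurable_set_le;
    [exact: vmeasurable_code_sum|exact: vmeasurable_cst].
pose Bd (x : 'rV[R]_n) : \bar R := (r%:E + T%:E * (\1_U x)%:E)%E.
have mB : vmeasurable Bd.
  apply: vmeasurableD; first exact: vmeasurable_cst.
  by apply: vmeasurableM; [exact: vmeasurable_cst|exact: vmeasurable_indic].
have BdE x : Bd x = (r + T * \1_U x)%:E by [].
have B0 x : (0 <= Bd x)%E by rewrite BdE lee_fin addr_ge0 ?mulr_ge0.
have hB x v : SL v -> vor (x - e v) -> ((sqnorm (x - e v))%:E <= Bd x)%E.
  by move=> Sv vx; rewrite BdE lee_fin; exact: voronoi_sqnorm_le.
have := vint_voronoi_le eB e_inj cE finE Q0 QB repB rep_inj fD encB enc_inj
  (@vmeasurable_sqnorm R n) (@sqnorm_ge0 R n) mB B0 hB.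
have [mD _ _] := fD.
have -> : vint (fun x => (\1_D x)%:E * Bd x)%E =
    (r%:E * V'%:E + T%:E * vint (fun x => (\1_(D `&` U) x)%:E))%E.
  rewrite -VE -vintZ ?lee_fin//; last exact: vmeasurable_indic.
  rewrite -vintZ ?lee_fin//; last by apply: vmeasurable_indic; exact: vmeasurable_setI.
  rewrite -vintD.
  - apply: eq_vint => x; rewrite BdE -!EFinM -EFinD.
    by rewrite indicI /=; congr (_%:E); ring.
  - by apply: vmeasurableM; [exact: vmeasurable_cst|exact: vmeasurable_indic].
  - by apply: vmeasurableM; [exact: vmeasurable_cst|apply: vmeasurable_indic; exact: vmeasurable_setI].
  - by move=> x; rewrite -EFinM lee_fin mulr_ge0.
  - by move=> x; rewrite -EFinM lee_fin mulr_ge0.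
move=> h.
have h' : (k%:E * vint (fun x => (\1_vor x * sqnorm x)%:E) <= (V' * r + T * J)%:E)%E.
  apply: le_trans h _; rewrite EFinD -EFinM [r * V']mulrC leeD2l// EFinM.
  by rewrite lee_wpmul2l// lee_fin.
have := lee_wpmul2l (_ : 0 <= k^-1%:E)%E h'; rewrite lee_fin invr_ge0 => /(_ (ltW k_gt0)).
rewrite muleA -EFinM mulVf ?gt_eqF// mul1e => /le_trans; apply.
by rewrite -EFinM lee_fin mulrDr [k^-1 * (T * J)]mulrC mulrA [k^-1 * V']mulrC.
Qed.

End VoronoiMoments.

Section SqrtPower.
Variables (R : realType) (n : nat).
Implicit Types x y : R.

Lemma sqrtr_exprnM x y : 0 <= x ->
  Num.sqrt x ^+ n * Num.sqrt y ^+ n = Num.sqrt (x * y) ^+ n.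
Proof. by move=> x0; rewrite sqrtrM// exprMn. Qed.

Lemma sqrtr_expR_exprn x : Num.sqrt (expR x) ^+ n = expR (n%:R * x / 2).
Proof. by rewrite sqrtr_expR -expRM_natl mulrA. Qed.

End SqrtPower.

Section ScaledWeight.
Variables (R : realType) (n : nat) (rho t a : R).
Hypothesis t_gt0 : 0 < t.
Hypothesis a_gt0 : 0 < a.
Local Notation s' := (t * a ^+ 2 / 2).

Lemma theta_weightZ (x : 'rV[R]_n) : theta_weight rho t (a *: x) =
  Num.sqrt (expR rho / 2 * (pi / s')) ^+ n * gauss s' x.
Proof.
have pi0 : 0 < pi :> R := pi_gt0 R.
have s0 : 0 < s' by rewrite divr_gt0// mulr_gt0// exprn_gt0.
rewrite /gauss mulrA sqrtr_exprnM; last first.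
  by rewrite ltW// mulr_gt0// divr_gt0// expR_gt0.
have -> : expR rho / 2 * (pi / s') * (s' / pi) = 2^-1 * expR rho.
  by move: (pi : R) pi0 => P P0; field; rewrite !gt_eqF.
rewrite -sqrtr_exprnM ?invr_ge0// sqrtr_expR_exprn /theta_weight.
by congr (_ * expR _); rewrite sqnormZ; field.
Qed.

Lemma le_theta_weight (t' : R) (x : 'rV[R]_n) : t <= t' ->
  theta_weight rho t' x <= theta_weight rho t x.
Proof.
move=> tt'; rewrite /theta_weight ler_wpM2l ?mulr_ge0 ?expR_ge0 ?exprn_ge0 ?sqrtr_ge0//.
by rewrite ler_expR ler_wpM2r ?sqnorm_ge0// lerN2 ler_pM2r.
Qed.

End ScaledWeight.

(** * A lattice good for both criteria, at given parameters *)

Section GoodLattice.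
Variables (R : realType) (n : nat) (E : zmodType) (e : E -> 'rV[R]_n).
Hypothesis eB : {morph e : x y / x - y}.
Hypothesis e_inj : injective e.
Hypothesis cE : countable [set: E].
Hypothesis finE : forall x rho, finite_set [set v | sqnorm (x - e v) <= rho].
Variable Q : set E.
Hypothesis Q0 : Q 0.
Hypothesis QB : forall x y, Q x -> Q y -> Q (x - y).
Variables (F : finFieldType) (N m : nat) (rep : 'cV[F]_N -> E).
Hypothesis repB : forall c c', Q (rep (c - c') - (rep c - rep c')).
Hypothesis rep_ex : forall v, exists c, Q (v - rep c).
Hypothesis rep_inj : forall c c', Q (rep c - rep c') -> c = c'.
Variables (D0 D : set 'rV[R]_n) (v0 : R).
Hypothesis fD0 : fundamental e setT D0.
Hypothesis D0r : forall u, D0 u -> sqnorm u <= n%:R.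
Hypothesis v0E : vint (fun x => (\1_D0 x)%:E) = v0%:E.
Hypothesis v0_gt0 : 0 < v0.
Hypothesis fD : fundamental e Q D.
Local Notation q := (#|'cV[F]_N|%:R : R).
Local Notation k := (#|'cV[F]_m|%:R : R).
Hypothesis VE : vint (fun x => (\1_D x)%:E) = (q * v0)%:E.
Variables (P W eps : R).
Hypothesis P_gt0 : 0 < P.
Hypothesis Q_sep : forall u, Q u -> u <> 0 -> P ^+ 2 <= sqnorm (e u).
Hypothesis Q_cover : forall x, exists2 u, Q u & sqnorm (x - e u) <= P ^+ 2 * n%:R.
Hypothesis W_gt0 : 0 < W.
Local Notation V := (q * v0 / k).
Hypothesis WV : Num.sqrt W ^+ n = V.
Hypothesis eps_gt0 : 0 < eps.
Hypothesis eps_lt1 : eps < 1.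
Local Notation delta := (eps / 2).
Local Notation c0 := (pi * expR 1 : R).
(** The quantization Gaussian has variance (1 + eps) W / (2 pi e) per coordinate, slightly above the
    ideal value. The parameter [t] belongs to the largest admissible noise variance (1 - eps) / (2
    pi e), for the lattice scaled by [a] to volume 1. *)
Let s : R := c0 / ((1 + eps) * W).
Let t : R := c0 / (1 - eps).
Let a : R := (Num.sqrt W)^-1.

(** The Chebyshev bound on the uncovered fraction of [D], weighted by the ratio of the covering
    bound n P^2 to n W. In the parentheses the first term is due to the zero word and the second to
    the other words; [I0] bounds the mass of the shell from below. *)
Definition quantization_error : R :=
  let I0 := 1 - atypical_rate (1 + delta) ^+ n - atypical_rate (1 - delta) ^+ n in
  P ^+ 2 / W * (Num.sqrt (expR delta / (1 + eps)) ^+ n / I0 ^+ 2 +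
     expR (c0 / (1 + eps) * (n%:R / W)) / I0 - 1).

(** The averaged union bound over the nonzero words. The summand k / q bounds the mean number of
    nonzero words encoded as 0. *)
Definition decoding_error : R :=
  Num.sqrt ((1 - eps) * expR delta) ^+ n *
  expR (c0 / (2 * (1 - eps)) * (n%:R / W)) + k / q.

Hypothesis I0_gt0 :
  0 < 1 - atypical_rate (1 + delta) ^+ n - atypical_rate (1 - delta) ^+ n.
Hypothesis W_sep : 2 * n%:R * (1 + delta) * (1 + eps) * W < c0 * P ^+ 2.
Hypothesis err_lt1 : quantization_error + decoding_error < 1.
Local Notation err := (quantization_error + decoding_error).

Let q_gt0 : 0 < q. Proof. by rewrite ltr0n; apply/card_gt0P; exists 0. Qed.
Let k_gt0 : 0 < k. Proof. by rewrite ltr0n; apply/card_gt0P; exists 0. Qed.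
Let c0_gt0 : 0 < c0. Proof. by rewrite mulr_gt0 ?expR_gt0// pi_gt0. Qed.
Let s_gt0 : 0 < s. Proof. by rewrite divr_gt0// mulr_gt0// addr_gt0. Qed.
Let t_gt0 : 0 < t. Proof. by rewrite divr_gt0// subr_gt0. Qed.
Let a_gt0 : 0 < a. Proof. by rewrite invr_gt0 sqrtr_gt0. Qed.
Let V_gt0 : 0 < V. Proof. by rewrite divr_gt0// mulr_gt0. Qed.
Let delta_gt0 : 0 < delta. Proof. by rewrite divr_gt0. Qed.
Let delta_lt1 : delta < 1. Proof. by move: eps_gt0 eps_lt1; lra. Qed.

Let a2 : a ^+ 2 = W^-1. Proof. by rewrite exprVn sqr_sqrtr// ltW. Qed.

Let mean_radius : n%:R * (1 + delta) / (2 * s) =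
  n%:R * W * (1 + delta) * (1 + eps) / (2 * c0).
Proof.
rewrite /s; move: (pi : R) (expR 1) c0_gt0 => p1 e1 c00.
have [p0 e0] : p1 != 0 /\ e1 != 0 by apply/andP; rewrite -negb_or -mulf_eq0 gt_eqF.
by field; rewrite p0 e0 !gt_eqF// addr_gt0.
Qed.

Let w (v : E) : R := theta_weight (1 + delta) t (a *: e v).

Let B : R := Num.sqrt (expR (1 + delta) / 2 * (pi / (t * a ^+ 2 / 2))) ^+ n *
  (expR (t * a ^+ 2 / 2 * n%:R) / v0).

Let sum_weights : (\esum_(v in [set: E]) (w v)%:E <= B%:E)%E.
Proof.
have s'0 : 0 < t * a ^+ 2 / 2 by rewrite divr_gt0// mulr_gt0// exprn_gt0.
rewrite /B EFinM; set K := (Num.sqrt _ ^+ n).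
have K0 : 0 <= K by rewrite exprn_ge0// sqrtr_ge0.
rewrite (_ : \esum_(v in _) _ = K%:E * \esum_(v in [set: E]) (gauss (t * a ^+ 2 / 2) (0 - e v))%:E)%E.
  rewrite lee_wpmul2l ?lee_fin//.
  exact: (esum_gauss_le eB cE _ _ fD0 0 s'0 D0r v0E v0_gt0).
rewrite -ge0_esumZl//; last by move=> v; rewrite lee_fin gauss_ge0.
apply: eq_esum => v _; rewrite -EFinM /w theta_weightZ//; congr (_ * _)%:E.
by rewrite sub0r /gauss sqnormN.
Qed.

Let weight_error : k / q * (B + 1) = decoding_error.
Proof.
rewrite mulrDr mulr1 /decoding_error /B; congr (_ + _).
have -> : t * a ^+ 2 / 2 * n%:R = c0 / (2 * (1 - eps)) * (n%:R / W).
  rewrite a2 /t; move: c0 c0_gt0 => c00 _.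
  by field; rewrite !gt_eqF// subr_gt0.
rewrite a2; set X := expR (c0 / _ * _).
have -> : expR (1 + delta) / 2 * (pi / (t * W^-1 / 2)) = (1 - eps) * expR delta * W.
  rewrite /t expRD; move: (pi : R) (expR 1) (expR delta) c0_gt0 => p1 e1 d1 c00.
  have [p0 e0] : p1 != 0 /\ e1 != 0 by apply/andP; rewrite -negb_or -mulf_eq0 gt_eqF.
  by field; rewrite p0 e0 !gt_eqF// subr_gt0.
rewrite -sqrtr_exprnM; last by rewrite mulr_ge0 ?expR_ge0// subr_ge0 ltW.
rewrite WV; set Y := Num.sqrt _ ^+ n.
by field; rewrite !gt_eqF.
Qed.

Let phi_error : q * v0 * typical_max n s delta / k =
  Num.sqrt (expR delta / (1 + eps)) ^+ n.
Proof.
have e1 : 0 < 1 + eps by rewrite addr_gt0.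
rewrite mulrAC -WV /typical_max mulrA sqrtr_exprnM ?(ltW W_gt0)//.
have -> : W * (s / pi) = expR 1 / (1 + eps).
  rewrite /s; move: (pi : R) (pi_gt0 R) => p1 p0.
  by field; rewrite !gt_eqF.
have -> : expR (- (n%:R * (1 - delta) / 2)) = Num.sqrt (expR (delta - 1)) ^+ n.
  by rewrite sqrtr_expR_exprn; congr expR; ring.
rewrite sqrtr_exprnM ?divr_ge0 ?expR_ge0 ?(ltW e1)//.
by rewrite mulrAC -expRD addrC subrK.
Qed.

Lemma exists_good_lattice : exists G : 'M[F]_(N, m),
  let L := e @` code_lattice Q rep (fun w : 'cV[F]_m => G *m w) in
  [/\ vint (fun x => (\1_(voronoi L) x)%:E) = V%:E,
      (vint (fun x => (\1_(voronoi L) x * sqnorm x)%:E) <=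
        (n%:R * V * W * ((1 + delta) * (1 + eps) / (2 * c0) + err))%:E)%E &
      (\sum_(c : 'cV[F]_m | G *m c != 0%R) \esum_(u in Q)
        (theta_weight (1 + delta) t (a *: e (rep (G *m c) + u)%R))%:E <= err%:E)%E].
Proof.
have [I IE /andP[I0I _]] := vint_typical_gauss n s_gt0 delta_gt0 delta_lt1.
have I0p := I0_gt0; set I0 := 1 - _ - _ in I0I I0p.
have I_gt0 : 0 < I by exact: lt_le_trans I0I.
have sep u : Q u -> u <> 0 -> 4 * (n%:R * (1 + delta) / (2 * s)) < sqnorm (e u).
  move=> Qu u0; apply: lt_le_trans (Q_sep Qu u0).
  rewrite mean_radius mulrA ltr_pdivrMr; last by rewrite mulr_gt0.
  rewrite (_ : P ^+ 2 * (2 * c0) = 2 * (c0 * P ^+ 2)); last by rewrite mulrCA [P ^+ 2 * _]mulrC.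
  rewrite (_ : 4 * _ = 2 * (2 * n%:R * (1 + delta) * (1 + eps) * W)); last by ring.
  by rewrite ltr_pM2l.
have corr := typical_coset_corr eB Q0 QB repB s_gt0 delta_gt0 delta_lt1 sep.
pose phi := @typical_gauss R n s delta.
have mphi := @vmeasurable_typical_gauss R n s delta.
have phi0 x : 0 <= phi x by exact: typical_gauss_ge0.
(* The weight for which A J <= err bounds the excess n P^2 J / k of the second moment by n V W
   err. *)
pose A := P ^+ 2 / (W * (q * v0)).
have A_gt0 : 0 < A by rewrite divr_gt0 ?exprn_gt0// !mulr_gt0.
have w0 v : 0 <= w v by exact: theta_weight_ge0.
have [G hG] := exists_good_code eB cE Q0 QB m repB rep_ex rep_inj fD0 D0r v0E v0_gt0
  fD VE mphi phi0 s_gt0 (typical_gauss_le s delta) IE I_gt0 corr w0 sum_weights (ltW A_gt0).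
exists G => L.
rewrite weight_error in hG.
set J := vint _ in hG.
pose H c := (\esum_(u in Q) (w (rep c + u)%R)%:E)%E.
have H0 c : (0 <= H c)%E by apply: esum_ge0 => u _; rewrite lee_fin.
have J0 : (0 <= J)%E by apply: vint_ge0 => x; rewrite lee_fin.
have AJ0 : (0 <= A%:E * J)%E by rewrite mule_ge0// lee_fin ltW.
have {}hG : (A%:E * J + \sum_(c | c != 0%R) (H (G *m c) + (G *m c == 0%R)%:R%:E) <= err%:E)%E.
  apply: le_trans hG _; rewrite lee_fin lerD2r /quantization_error -/I0.
  have -> : A * (q * v0) = P ^+ 2 / W.
    by rewrite /A; field; rewrite !gt_eqF.
  apply: ler_wpM2l; first by rewrite divr_ge0 ?sqr_ge0// ltW.
  rewrite lerD2r.
  rewrite lerD//; last first.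
    have -> : s * n%:R = c0 / (1 + eps) * (n%:R / W).
      rewrite /s; move: c0 => c00; field; rewrite !gt_eqF// addr_gt0//.
    by rewrite ler_wpM2l ?expR_ge0// lef_pV2.
  rewrite invfM mulrA phi_error ler_wpM2l ?exprn_ge0 ?sqrtr_ge0//.
  by rewrite lef_pV2 ?posrE ?exprn_gt0// lerXn2r ?nnegrE ?(ltW I_gt0)// (ltW I0p).
have S0 c : (0 <= H (G *m c) + (G *m c == 0%R)%:R%:E)%E.
  by rewrite adde_ge0// lee_fin.
have G_inj : injective (fun w : 'cV[F]_m => G *m w).
  move=> x y xy; apply/eqP; rewrite -subr_eq0; apply: contraT => neq.
  have : (1 <= err%:E)%E.
    apply: le_trans hG; apply: le_trans (leeDr _ AJ0).
    rewrite (bigD1 (x - y))//=; apply: le_trans (leeDl _ _); last exact: sume_ge0.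
    by rewrite mulmxBr xy subrr eqxx leeDr.
  by rewrite lee_fin leNgt err_lt1.
have encB : {morph (fun w : 'cV[F]_m => G *m w) : x y / x - y} by move=> x y; exact: mulmxBr.
split.
- exact: (vint_voronoi eB e_inj cE finE Q0 QB repB rep_inj fD VE encB G_inj).
- have AJ : (A%:E * J <= err%:E)%E.
    by apply: le_trans hG; rewrite leeDl//; exact: sume_ge0.
  have Jle : (J <= (A^-1 * err)%:E)%E.
    have := lee_wpmul2l (_ : 0 <= A^-1%:E)%E AJ; rewrite lee_fin invr_ge0 => /(_ (ltW A_gt0)).
    by rewrite muleA -EFinM mulVf ?gt_eqF// mul1e -EFinM.
  have r0 : 0 <= n%:R * (1 + delta) / (2 * s).
    have d1 : 0 <= 1 + delta by rewrite addr_ge0// ltW.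
    have s2 : 0 <= 2 * s by rewrite mulr_ge0// ltW.
    by rewrite divr_ge0// mulr_ge0.
  have T0 : 0 <= P ^+ 2 * n%:R by rewrite mulr_ge0 ?sqr_ge0.
  have := vint_voronoi_sqnorm_le eB e_inj cE finE Q0 QB repB rep_inj fD VE encB G_inj
    mphi phi0 (@typical_gauss_sqnorm R n s delta) r0 T0 Q_cover Jle.
  move=> /le_trans; apply; rewrite lee_fin mean_radius le_eqVlt; apply/orP; left; apply/eqP.
  rewrite /A; move: c0 c0_gt0 err => c00 c0p er.
  by field; rewrite !gt_eqF.
- apply: (@le_trans _ _ (\sum_(c : 'cV[F]_m | c != 0%R) (H (G *m c) + (G *m c == 0%R)%:R%:E))%E).
    rewrite big_mkcond [leRHS]big_mkcond; apply: lee_sum => c _.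
    case: ifPn => Gc; last by case: ifP.
    have -> : c != 0 by apply: contraNneq Gc => ->; rewrite mulmx0.
    by rewrite leeDl// lee_fin.
  by apply: le_trans hG; rewrite leeDr.
Qed.

End GoodLattice.

(** * Choice of the parameters *)

Section Asymptotics.
Variable R : realType.
Implicit Types (r x eps : R).

(** From y <= e^y at y = t m / 3 with t = - ln r; cubing yields the constant 27 / t^3. A cubic rate
    suffices, since the largest factor to be beaten is of order m^2. *)
Lemma exprn_le_cube r : 0 <= r < 1 -> exists2 C : R, 0 <= C &
  forall m n : nat, (0 < m <= n)%N -> r ^+ n <= C / m%:R ^+ 3.
Proof.
move=> /andP[r0 r1]; move: r0; rewrite le_eqVlt => /orP[/eqP<-|r0].
  exists 0 => // m n /andP[m0 mn]; rewrite expr0n mul0r.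
  by rewrite eqn0Ngt (leq_trans m0).
pose t := - ln r; have t0 : 0 < t by rewrite oppr_gt0 ln_lt0// r0.
exists (27 / t ^+ 3); first by rewrite divr_ge0// exprn_ge0// ltW.
move=> m n /andP[m0 mn]; have mr : 0 < m%:R :> R by rewrite ltr0n.
apply: (@le_trans _ _ (r ^+ m)); first by rewrite ler_wiXn2l// ltW.
have rE : r = expR (- t) by rewrite opprK lnK.
have h : t * m%:R / 3 <= expR (t * m%:R / 3).
  by apply: le_trans (expR_ge1Dx _); rewrite lerDr.
have h3 : (t * m%:R / 3) ^+ 3 <= expR (t * m%:R).
  rewrite [X in expR X](_ : _ = 3%:R * (t * m%:R / 3)); last by field.
  rewrite expRM_natl; apply: lerXn2r h; rewrite nnegrE ?expR_ge0//.
  by rewrite divr_ge0// mulr_ge0// ltW.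
have -> : 27 / t ^+ 3 / m%:R ^+ 3 = ((t * m%:R / 3) ^+ 3)^-1.
  by field; rewrite !gt_eqF.
have -> : r ^+ m = (expR (t * m%:R))^-1.
  by rewrite rE -expRM_natl mulrN expRN mulrC.
by rewrite lef_pV2 ?posrE ?expR_gt0// exprn_gt0// divr_gt0// mulr_gt0.
Qed.

Lemma sqrtr_rate x : x < 1 -> 0 <= Num.sqrt x < 1.
Proof. by move=> x1; rewrite sqrtr_ge0/= -[X in _ < X]sqrtr1 ltr_sqrt. Qed.

Lemma atypical_rate_lt1 r : r != 1 -> 0 <= atypical_rate r < 1.
Proof.
move=> rn1; apply: sqrtr_rate.
have h : r < expR (r - 1).
  by rewrite -[X in X < _](subrK 1) addrC expR_gt1Dx// subr_eq0.
by rewrite -opprB expRN ltr_pdivrMr ?expR_gt0// mul1r.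
Qed.

Lemma expR_lt_inv x : 0 < x < 1 -> expR x < (1 - x)^-1.
Proof.
move=> /andP[x0 x1]; rewrite -[X in expR X]opprK expRN ltf_pV2 ?posrE ?expR_gt0 ?subr_gt0//.
by rewrite expR_gt1Dx// oppr_eq0 gt_eqF.
Qed.

Lemma expR_le_inv x : x < 1 -> expR x <= (1 - x)^-1.
Proof.
move=> x1; rewrite -[X in expR X]opprK expRN lef_pV2 ?posrE ?expR_gt0 ?subr_gt0//.
exact: expR_ge1Dx.
Qed.

(** A shell of relative width eps / 2 is thin enough for a variance enlarged by 1 + eps: e^(eps/2) <
    1 / (1 - eps/2) <= 1 + eps. *)
Lemma shaping_rate eps : 0 < eps < 1 -> expR (eps / 2) / (1 + eps) < 1.
Proof.
move=> /andP[e0 e1]; rewrite ltr_pdivrMr ?addr_gt0// mul1r.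
have d : 0 < eps / 2 < 1 by lra.
apply: (lt_le_trans (expR_lt_inv d)).
rewrite -[_^-1]div1r ler_pdivrMr; last by lra.
nra.
Qed.

Lemma decoding_rate eps : 0 < eps < 1 -> (1 - eps) * expR (eps / 2) < 1.
Proof.
move=> /andP[e0 e1]; have d : 0 < eps / 2 < 1 by lra.
have h : expR (eps / 2) * (1 - eps / 2) < 1.
  by rewrite -ltr_pdivlMr ?div1r; [exact: expR_lt_inv|lra].
move: h; have := expR_gt0 (eps / 2); set X := expR _; nra.
Qed.

Local Notation c0 := (pi * expR 1 : R).

(** The first quotient contributes 2 z and the second 6 z, the bound z <= 1 / 8 keeping [I0] above 3
    / 4. *)
Lemma quantization_factor_le (z y x1 I0 : R) : 0 <= z <= 1 / 8 ->
  0 <= y <= z -> x1 <= z -> 1 - 2 * z <= I0 ->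
  y / I0 ^+ 2 + expR x1 / I0 - 1 <= 8 * z.
Proof.
move=> /andP[z0 z1] /andP[y0 yz] xz Iz.
have I34 : 3 / 4 <= I0 by lra.
have I0p : 0 < I0 by lra.
have h1 : y / I0 ^+ 2 <= 2 * z.
  rewrite ler_pdivrMr ?exprn_gt0//.
  have : 9 / 16 <= I0 ^+ 2 by nra.
  by set X := I0 ^+ 2; nra.
have h2 : expR x1 <= (1 - z)^-1.
  by apply: le_trans (expR_le_inv _); [rewrite ler_expR|lra].
have h3 : expR x1 / I0 <= 1 + 6 * z.
  rewrite ler_pdivrMr//; apply: le_trans h2 _.
  rewrite -div1r ler_pdivrMr; last by lra.
  have hI : (1 + 6 * z) * (1 - 2 * z) * (1 - z) <= (1 + 6 * z) * I0 * (1 - z).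
    apply: ler_wpM2r; first by lra.
    by apply: ler_wpM2l => //; lra.
  apply: le_trans hI; nra.
lra.
Qed.

(* With u = sqrt p and p of order m ^ 4: p ^ 2 / W = u / b is O(m ^ 2), whereas
   n / W and the n-th powers of the four rates, all less than 1, are
   O(m ^ -3). *)
Lemma good_parameters (b eps : R) : 0 < b <= 1 -> 0 < eps < 1 ->
  exists K : nat, forall (m n : nat) (u kq : R), (K <= m)%N ->
  (m <= n <= 8 * m)%N -> 16 * m%:R ^+ 2 <= u <= 64 * m%:R ^+ 2 ->
  kq <= m%:R^-1 ->
  let W := b * u ^+ 3 in
  [/\ 0 < 1 - atypical_rate (1 + eps / 2) ^+ n - atypical_rate (1 - eps / 2) ^+ n,
      2 * n%:R * (1 + eps / 2) * (1 + eps) * W < c0 * (u ^+ 2) ^+ 2,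
      n%:R * (1 + eps / 2) * (W * (1 - eps) / (2 * c0)) <= (u ^+ 2) ^+ 2 / 4 &
      atypical_rate (1 + eps / 2) ^+ n + (quantization_error n (u ^+ 2) W eps +
        (Num.sqrt ((1 - eps) * expR (eps / 2)) ^+ n *
         expR (c0 / (2 * (1 - eps)) * (n%:R / W)) + kq)) <= eps].
Proof.
move=> /andP[b0 b1] /andP[e0 e1].
have eP : 0 < eps < 1 by rewrite e0 e1.
have c00 : 0 < c0 by rewrite mulr_gt0 ?expR_gt0// pi_gt0.
have [C1 C10 r1] : exists2 C : R, 0 <= C & forall m n : nat, (0 < m <= n)%N ->
    atypical_rate (1 + eps / 2) ^+ n <= C / m%:R ^+ 3.
  by apply/exprn_le_cube/atypical_rate_lt1; rewrite neq_lt; apply/orP; right; lra.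
have [C2 C20 r2] : exists2 C : R, 0 <= C & forall m n : nat, (0 < m <= n)%N ->
    atypical_rate (1 - eps / 2) ^+ n <= C / m%:R ^+ 3.
  by apply/exprn_le_cube/atypical_rate_lt1; rewrite neq_lt; apply/orP; left; lra.
have [C3 C30 r3] : exists2 C : R, 0 <= C & forall m n : nat, (0 < m <= n)%N ->
    Num.sqrt (expR (eps / 2) / (1 + eps)) ^+ n <= C / m%:R ^+ 3.
  by apply/exprn_le_cube/sqrtr_rate/shaping_rate.
have [C4 C40 r4] : exists2 C : R, 0 <= C & forall m n : nat, (0 < m <= n)%N ->
    Num.sqrt ((1 - eps) * expR (eps / 2)) ^+ n <= C / m%:R ^+ 3.
  by apply/exprn_le_cube/sqrtr_rate/decoding_rate.
have C50 : 0 < c0 / b by rewrite divr_gt0.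
have C60 : 0 < c0 / (2 * (1 - eps)) / b by rewrite !divr_gt0// mulr_gt0// subr_gt0.
have [Z Z0 [Z1 Z2 Z3 Z4 [Z5 Z6]]] : exists2 Z : R, 0 < Z &
    [/\ C1 <= Z, C2 <= Z, C3 <= Z, C4 <= Z & c0 / b <= Z /\ c0 / (2 * (1 - eps)) / b <= Z].
  exists (C1 + C2 + C3 + C4 + c0 / b + c0 / (2 * (1 - eps)) / b); first by lra.
  by split; [lra|lra|lra|lra|split; lra].
(* X / m will bound the quantization error, as the product of u / b <= 64 m^2 / b and of 8 Z /
   m^3. *)
have [X X0 XE] : exists2 X : R, 0 < X & 64 * (8 * (Z / b)) = X.
  by have Zb := divr_gt0 Z0 b0; exists (64 * (8 * (Z / b))) => //; lra.
have T2 : 0 < (X + 3 * Z + 1) / eps by apply: divr_gt0 e0; lra.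
have T1 : 0 < 8 / c0 by rewrite divr_gt0.
(* For m > T the three bounds give z <= 1 / 8, c0 m >= 8, and a total error (X + 3 Z + 1) / m of at
   most [eps]. *)
have [T [T8 Tc Te]] : exists T, [/\ 8 * Z <= T, 8 / c0 <= T & (X + 3 * Z + 1) / eps <= T].
  exists (8 * Z + 8 / c0 + (X + 3 * Z + 1) / eps).
  by split; lra.
exists (Num.truncn T).+1 => m n u kq mK /andP[mn n8] /andP[u1 u2] kqm W.
have Tm : T < m%:R.
  by apply: lt_le_trans (truncnS_gt T) _; rewrite ler_nat.
have m0 : (0 < m)%N by exact: leq_trans mK.
have mr0 : 0 < m%:R :> R by rewrite ltr0n.
have mr1 : 1 <= m%:R :> R by rewrite ler1n.
have m2 : 0 < m%:R ^+ 2 :> R by rewrite exprn_gt0.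
have u0 : 0 < u by apply: lt_le_trans u1; rewrite mulr_gt0.
have nr : n%:R <= 8 * m%:R :> R by rewrite -natrM ler_nat.
have nr0 : 0 < n%:R :> R by rewrite ltr0n (leq_trans m0).
have W0 : 0 < W by rewrite mulr_gt0// exprn_gt0.
have m3 : 0 < m%:R ^+ 3 :> R by rewrite exprn_gt0.
have mnP : (0 < m <= n)%N by rewrite m0.
(* A common bound for the powers of the four rates and for the two exponents proportional to n /
   W. *)
pose z := Z / m%:R ^+ 3.
have z0 : 0 < z by rewrite divr_gt0.
have zm : z <= Z / m%:R.
  by rewrite ler_pM2l// lef_pV2// ler_eXnr.
have z8 : z <= 1 / 8.
  apply: le_trans zm _; rewrite ler_pdivrMr//.
  by move: Tm; lra.
have Cz (C : R) : C <= Z -> C / m%:R ^+ 3 <= z.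
  by move=> ?; rewrite ler_pM2r// invr_gt0.
have {r1} r1 : atypical_rate (1 + eps / 2) ^+ n <= z.
  by apply: le_trans (r1 _ _ mnP) (Cz _ _).
have {r2} r2 : atypical_rate (1 - eps / 2) ^+ n <= z.
  by apply: le_trans (r2 _ _ mnP) (Cz _ _).
have {r3} r3 : Num.sqrt (expR (eps / 2) / (1 + eps)) ^+ n <= z.
  by apply: le_trans (r3 _ _ mnP) (Cz _ _).
have {r4} r4 : Num.sqrt ((1 - eps) * expR (eps / 2)) ^+ n <= z.
  by apply: le_trans (r4 _ _ mnP) (Cz _ _).
have nW : n%:R / W <= (b * m%:R ^+ 3)^-1.
  rewrite ler_pdivrMr// mulrC ler_pdivlMr ?mulr_gt0// /W.
  apply: (@le_trans _ _ (8 * m%:R * (b * m%:R ^+ 3))).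
    by rewrite ler_wpM2r// ltW// mulr_gt0.
  have -> : 8 * m%:R * (b * m%:R ^+ 3) = b * (8 * (m%:R ^+ 2) ^+ 2) by ring.
  rewrite ler_pM2l//.
  have u3 : (16 * m%:R ^+ 2) ^+ 3 <= u ^+ 3.
    by apply: lerXn2r => //; rewrite nnegrE ltW// mulr_gt0.
  apply: le_trans u3.
  have : 1 <= m%:R ^+ 2 :> R by rewrite exprn_ege1.
  set M := m%:R ^+ 2 => M1; rewrite (_ : (16 * M) ^+ 3 = 4096 * M ^+ 2 * M); last by ring.
  by have := sqr_ge0 M; nra.
have x1 : c0 / (1 + eps) * (n%:R / W) <= z.
  apply: (@le_trans _ _ (c0 * (b * m%:R ^+ 3)^-1)).
    apply: ler_pM => //; first by rewrite divr_ge0 ?ltW// addr_gt0.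
      by rewrite divr_ge0// ltW.
    by rewrite ler_pdivrMr ?addr_gt0// ler_peMr ?(ltW c00)// lerDl ltW.
  by rewrite [(b * _)^-1]invfM mulrA Cz.
have x2 : c0 / (2 * (1 - eps)) * (n%:R / W) <= z.
  apply: (@le_trans _ _ (c0 / (2 * (1 - eps)) * (b * m%:R ^+ 3)^-1)).
    by rewrite ler_wpM2l// divr_ge0 ?ltW// mulr_gt0// subr_gt0.
  by rewrite [(b * _)^-1]invfM mulrA Cz.
have Iz : 1 - 2 * z <= 1 - atypical_rate (1 + eps / 2) ^+ n - atypical_rate (1 - eps / 2) ^+ n.
  lra.
have um : 64 * m%:R <= c0 * u.
  have h : 8 <= c0 * m%:R.
    by rewrite mulrC -ler_pdivrMr//; apply: le_trans Tc (ltW Tm).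
  apply: (@le_trans _ _ (c0 * (16 * m%:R ^+ 2))); last by rewrite ler_pM2l.
  have -> : c0 * (16 * m%:R ^+ 2) = 16 * m%:R * (c0 * m%:R) by ring.
  by nra.
have u30 : 0 < u ^+ 3 by rewrite exprn_gt0.
have u4 : (u ^+ 2) ^+ 2 = u ^+ 3 * u by ring.
split.
- by lra.
- have -> : 2 * n%:R * (1 + eps / 2) * (1 + eps) * W =
      2 * ((1 + eps / 2) * (1 + eps)) * (n%:R * b) * u ^+ 3 by rewrite /W; ring.
  have -> : c0 * (u ^+ 2) ^+ 2 = c0 * u * u ^+ 3 by move: c0 => c; ring.
  rewrite ltr_pM2r//; apply: lt_le_trans um.
  have nb : n%:R * b <= 8 * m%:R.
    by apply: le_trans nr; rewrite ler_piMr// ltW.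
  apply: (@le_lt_trans _ _ (2 * ((1 + eps / 2) * (1 + eps)) * (8 * m%:R))).
    by rewrite ler_wpM2l//; nra.
  have : (1 + eps / 2) * (1 + eps) < 4 by clear -e0 e1; nra.
  set Y := _ * (1 + eps); clear -mr0; nra.
- rewrite u4; have -> : n%:R * (1 + eps / 2) * (W * (1 - eps) / (2 * c0)) =
      (n%:R * b) * ((1 + eps / 2) * (1 - eps)) / (2 * c0) * u ^+ 3.
    by rewrite /W; move: c0 => c; ring.
  rewrite -[u ^+ 3 * u / 4]mulrA [u ^+ 3 * _]mulrC ler_pM2r//.
  rewrite ler_pdivrMr; last by rewrite mulr_gt0.
  have nb : n%:R * b <= 8 * m%:R.
    by apply: le_trans nr; rewrite ler_piMr// ltW.
  have nb0 : 0 <= n%:R * b by rewrite mulr_ge0// ltW.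
  have : (1 + eps / 2) * (1 - eps) <= 1 by clear -e0 e1; nra.
  have : 0 <= (1 + eps / 2) * (1 - eps) by clear -e0 e1; nra.
  move: um nb nb0; set cu := c0 * u; set Y := _ * (1 - eps); set nB := _ * b.
  have -> : u / 4 * (2 * c0) = cu / 2 by rewrite /cu; move: c0 => c; field.
  by clear => *; nra.
- have quant : quantization_error n (u ^+ 2) W eps <= X / m%:R.
    rewrite /quantization_error.
    have -> : (u ^+ 2) ^+ 2 / W = u / b by rewrite /W; field; rewrite !gt_eqF.
    apply: (@le_trans _ _ (64 * m%:R ^+ 2 / b * (8 * z))).
      apply: (@le_trans _ _ (u / b * (8 * z))).
        apply: ler_wpM2l; first by rewrite divr_ge0 ?ltW.
        apply: quantization_factor_le => //; first by rewrite ltW.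
        by rewrite exprn_ge0 ?sqrtr_ge0.
      apply: ler_wpM2r; first by rewrite mulr_ge0// ltW.
      by rewrite ler_pM2r// invr_gt0.
    by rewrite le_eqVlt; apply/orP; left; apply/eqP; rewrite -XE /z; field; rewrite !gt_eqF.
  have dec : Num.sqrt ((1 - eps) * expR (eps / 2)) ^+ n *
         expR (c0 / (2 * (1 - eps)) * (n%:R / W)) <= 2 * z.
    rewrite mulrC; apply: ler_pM => //; rewrite ?expR_ge0 ?exprn_ge0 ?sqrtr_ge0//.
    apply: le_trans (expR_le_inv _) _; first by lra.
    by move: (c0 / _ * _) x2 z8; clear => y ? ?; rewrite -[_^-1]div1r ler_pdivrMr; lra.
  have : (X + 3 * Z + 1) / m%:R <= eps.
    rewrite ler_pdivrMr// -ler_pdivrMl// [_^-1 * _]mulrC.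
    exact: le_trans Te (ltW Tm).
  rewrite (_ : _ / m%:R = X / m%:R + 3 * (Z / m%:R) + m%:R^-1); last by field; rewrite gt_eqF.
  move: r1 quant dec zm kqm; clear; set q1 := quantization_error _ _ _ _.
  set q2 := _ * expR _; set q3 := _ ^+ n => *; lra.
Qed.

End Asymptotics.

(** * Normalized volume and normalized second moment *)

Section VoronoiInvariants.
Variables (R : realType) (n : nat) (L : set 'rV[R]_n) (V W : R).
Hypothesis n_gt0 : (0 < n)%N.
Hypothesis mL : vmeasurable_set (voronoi L).
Hypothesis V_gt0 : 0 < V.
Hypothesis VE : vint (fun x => (\1_(voronoi L) x)%:E) = V%:E.
Hypothesis W_gt0 : 0 < W.
Hypothesis WV : Num.sqrt W ^+ n = V.

Lemma volume_vint (A : set 'rV[R]_n) : vmeasurable_set A ->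
  volume A = fine (vint (fun x => (\1_A x)%:E)).
Proof. by move=> mA; rewrite vint_indic. Qed.

Lemma powR_volume : V `^ (2 / n%:R) = W.
Proof.
have h := sqrtr_powR_exprn n_gt0 (ltW V_gt0).
have hW : Num.sqrt (V `^ (2 / n%:R)) = Num.sqrt W.
  by apply/eqP; rewrite -(eqrXn2 n_gt0) ?sqrtr_ge0// h WV.
have := congr1 (fun x => x ^+ 2) hW.
by rewrite /= !sqr_sqrtr ?powR_ge0// ltW.
Qed.

Lemma normalized_second_momentE (M : R) :
  vint (fun x => (\1_(voronoi L) x * sqnorm x)%:E) = M%:E ->
  normalized_second_moment L = M / (n%:R * V * W).
Proof.
move=> ME; rewrite /normalized_second_moment /normalized_volume /second_moment.
rewrite volume_vint// VE /= powR_volume.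
have -> : (\int[lebesgue_tuple R n]_(t in @tuple_row R n @^-1` voronoi L) sqnorm (tuple_row t)) = M.
  rewrite /Rintegral integral_mkcond -[RHS]/(fine M%:E) -ME; congr fine.
  apply: eq_integral => t _; rewrite /= patchE indicE.
  have -> : (t \in @tuple_row R n @^-1` voronoi L) = (tuple_row t \in voronoi L).
    by apply/idP/idP => /set_mem h; apply/mem_set.
  by case: ifP; rewrite ?mul1r ?mul0r.
by rewrite [in RHS]invfM mulrA.
Qed.

Lemma normalized_second_moment_bounds (X : R) :
  (vint (fun x => (\1_(voronoi L) x * sqnorm x)%:E) <= (n%:R * V * W * X)%:E)%E ->
  (2 * pi * expR 1)^-1 <= normalized_second_moment L <= X.
Proof.
set I := vint _ => IX.
have I0 : (0 <= I)%E.
  by apply: vint_ge0 => x; rewrite lee_fin mulr_ge0// sqnorm_ge0.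
have [M ME] : exists M : R, I = M%:E.
  exists (fine I); rewrite fineK// ge0_fin_numE//.
  exact: le_lt_trans IX (ltry _).
have nVW : 0 < n%:R * V * W by rewrite !mulr_gt0// ltr0n.
rewrite (normalized_second_momentE ME); apply/andP; split.
  rewrite ler_pdivlMr//.
  by have := second_moment_lower_bound n_gt0 mL V_gt0 VE ME; rewrite powR_volume.
by rewrite ler_pdivrMr// mulrC -lee_fin -ME.
Qed.

Lemma voronoi_scale (a : R) : 0 < a ->
  voronoi (scale_set a L) = [set x | voronoi L (a^-1 *: x + 0)].
Proof.
move=> a0; have an0 : a != 0 by rewrite gt_eqF.
have key (x y : 'rV[R]_n) : sqnorm (a^-1 *: x) <= sqnorm (a^-1 *: x - y) <->
    sqnorm x <= sqnorm (x - a *: y).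
  rewrite -[y in X in X <-> _](scalerK an0) -scalerBr !sqnormZ.
  by rewrite ler_pM2l// exprn_gt0// invr_gt0.
apply/seteqP; split => x /= h.
  by move=> y Ly; rewrite addr0; apply/key/h; exists y.
by move=> _ [y Ly <-]; apply/key; have := h y Ly; rewrite addr0.
Qed.

Lemma normalized_volume_scale : normalized_volume (scale_set (Num.sqrt W)^-1 L) = 1.
Proof.
set a := (Num.sqrt W)^-1.
have a0 : 0 < a by rewrite invr_gt0 sqrtr_gt0.
have ai0 : 0 < a^-1 by rewrite invr_gt0.
rewrite /normalized_volume voronoi_scale// volume_vint; last first.
  exact: vmeasurable_affine_set.
have h0 (x : 'rV[R]_n) : (0 <= (\1_(voronoi L) x : R)%:E)%E by rewrite lee_fin.
have := ge0_vint_affine 0 ai0 (vmeasurable_indic mL) h0.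
rewrite VE (eq_vint (g := fun x => (\1_[set x | voronoi L (a^-1 *: x + 0)] x)%:E)); last first.
  by move=> x; rewrite !indicE; congr ((nat_of_bool _)%:R%:E); apply/idP/idP => /set_mem h; apply/mem_set.
rewrite {1}/a invrK WV => /esym VI.
set I := vint _ in VI *.
have -> : I = 1%:E.
  have := congr1 (fun y => V^-1%:E * y)%E VI.
  have VV : (V^-1%:E * V%:E = 1)%E by rewrite -EFinM mulVf// gt_eqF.
  by rewrite /= [LHS]muleA VV mul1e.
by rewrite /= powR1.
Qed.

End VoronoiInvariants.

(** Both criteria at a finite tolerance. The error bound is uniform in the noise level and in the
    sent point, because the lattice is chosen before either. *)
Definition good_product_lattice (R : realType) (B : base_ring R) (eps : R) N
    (P : product_data B N) (a : R) : Prop :=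
  [/\ 0 < a,
      normalized_volume (scale_set a (product_lattice P)) = 1,
      (2 * pi * expR 1)^-1 <= normalized_second_moment (product_lattice P)
        <= (2 * pi * expR 1)^-1 + eps &
      forall eta x, 0 < eta -> eta ^+ 2 <= (1 - eps) / (2 * pi * expR 1) ->
        scale_set a (product_lattice P) x ->
        (error_probability P a eta x <= eps%:E)%E].

(** * Good codes over the residue field of a prime *)

Section PrimeFieldCodes.
Variables (R : realType) (B : base_ring R).
Local Notation d := (bdim B).
Variable beta : 'I_d -> R.
Hypothesis beta_gt0 : forall j, 0 < beta j.
Hypothesis beta_le1 : forall j, beta j <= 1.
Hypothesis embB : {morph @embed R B : x y / x - y}.
Hypothesis emb_min : forall z : B, z <> 0 -> 1 <= sqnorm (embed z).
Hypothesis emb_ex : forall x : 'rV[R]_d, exists z : B,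
  forall j, 0 <= (x - embed z) 0 j < beta j.
Hypothesis emb_un : forall (x : 'rV[R]_d) (z z' : B),
  (forall j, 0 <= (x - embed z) 0 j < beta j) ->
  (forall j, 0 <= (x - embed z') 0 j < beta j) -> z = z'.
Hypothesis countB : countable [set: B].
Hypothesis d_bounds : (0 < d <= 2)%N.
(** The normalized volume of the base ring as a lattice: 1 for Z and sqrt 3 / 2 for Z[w]. *)
Variable b : R.
Hypothesis b_bounds : 0 < b <= 1.
Hypothesis bE : Num.sqrt b ^+ d = \prod_j beta j.

Section OnePrime.
Variables (p : nat) (F : finFieldType).
Hypothesis adm : @admissible_primes R B 1 (fun=> p%:R).
Hypothesis cardF : #|F| = bnorm (p%:R : B).
Hypothesis cardFp : #|F| = (p ^ d)%N.
Hypothesis p_gt0 : (0 < p)%N.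
Variable pi' : B -> F.
Hypothesis piB : {morph pi' : x y / x - y}.
Hypothesis piM : {morph pi' : x y / x * y}.
Hypothesis pi1 : pi' 1 = 1.
Hypothesis pi_ker : forall x, pi' x = 0 <-> ring_dvd (p%:R : B) x.
Variable M : F -> B.
Hypothesis MK : forall y, pi' (M y) = y.
Hypothesis Mmin : forall y z, pi' z = y -> (bnorm (M y) <= bnorm z)%N.
Variable m : nat.
Hypothesis m_gt0 : (0 < m)%N.
Hypothesis pm : (m <= p)%N.
Local Notation N := (4 * m)%N.
Local Notation n := (N * d)%N.
Local Notation e := (@embed_vector R B N).
Local Notation u := (Num.sqrt p%:R : R).
Local Notation W := (b * u ^+ 3).
Local Notation q := (#|'cV[F]_N|%:R : R).
Local Notation k := (#|'cV[F]_m|%:R : R).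
Local Notation v0 := ((\prod_j beta j) ^+ N).
Local Notation c0 := (pi * expR 1 : R).

Let p0 : 0 < p%:R :> R. Proof. by rewrite ltr0n. Qed.
Let u_gt0 : 0 < u. Proof. by rewrite sqrtr_gt0. Qed.
Let u2 : u ^+ 2 = p%:R. Proof. by rewrite sqr_sqrtr// ltW. Qed.
Let b_gt0 : 0 < b. Proof. by case/andP: b_bounds. Qed.
Let W_gt0 : 0 < W. Proof. by rewrite mulr_gt0// exprn_gt0. Qed.
Let q_gt0 : 0 < q. Proof. by rewrite ltr0n; apply/card_gt0P; exists 0. Qed.
Let k_gt0 : 0 < k. Proof. by rewrite ltr0n; apply/card_gt0P; exists 0. Qed.
Let v0_gt0 : 0 < v0. Proof. by rewrite exprn_gt0// prodr_gt0. Qed.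

Let qE : q = p%:R ^+ n.
Proof. by rewrite card_mx muln1 cardFp -expnM natrX mulnC. Qed.

Let kE : k = p%:R ^+ (m * d).
Proof. by rewrite card_mx muln1 cardFp -expnM natrX mulnC. Qed.

Let qkE : q / k = p%:R ^+ (3 * (m * d)).
Proof.
by rewrite qE kE -mulnA [(4 * _)%N]mulSnr exprD mulfK// gt_eqF// exprn_gt0.
Qed.

(** With n = 4 m d and q / k = p^(3 m d), the power 2 / n of q / k is p^(3/2) = u^3; the box volume
    accounts for [b]. *)
Let WV : Num.sqrt W ^+ n = q * v0 / k.
Proof.
rewrite mulrAC qkE -[in RHS]u2 -[in RHS]exprM sqrtrM ?(ltW b_gt0)// exprMn.
rewrite {1}[n]mulnC exprM bE mulrC; congr (_ * _).
have -> : n = (2 * (2 * (m * d)))%N by rewrite !mulnA.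
rewrite exprM sqr_sqrtr; last by rewrite exprn_ge0// ltW.
rewrite -exprM; congr (_ ^+ _).
by rewrite mulnCA.
Qed.

Lemma code_rate : k / q <= m%:R^-1.
Proof.
have -> : k / q = (q / k)^-1 by rewrite invf_div.
rewrite qkE lef_pV2 ?posrE ?exprn_gt0 ?ltr0n// -natrX ler_nat.
apply: leq_trans pm _; rewrite -[X in (X <= _)%N]expn1 leq_pexp2l//.
by case/andP: d_bounds => dg _; rewrite !muln_gt0 m_gt0.
Qed.

Lemma exists_good_construction_A (eps : R) : 0 < eps < 1 ->
  0 < 1 - atypical_rate (1 + eps / 2) ^+ n - atypical_rate (1 - eps / 2) ^+ n ->
  2 * n%:R * (1 + eps / 2) * (1 + eps) * W < c0 * (u ^+ 2) ^+ 2 ->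
  n%:R * (1 + eps / 2) * (W * (1 - eps) / (2 * c0)) <= (u ^+ 2) ^+ 2 / 4 ->
  atypical_rate (1 + eps / 2) ^+ n + (quantization_error n (u ^+ 2) W eps +
        (Num.sqrt ((1 - eps) * expR (eps / 2)) ^+ n *
         expR (c0 / (2 * (1 - eps)) * (n%:R / W)) + k / q)) <= eps ->
  exists G : 'M[F]_(N, m),
    let P := construction_A adm cardF piB piM pi1 pi_ker MK Mmin G in
    let a := (Num.sqrt W)^-1 in
    [/\ 0 < a,
      normalized_volume (scale_set a (product_lattice P)) = 1,
      (2 * pi * expR 1)^-1 <= normalized_second_moment (product_lattice P)
        <= (1 + eps / 2) * (1 + eps) / (2 * pi * expR 1) + eps &
      forall eta x, 0 < eta -> eta ^+ 2 <= (1 - eps) / (2 * pi * expR 1) ->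
        scale_set a (product_lattice P) x ->
        (error_probability P a eta x <= eps%:E)%E].
Proof.
move=> /andP[eps0 eps1] hI hsep hball herr.
rewrite -/(decoding_error n F N m W eps) in herr.
set Q := @coarse R B N p.
set rep := @word_rep R B F M N.
have eB := embed_vectorB embB (N := N).
have e_inj := embed_vector_inj embB emb_min (N := N).
have cE := countable_vectors N countB.
have finE := finite_vector_ball beta_gt0 beta_le1 embB emb_ex emb_un countB (N := N).
have Q0 : Q 0 := @coarse0 R B N p.
have QB : forall x y, Q x -> Q y -> Q (x - y) := @coarseB R B N p.
have repB := word_repB piB pi_ker MK (N := N).
have rep_ex := word_rep_ex piB pi_ker MK (N := N).
have rep_inj := word_rep_inj piB pi_ker MK (N := N).
have fD0 := fundamental_box emb_ex emb_un N.
have v0E := vint_box beta_gt0 N.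
have fD := fundamental_coarse_box embB emb_ex emb_un N p_gt0.
have VE := vint_coarse_box beta_gt0 embB emb_ex emb_un N p_gt0.
rewrite -qE in VE.
have sep v : Q v -> v <> 0 -> (u ^+ 2) ^+ 2 <= sqnorm (e v).
  by rewrite u2; exact: sqnorm_coarse.
have cover x : exists2 v, Q v & sqnorm (x - e v) <= (u ^+ 2) ^+ 2 * n%:R.
  by rewrite u2; exact: (coarse_cover beta_le1 embB emb_ex emb_un p_gt0).
have n0 : (0 < n)%N by case/andP: d_bounds => dg _; rewrite !muln_gt0 m_gt0.
have u20 : 0 < u ^+ 2 by rewrite exprn_gt0.
set err := quantization_error _ _ _ _ + _ in herr.
have rate0 (r : R) : 0 <= atypical_rate r ^+ n by rewrite exprn_ge0// sqrtr_ge0.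
have err1 : err < 1.
  by apply: le_lt_trans eps1; apply: le_trans herr; rewrite lerDr.
have [G [vor1 vor2 vor3]] := exists_good_lattice eB e_inj cE finE Q0 QB repB rep_ex rep_inj
  fD0 (box_sqnorm beta_le1 (N := N)) v0E v0_gt0 fD VE u20 sep cover W_gt0 WV eps0 eps1 hI hsep err1.
exists G => P a.
have LE : product_lattice P = e @` code_lattice Q rep (fun w : 'cV[F]_m => G *m w).
  exact: construction_A_lattice.
rewrite -LE in vor1 vor2.
have mV : vmeasurable_set (voronoi (product_lattice P)).
  by rewrite LE; exact: (vmeasurable_voronoi e cE Q rep _).
have V0 : 0 < q * v0 / k by rewrite divr_gt0// mulr_gt0.
have a0 : 0 < a by rewrite invr_gt0 sqrtr_gt0.
have c00 : 0 < c0 by rewrite mulr_gt0 ?expR_gt0// pi_gt0.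
split => //.
- exact: normalized_volume_scale mV V0 vor1 W_gt0 WV.
- have /andP[-> le2] := normalized_second_moment_bounds n0 mV V0 vor1 W_gt0 WV vor2.
  apply: le_trans le2 _; rewrite mulrA lerD2l.
  by apply: le_trans herr; rewrite lerDr.
- move=> eta x eta0 etale Lx.
  pose rho := 1 + eps / 2.
  have rho1 : 1 < rho by rewrite ltrDl divr_gt0.
  have cQ : countable Q by exact: countable_subset.
  apply: le_trans (le_gaussian_noise eta (decoder_error_sub embB emb_min a0 Lx)) _.
  have := gaussian_noise_union_le cQ (fun w : 'cV[F]_m => G *m w != 0)
    (fun w v => a *: e (rep (G *m w) + v)) eta0 rho1.
  move=> union_le; apply: le_trans (le_trans union_le _).
    (* Even at the largest noise level, the typical radius is at most half the minimal distance of
       the scaled Lambda', so a coarse error needs atypically long noise. *)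
    apply: le_gaussian_noise => z [zl|zr]; [left|right] => //=.
    apply: le_trans zl; rewrite u2 in hball.
    have a2 : a ^+ 2 = W^-1 by rewrite exprVn sqr_sqrtr// ltW.
    have -> : (a * p%:R) ^+ 2 / 4 = W^-1 * (p%:R ^+ 2 / 4) by rewrite exprMn a2 mulrA.
    rewrite ler_pdivlMl//; apply: le_trans hball.
    have -> : n%:R * (1 + eps / 2) * (W * (1 - eps) / (2 * c0)) =
        W * (n%:R * rho * ((1 - eps) / (2 * pi * expR 1))).
      rewrite /rho -[2 * pi * expR 1]mulrA; move: (2 * c0)^-1 (Num.sqrt _) => C s; ring.
    by rewrite ler_pM2l// ler_wpM2l// mulr_ge0// ltW// (lt_trans ltr01).
  apply: (@le_trans _ _ ((atypical_rate rho ^+ n)%:E + err%:E)%E); last first.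
    by rewrite -EFinD lee_fin.
  rewrite leeD2l//; apply: le_trans vor3.
  apply: lee_sum => w _; apply: le_esum => v _; rewrite lee_fin.
  (* Every admissible noise level is compared with the largest one, for which the code was
     selected. *)
  apply: le_theta_weight.
  have eta2 : 0 < eta ^+ 2 by rewrite exprn_gt0.
  have t0 : 0 < (1 - eps) / c0 by rewrite divr_gt0// subr_gt0.
  rewrite -[X in X <= _]invf_div lef_pV2 ?posrE//; last by rewrite mulr_gt0.
  rewrite -ler_pdivlMl//; apply: le_trans etale _.
  by rewrite -[2 * pi * expR 1]mulrA invfM mulrCA.
Qed.

End OnePrime.

Definition residue_map (p : nat) (F : finFieldType) (f : B -> F) : Prop :=
  [/\ {morph f : x y / x - y}, {morph f : x y / x * y}, f 1 = 1 &
      forall x, f x = 0 <-> ring_dvd (p%:R : B) x].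

Hypothesis prime_supply : forall K : nat, exists p (F : finFieldType) (f : B -> F),
  [/\ (K <= p)%N, @admissible_primes R B 1 (fun=> p%:R), bnorm (p%:R : B) = #|F|,
      #|F| = (p ^ d)%N & residue_map p f /\ forall y, exists x, f x = y].

(** The prime is taken first and [m] is fitted to it, so arbitrarily large suitable primes are
    enough. For m > 0, sqrt p lies between 16 m^2 and 64 m^2 because m + 1 <= 2 m. *)
Lemma exists_fourth_root (p : nat) : exists m : nat,
  ((4 * m) ^ 4 <= p < (4 * m.+1) ^ 4)%N.
Proof.
have ex : exists m, ((4 * m) ^ 4 <= p)%N by exists 0.
have ub m : ((4 * m) ^ 4 <= p)%N -> (m <= p)%N.
  apply: leq_trans; apply: leq_trans (leq_pmull m (isT : 0 < 4)%N) _.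
  by case: m => // m; rewrite -[X in (X <= _)%N]expn1 leq_pexp2l.
have [m Pm mmax] := ex_maxnP ex ub.
exists m; rewrite Pm ltnNge; apply/negP => /mmax; rewrite ltnn//.
Qed.

Lemma exists_good_product_lattice (eps : R) (K : nat) : 0 < eps < 1 ->
  exists N (P : product_data B N) (a : R),
    [/\ (K <= N)%N, (0 < N)%N & good_product_lattice eps P a].
Proof.
(* As 2 pi e >= 2, the factor (1 + eps' / 2) (1 + eps') costs at most eps', and the error term
   another eps'. *)
move=> /andP[eps0 eps1]; pose eps' := eps / 2.
have e0 : 0 < eps' by rewrite divr_gt0.
have e1 : eps' < 1 by rewrite /eps'; lra.
have eP : 0 < eps' < 1 by rewrite e0 e1.
have [K0 params] := good_parameters b_bounds eP.
pose K1 := maxn (maxn K0 K) 1.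
have [p [F [f [pK adm normp cardF [[fB fM f1 fker] fsurj]]]]] := prime_supply ((4 * K1) ^ 4).
have [m /andP[m4 m5]] := exists_fourth_root p.
have K1m : (K1 <= m)%N.
  rewrite leqNgt; apply/negP => mK1; move: m5; rewrite ltnNge => /negP; apply.
  by apply: leq_trans pK; rewrite leq_exp2r// leq_mul2l.
have m0 : (0 < m)%N by apply: leq_trans K1m; rewrite leq_max orbT.
have K0m : (K0 <= m)%N by apply: leq_trans K1m; rewrite !leq_max leqnn.
have Km : (K <= m)%N by apply: leq_trans K1m; rewrite !leq_max leqnn orbT.
have mp : (m <= p)%N.
  apply: leq_trans m4; apply: leq_trans (leq_pmull m (isT : 0 < 4)%N) _.
  by rewrite -[X in (X <= _)%N]expn1 leq_pexp2l// muln_gt0.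
have p0 : (0 < p)%N by exact: leq_trans mp.
have [M [MK Mmin]] := min_energy_rep (@bnorm R B) fsurj.
have cardFn : #|F| = bnorm (p%:R : B) by rewrite normp.
pose u : R := Num.sqrt p%:R.
have u1 : 16 * m%:R ^+ 2 <= u.
  rewrite -(@ler_pXn2r _ 2)// ?nnegrE ?sqrtr_ge0 ?mulr_ge0 ?sqr_ge0// sqr_sqrtr//.
  rewrite (_ : _ ^+ 2 = ((4 * m) ^ 4)%N%:R) ?ler_nat// natrX natrM; ring.
have u2 : u <= 64 * m%:R ^+ 2.
  rewrite -(@ler_pXn2r _ 2)// ?nnegrE ?sqrtr_ge0 ?mulr_ge0 ?sqr_ge0// sqr_sqrtr//.
  rewrite (_ : _ ^+ 2 = ((8 * m) ^ 4)%N%:R); last by rewrite natrX natrM; ring.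
  rewrite ler_nat (leq_trans (ltnW m5))// leq_exp2r//.
  by rewrite -[8%N]/(4 * 2)%N -mulnA leq_mul2l/= mul2n -addnn -addn1 leq_add2l.
have nm : (m <= 4 * m * d <= 8 * m)%N.
  have /andP[d1 d2] := d_bounds; apply/andP; split.
    by rewrite (leq_trans (leq_pmull m (isT : 0 < 4)%N))// leq_pmulr.
  by rewrite -[8%N]/(4 * 2)%N -mulnA -mulnA leq_mul2l/= mulnC leq_mul2r d2 orbT.
have := params m (4 * m * d)%N u _ K0m nm _ (code_rate cardF p0 m0 mp).
rewrite u1 u2 => /(_ isT)[h1 h2 h3 h4].
have [G [g1 g2 /andP[g3 g4] g5]] := exists_good_construction_A adm cardFn cardF p0 fB fM f1 fker
  MK Mmin m0 eP h1 h2 h3 h4.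
exists (4 * m)%N, (construction_A adm cardFn fB fM f1 fker MK Mmin G), (Num.sqrt (b * u ^+ 3))^-1.
split; [by rewrite (leq_trans Km)// leq_pmull|by rewrite muln_gt0|].
have c00 : 2 <= 2 * pi * expR 1 :> R.
  have := pi_ge2 R; have := expR_ge1Dx (1 : R); move: (pi : R) (expR 1) => P E; nra.
split => //.
  rewrite g3/=; apply: le_trans g4 _; set c := 2 * pi * expR 1 in c00 *.
  have -> : (1 + eps' / 2) * (1 + eps') / c = c^-1 + (3 / 2 * eps' + eps' ^+ 2 / 2) / c.
    by field; rewrite gt_eqF// (lt_le_trans (ltr0Sn _ 1)).
  rewrite -addrA lerD2l (_ : eps = eps' + eps'); last by rewrite /eps'; field.
  rewrite addrC lerD2l ler_pdivrMr; last by rewrite (lt_le_trans (ltr0Sn _ 1)).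
  nra.
move=> eta x eta0 etale Lx; apply: le_trans (g5 _ _ eta0 _ Lx) _; last first.
  by rewrite lee_fin /eps'; lra.
apply: le_trans etale _; rewrite ler_pM2r; last by rewrite invr_gt0 (lt_le_trans (ltr0Sn _ 1)).
by rewrite /eps'; lra.
Qed.

End PrimeFieldCodes.

(** * From tolerances to a sequence *)

Section GoodSequence.
Variables (R : realType) (B : base_ring R).
Hypothesis good : forall (eps : R) (K : nat), 0 < eps < 1 ->
  exists N (P : product_data B N) (a : R),
    [/\ (K <= N)%N, (0 < N)%N & good_product_lattice eps P a].

Lemma exists_good_sequence :
  exists (N : nat -> nat) (P : forall k, product_data B (N k)),
     [/\ (forall k, (0 < N k)%N),
         N k @[k --> \oo] --> \oo,
         good_for_MSE (fun k => product_lattice (P k)) &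
         poltyrev_good P].
Proof.
(* The shift by 2 keeps the tolerance below 1 already at k = 0. *)
pose eps k : R := (k.+2%:R)^-1.
have epsP k : 0 < eps k < 1 by rewrite invr_gt0 ltr0n invf_lt1 ?ltr0n// ltr1n.
have eps_cvg : eps k @[k --> \oo] --> (0 : R).
  by have := @cvg_harmonic R; rewrite -cvg_shiftS.
have /choice[s sP] : forall k, exists s : {N & product_data B N}, exists a,
    [/\ (k <= projT1 s)%N, (0 < projT1 s)%N & good_product_lattice (eps k) (projT2 s) a].
  by move=> k; have [N [P [a aP]]] := good k (epsP k); exists (existT _ N P), a.
have /choice[a aP] := sP.
exists (fun k => projT1 (s k)), (fun k => projT2 (s k)); split.
- by move=> k; have [] := aP k.
- apply/cvgnyPge => A; near=> k.
  have [kN _ _] := aP k; apply: leq_trans kN; near: k; exact: nbhs_infty_ge.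
- apply: (@squeeze_cvgr _ _ _ _ (fun=> (2 * pi * expR 1)^-1)
     (fun k => (2 * pi * expR 1)^-1 + eps k)).
  + by near=> k; have [_ _ []] := aP k.
  + exact: cvg_cst.
  + by rewrite -[X in _ --> X]addr0; apply: cvgD => //; exact: cvg_cst.
- exists a, 1; split => //.
  + by move=> k; have [_ _ []] := aP k.
  + by move=> k; have [_ _ []] := aP k.
  + move=> eta eta0 etalt x Lx.
    have c0 : 0 < 2 * pi * expR 1 :> R by rewrite mulr_gt0 ?expR_gt0// mulr_gt0// pi_gt0.
    (* A fixed [eta] strictly below the limit is admissible for all small enough tolerances. *)
    have small : \forall k \near \oo, eps k <= 1 - eta ^+ 2 * (2 * pi * expR 1).
      by apply: (cvgr_le (0 : R)) => //; rewrite subr_gt0 -ltr_pdivlMr.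
    apply: (squeeze_cvge (f := fun=> 0%E) (h := fun k => (eps k)%:E)).
    * near=> k; have [_ _ [_ _ _ h]] := aP k.
      rewrite /error_probability measure_ge0/=; apply: h => //.
      rewrite ler_pdivlMr// lerBrDr -lerBrDl; near: k; exact: small.
    * exact: cvg_cst.
    * by apply: cvg_EFin => //; near=> k.
Unshelve. all: end_near.
Qed.

End GoodSequence.

(** * Product lattices are lattices *)

(** Balls are those of the sup norm; with radius 1 / (n + 1) the squares of the [n] coordinates sum
    to less than 1, also when n = 0. *)
Lemma separated_isolated (R : realType) n (L : set 'rV[R]_n) :
  (forall x y, L x -> L y -> x <> y -> 1 <= sqnorm (x - y)) -> L `<=` isolated L.
Proof.
move=> sep x Lx; split; first exact/mem_set.
have e0 : 0 < (n.+1%:R)^-1 :> R by rewrite invr_gt0.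
exists (ball x (n.+1%:R)^-1); first exact: nbhsx_ballx.
apply/seteqP; split => y /=; last by move=> ->; split=> //; exact: ballxx.
move=> [xy Ly]; apply: contrapT => neq.
have := sep x y Lx Ly (fun h => neq (esym h)); apply/negP; rewrite -ltNge.
apply: (@le_lt_trans _ _ (n%:R * (n.+1%:R)^-1)); last first.
  by rewrite ltr_pdivrMr// mul1r ltr_nat.
rewrite /sqnorm mulr_natl -[X in _ *+ X]card_ord -sumr_const.
apply: ler_sum => i _; rewrite !mxE -real_normK ?num_real//.
have lt_i : `|x 0 i - y 0 i| < (n.+1%:R)^-1 by case: xy => _ /(_ 0 i); rewrite -ball_normE.
apply: (@le_trans _ _ `|x 0 i - y 0 i|); last exact: ltW.
rewrite expr2 ler_piMr// ltW// (lt_le_trans lt_i)//.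
by rewrite invf_le1// ler1n.
Qed.

Section ProductLattice.
Variables (R : realType) (B : base_ring R).
Hypothesis embB : {morph @embed R B : x y / x - y}.
Hypothesis emb_min : forall z : B, z <> 0 -> 1 <= sqnorm (embed z).
Variables (N : nat) (P : product_data B N).
Local Notation e := (@embed_vector R B N).

(** The representatives are additive only modulo the modulus. Additivity applied to (c - c') + c'
    shows that the defect lies in Lambda'. *)
Lemma product_vectorsB x y :
  product_vectors P x -> product_vectors P y -> product_vectors P (x - y).
Proof.
move=> [c [cC [_ [u ->] ->]]] [c' [cC' [_ [u' ->] ->]]].
have [_ [MD _]] := mapM_iso P.
pose c'' : words P := [ffun l => c l - c' l].
have /choice[w wP] : forall i, exists z,
    map_words c i 0 - map_words c' i 0 - map_words c'' i 0 = z * modulus P.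
  move=> i; rewrite !mxE.
  have [z zP] := MD (fun l => c'' l i 0) (fun l => c' l i 0).
  exists z; rewrite -[z * _]zP.
  have -> : (fun l => c'' l i 0 + c' l i 0) = (fun l => c l i 0).
    by apply: functional_extensionality_dep => l; rewrite ffunE !mxE subrK.
  by rewrite opprD [RHS]addrA [LHS]addrAC.
exists c''; split.
  move=> l; have /imsetP[v _ vE] := cC l; have /imsetP[v' _ vE'] := cC' l.
  by apply/imsetP; exists (v - v') => //; rewrite ffunE vE vE' mulmxBr.
exists (modulus P *: (\col_i w i + u - u')); first by eexists.
apply/colP => i; have := wP i; rewrite !mxE => wi.
rewrite !mulrBr !mulrDr [modulus P * w i]mulrC -wi; ring.
Qed.

Lemma product_lattice_is_lattice : is_lattice (product_lattice P).
Proof.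
have eB := embed_vectorB embB (N := N).
have LB x y : product_lattice P x -> product_lattice P y -> product_lattice P (x - y).
  move=> [v Pv <-] [v' Pv' <-]; rewrite -eB; exists (v - v') => //.
  exact: product_vectorsB.
split => //.
  pose c0 : words P := [ffun=> 0].
  have P0 : product_lattice P (e (map_words c0 + 0)).
    exists (map_words c0 + 0) => //; exists c0; split.
      by move=> l; apply/imsetP; exists 0; rewrite ?ffunE ?mulmx0.
    by exists 0 => //; exists 0; rewrite scaler0.
  by have := LB _ _ P0 P0; rewrite subrr.
apply: separated_isolated => _ _ [v Pv <-] [v' Pv' <-] neq; rewrite -eB.
apply: (sqnorm_embed_vector_ge1 emb_min) => /eqP; rewrite subr_eq0 => /eqP vv'.
by apply: neq; rewrite vv'.
Qed.

End ProductLattice.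

(** * The integers and the Eisenstein integers *)

Section IntegerBase.
Variable R : realType.
Local Notation B := (int_base R).
Local Notation one := (fun=> 1 : R).

Lemma int_embB : {morph @embed R B : x y / x - y}.
Proof. by move=> x y; apply/rowP => j; rewrite !mxE intrB. Qed.

Lemma int_emb_min (z : B) : z <> 0 -> 1 <= sqnorm (embed z).
Proof.
move=> z0; rewrite /sqnorm big_ord1 mxE -rmorphXn/= -[1]/(1%:~R) ler_int.
by rewrite -gtz0_ge1 exprn_even_gt0//=; apply/eqP.
Qed.

Lemma int_emb_ex (x : 'rV[R]_1) : exists z : B,
  forall j, 0 <= (x - embed z) 0 j < one j.
Proof.
exists (Num.floor (x 0 0)) => j; rewrite !mxE ord1 subr_ge0 floor_le//=.
by rewrite ltrBlDl; have := floorD1_gt (x 0 0); rewrite intrD.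
Qed.

Lemma floor_interval (y : R) (z : int) : 0 <= y - z%:~R < 1 -> z = Num.floor y.
Proof.
rewrite subr_ge0 ltrBlDl => /andP[h1 h2]; apply/esym/floor_def.
by rewrite h1 intrD.
Qed.

Lemma int_emb_un (x : 'rV[R]_1) (z z' : B) :
  (forall j, 0 <= (x - embed z) 0 j < one j) ->
  (forall j, 0 <= (x - embed z') 0 j < one j) -> z = z'.
Proof.
move=> /(_ 0); rewrite !mxE => /floor_interval->.
by move=> /(_ 0); rewrite !mxE => /floor_interval->.
Qed.

Lemma int_prime_supply (K : nat) : exists p (F : finFieldType) (f : B -> F),
  [/\ (K <= p)%N, @admissible_primes R B 1 (fun=> p%:R),
      bnorm (p%:R : B) = #|F|, #|F| = (p ^ 1)%N &
      residue_map p f /\ forall y, exists x, f x = y].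
Proof.
have [p Kp pp] := prime_above K.
exists p, 'F_p, (fun z : int => z%:~R); split.
- exact: ltnW.
- split; first by move=> _; exists p => //; exact: natz.
  by move=> i j _; rewrite (ord1 i) (ord1 j).
- by rewrite card_Fp//= natz.
- by rewrite card_Fp// expn1.
- split; last by move=> y; exists (y : nat)%:Z; exact: natr_Zp.
  split; [exact: intrB|exact: intrM|by []|].
  move=> z; have := dvdz_pcharf (pchar_Fp pp) z => /esym h; split.
    by move=> /eqP; rewrite h => /dvdzP[k ->]; exists k; rewrite natz.
  by move=> [k zE]; apply/eqP; rewrite h zE natz dvdz_mull.
Qed.

Lemma exists_good_int_lattice (eps : R) (K : nat) : 0 < eps < 1 ->
  exists N (P : product_data B N) (a : R),
    [/\ (K <= N)%N, (0 < N)%N & good_product_lattice eps P a].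
Proof.
apply: (@exists_good_product_lattice R B one _ _ int_embB int_emb_min int_emb_ex
  int_emb_un _ _ 1 _ _ int_prime_supply) => //.
- exact: (countableP (T := int)).
- by rewrite ltr01 lexx.
- by rewrite sqrtr1 expr1n big1.
Qed.


End IntegerBase.

(** * Primes congruent to 2 modulo 3, and the Eisenstein integers *)

Lemma modn3_prime_factors n : (0 < n)%N ->
  (forall q, prime q -> q %| n -> q %% 3 = 1)%N -> (n %% 3 = 1)%N.
Proof.
have [k] := ubnP n; elim: k n => // k IHk n nk n0 fac.
have [n1|n1] := leqP n 1; first by rewrite (@anti_leq n 1) ?n1.
have pp := pdiv_prime n1; have pd := pdiv_dvd n.
rewrite -(divnK pd) -modnMm (fac _ pp pd) muln1 modn_mod; apply: IHk.
- exact: leq_trans (ltn_Pdiv (prime_gt1 pp) n0) nk.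
- by rewrite divn_gt0; [exact: dvdn_leq|exact: prime_gt0].
- by move=> q qp qd; apply: fac qp _; exact: dvdn_trans qd (dvdn_div pd).
Qed.

(* Some prime factor of 3 K! - 1 is 2 modulo 3, and none is at most K. *)
Lemma prime_above_mod3 (K : nat) : exists p, [/\ (K < p)%N, prime p & (p %% 3 = 2)%N].
Proof.
pose n := (3 * K`!).-1.
have Kf := fact_gt0 K.
have nE : n.+1 = (3 * K`!)%N by rewrite prednK// muln_gt0.
have n0 : (0 < n)%N by rewrite -ltnS nE; case: (K`!) Kf => // k _; rewrite mulnS.
apply: contrapT => no.
have : (n %% 3 = 1)%N.
  apply: modn3_prime_factors n0 _ => q qp qn.
  have nq : ~~ (q %| n.+1)%N.
    rewrite -addn1 dvdn_addr// dvdn1; apply/eqP => q1.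
    by move: qp; rewrite q1.
  have q3 : (q %% 3 != 0)%N.
    apply: contra nq => q3; have : (3 %| q)%N by [].
    by rewrite (dvdn_prime2 (isT : prime 3) qp) => /eqP <-; rewrite nE dvdn_mulr.
  case: (ltnP K q) => Kq.
    have : (q %% 3 < 3)%N by rewrite ltn_mod.
    have : (q %% 3 != 2)%N by apply/eqP => q2; apply: no; exists q.
    by move: q3; case: (q %% 3)%N => [|[|[|]]].
  by case/negP: nq; rewrite nE dvdn_mull// dvdn_fact// prime_gt0.
have : (n.+1 %% 3 = 0)%N by rewrite nE modnMr.
by rewrite -addn1 -modnDml => /[swap] ->.
Qed.

Section EisensteinBase.
Variable R : realType.
Local Notation B := (eisenstein_base R).
Local Notation h := (Num.sqrt 3 / 2 : R).
Local Notation beta := (fun j : 'I_2 => if j == 0 then 1 else h).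

Let h0 : 0 < h. Proof. by rewrite divr_gt0// sqrtr_gt0. Qed.
Let h2 : h ^+ 2 = 3 / 4.
Proof. by rewrite exprMn sqr_sqrtr// exprVn; congr (_ / _); rewrite -natrX. Qed.
Let h1 : h <= 1.
Proof. by rewrite -(@ler_pXn2r _ 2)// ?nnegrE ?ltW// h2 expr1n; lra. Qed.

Lemma eis_embB : {morph @embed R B : x y / x - y}.
Proof.
move=> x y; apply/rowP => j; rewrite !mxE /=.
by case: ifP => _; rewrite ?intrB; [field|ring].
Qed.

Lemma eis_emb_min (z : B) : z <> 0 -> 1 <= sqnorm (embed z).
Proof.
move=> z0; rewrite /sqnorm big_ord_recr big_ord1 /= !mxE /=.
have -> : ((eis_re z)%:~R - (eis_om z)%:~R / 2) ^+ 2 + ((eis_om z)%:~R * h) ^+ 2 =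
   (eis_re z ^+ 2 - eis_re z * eis_om z + eis_om z ^+ 2)%:~R.
  by rewrite exprMn h2 intrD intrB !rmorphXn/= intrM; field.
rewrite -[X in X <= _]/(1%:~R) ler_int -gtz0_ge1.
have : (eis_re z != 0) || (eis_om z != 0).
  apply: contraT; rewrite negb_or !negbK => /andP[/eqP a0 /eqP b0].
  by case: z0; move: a0 b0; case: z => a b /= -> ->.
move: (eis_re z) (eis_om z) => a b ab.
(* Four times the norm a^2 - a b + b^2, as a sum of squares. *)
have : 0 < (2 * a - b) ^+ 2 + 3 * b ^+ 2.
  case: (eqVneq b 0) ab => [->|b0 _]; last first.
    by rewrite ltr_wpDl ?sqr_ge0// mulr_gt0// exprn_even_gt0.
  rewrite orbF => a0; apply: ltr_wpDr => //; rewrite subr0 exprn_even_gt0//=.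
  by rewrite mulf_neq0.
nra.
Qed.

Lemma eis_emb_ex (x : 'rV[R]_2) : exists z : B,
  forall j, 0 <= (x - embed z) 0 j < beta j.
Proof.
pose om := Num.floor (x 0 1 / h).
pose re := Num.floor (x 0 0 + om%:~R / 2).
have fl (y : R) : 0 <= y - (Num.floor y)%:~R < 1.
  by rewrite subr_ge0 floor_le/= ltrBlDl; have := floorD1_gt y; rewrite intrD.
exists (Eis re om) => j; rewrite !mxE /=; case: (j =P 0) => [->|/eqP j0].
  by have := fl (x 0 0 + om%:~R / 2); rewrite opprB addrA addrAC.
have -> : j = 1 by apply/val_inj; case: j j0 => -[|[|]].
have := fl (x 0 1 / h); rewrite -/om => /andP[l1 l2].
have -> : x 0 1 - om%:~R * h = (x 0 1 / h - om%:~R) * h.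
  by rewrite mulrBl divfK// gt_eqF.
by rewrite mulr_ge0 ?(ltW h0)//= -[X in _ < X]mul1r ltr_pM2r.
Qed.

Lemma eis_emb_un (x : 'rV[R]_2) (z z' : B) :
  (forall j, 0 <= (x - embed z) 0 j < beta j) ->
  (forall j, 0 <= (x - embed z') 0 j < beta j) -> z = z'.
Proof.
case: z => a b; case: z' => a' b' H H'.
have key c d : (forall j, 0 <= (x - @embed R B (Eis c d)) 0 j < beta j) ->
    d = Num.floor (x 0 1 / h) /\ c = Num.floor (x 0 0 + d%:~R / 2).
  move=> K; split; apply: floor_interval.
    have := K 1; rewrite !mxE /=.
    have -> : x 0 1 - d%:~R * h = (x 0 1 / h - d%:~R) * h.
      by rewrite mulrBl divfK// gt_eqF.
    by rewrite -[X in _ < X]mul1r ltr_pM2r// pmulr_lge0.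
  by have := K 0; rewrite !mxE /= opprB addrA.
by have [-> ->] := key _ _ H; have [-> ->] := key _ _ H'.
Qed.

Lemma eis_natr k : (k%:R : B) = Eis k%:Z 0.
Proof.
elim: k => // k IHk; rewrite -addn1 natrD IHk.
by congr Eis; rewrite /= ?addr0// PoszD.
Qed.

Lemma eis_mul_natr (z : B) k : z * k%:R = Eis (eis_re z * k%:Z) (eis_om z * k%:Z).
Proof.
by rewrite eis_natr; congr Eis; rewrite /= !mulr0 ?subr0 ?add0r ?addr0.
Qed.

Section EisensteinResidue.
Variables (p : nat) (F : finFieldType) (w : F).
Hypothesis pp : prime p.
Hypothesis p3 : (p %% 3 = 2)%N.
Hypothesis pF : p \in [pchar F].
Hypothesis cardF : #|F| = (p ^ 2)%N.
Hypothesis w1 : w != 1.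
Hypothesis w3 : w ^+ 3 = 1.

(** Reduction modulo [p], realised by sending the generator of Z[w] to a nontrivial cube root of
    unity in a field with p^2 elements. *)
Definition eis_residue (z : B) : F := (eis_re z)%:~R + (eis_om z)%:~R * w.

Let wsq : w ^+ 2 = - 1 - w.
Proof.
have : (w - 1) * (w ^+ 2 + w + 1) = 0.
  by rewrite (_ : _ * _ = w ^+ 3 - 1); [rewrite w3 subrr|ring].
move=> /eqP; rewrite mulf_eq0 subr_eq0 (negbTE w1)/= => /eqP h.
by rewrite -[LHS]subr0 -h; ring.
Qed.

Lemma eis_residueB : {morph eis_residue : x y / x - y}.
Proof. by move=> [a b] [c d]; rewrite /eis_residue /= !intrB; ring. Qed.

Lemma eis_residueM : {morph eis_residue : x y / x * y}.
Proof.
move=> [a b] [c d]; rewrite /eis_residue /= !(intrB, intrD, intrM).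
have -> : (a%:~R + b%:~R * w) * (c%:~R + d%:~R * w) =
  a%:~R * c%:~R + (a%:~R * d%:~R + b%:~R * c%:~R) * w + b%:~R * d%:~R * w ^+ 2 by ring.
by rewrite wsq; ring.
Qed.

(* Frobenius fixes the integers and maps w to w ^ p = w ^ 2, hence
   a + b w ^ 2 vanishes together with a + b w. *)
Lemma eis_residue_eq0 z : eis_residue z = 0 ->
  (eis_re z)%:~R = 0 :> F /\ (eis_om z)%:~R = 0 :> F.
Proof.
case: z => a b; rewrite /eis_residue /= => h.
have wp : w ^+ p = w ^+ 2.
  by rewrite (divn_eq p 3) p3 exprD mulnC exprM w3 expr1n mul1r.
have hp : a%:~R + b%:~R * w ^+ 2 = 0 :> F.
  have := congr1 (pFrobenius_aut pF) h; rewrite rmorph0 => <-.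
  rewrite rmorphD rmorphM !rmorph_int; congr (_ + _ * _); exact/esym/wp.
have bw : b%:~R * (w * (w - 1)) = 0 :> F.
  by rewrite -[RHS](subrr 0) -{1}hp -h; ring.
have w0 : w != 0 by apply/eqP => w0; move/eqP: w3; rewrite w0 expr0n eq_sym oner_eq0.
have b0 : b%:~R = 0 :> F.
  by move/eqP: bw; rewrite !mulf_eq0 subr_eq0 (negbTE w0) (negbTE w1) !orbF => /eqP.
by split=> //; move: h; rewrite b0 mul0r addr0.
Qed.

Lemma eis_residue_ker z : eis_residue z = 0 <-> ring_dvd (p%:R : B) z.
Proof.
split=> [/eis_residue_eq0[]|[k ->]].
  move=> /eqP; rewrite -(dvdz_pcharf pF) => /dvdzP[a ra].
  move=> /eqP; rewrite -(dvdz_pcharf pF) => /dvdzP[b rb].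
  exists (Eis a b); rewrite eis_mul_natr /=.
  by case: z ra rb => ? ? /= -> ->.
rewrite eis_mul_natr /eis_residue /= !intrM.
have -> : (p%:Z)%:~R = 0 :> F by exact: pcharf0.
by rewrite !mulr0 mul0r addr0.
Qed.

(** Counting: the p^2 elements a + b w with 0 <= a, b < p have distinct residues. *)
Lemma eis_residue_surj y : exists x, eis_residue x = y.
Proof.
pose g (t : 'I_p * 'I_p) := eis_residue (Eis (t.1 : nat)%:Z (t.2 : nat)%:Z).
have eq_ord (i j : 'I_p) : ((i : nat)%:Z - (j : nat)%:Z)%:~R = 0 :> F -> i = j.
  move=> /eqP; rewrite -(dvdz_pcharf pF) => h; apply/val_inj => /=.
  have : (i = j %[mod p])%N.
    by apply/eqP; move: h; rewrite -eqz_mod_dvd !modz_nat eqz_nat.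
  by rewrite !modn_small.
have ginj : injective g.
  move=> [i j] [i' j'] => /eqP; rewrite -subr_eq0 /g -eis_residueB => /eqP.
  by move=> /eis_residue_eq0[/= /eq_ord -> /eq_ord ->].
have /codomP[t ->] : y \in codom g.
  apply: inj_card_onto ginj _ y.
  by rewrite card_prod !card_ord cardF mulnn.
by eexists.
Qed.

End EisensteinResidue.

Lemma eis_prime_supply (K : nat) : exists p (F : finFieldType) (f : B -> F),
  [/\ (K <= p)%N, @admissible_primes R B 1 (fun=> p%:R),
      bnorm (p%:R : B) = #|F|, #|F| = (p ^ 2)%N &
      residue_map p f /\ forall y, exists x, f x = y].
Proof.
have [p [Kp pp p3]] := prime_above_mod3 K.
have [F pF cardF] := pPrimePowerField pp (isT : 0 < 2)%N.
(* 3 divides p + 1, hence the order p^2 - 1 of the unit group, and Cauchy's theorem yields a cube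
   root of unity other than 1. *)
have [u _ ou] : {u : {unit F} | u \in [set: {unit F}]%G & #[u]%g = 3}.
  apply: Cauchy => //; rewrite card_finField_unit cardF -subn1.
  rewrite -[1%N](exp1n 2) subn_sqr dvdn_mull//.
  by rewrite /dvdn -modnDml p3.
pose w := FinRing.uval u.
have w3 : w ^+ 3 = 1.
  have := expg_order u; rewrite ou => /(congr1 (@FinRing.uval _)).
  by rewrite FinRing.val_unitX.
have w1 : w != 1.
  apply/eqP => wE; have : u = 1%g by apply/val_inj.
  by move=> uE; move: ou; rewrite uE order1.
have ker := eis_residue_ker p3 pF w1 w3.
have fM := eis_residueM w1 w3.
have f1 : eis_residue w 1 = 1 by rewrite /eis_residue /= mul0r addr0.
exists p, F, (eis_residue w); split => //.
- exact: ltnW.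
(* [p] is prime in Z[w] because its multiples are the kernel of a map to a field. *)
- split => [_|i j _|i j]; last by rewrite (ord1 i) (ord1 j) eqxx.
    split.
    + by rewrite eis_natr => -[] p0; rewrite p0 in pp.
    + move=> /ker; rewrite f1 => /eqP; rewrite oner_eq0//.
    + move=> y z /ker; rewrite fM => /eqP; rewrite mulf_eq0.
      by move=> /orP[]/eqP h; [left|right]; apply/ker.
  by rewrite (ord1 i) (ord1 j).
- by rewrite cardF eis_natr /= /eis_norm /= !mulr0 subr0 addr0 abszX.
- split; last exact: (eis_residue_surj p3 pF cardF w1 w3).
  by split => //; exact: eis_residueB.
Qed.

Lemma eis_countable : countable [set: B].
Proof.
apply/countable_injP; exists (fun z => choice.pickle (eis_pair z)) => x y _ _.
by move=> /(pcan_inj choice.pickleK)/(can_inj eis_pairK).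
Qed.

Lemma exists_good_eis_lattice (eps : R) (K : nat) : 0 < eps < 1 ->
  exists N (P : product_data B N) (a : R),
    [/\ (K <= N)%N, (0 < N)%N & good_product_lattice eps P a].
Proof.
apply: (@exists_good_product_lattice R B beta _ _ eis_embB eis_emb_min eis_emb_ex
  eis_emb_un eis_countable _ h _ _ eis_prime_supply) => //.
- by move=> j; case: ifP.
- by move=> j; case: ifP.
- by rewrite h0 h1.
- by rewrite big_ord_recr big_ord1 /= mul1r sqr_sqrtr ?(ltW h0).
Qed.

End EisensteinBase.

Theorem theorem3 (R : realType) (b : base_kind) :
  (forall (N : nat) (P : product_data (base_of R b) N),
     is_lattice (product_lattice P)) /\
  (exists (N : nat -> nat) (P : forall k, product_data (base_of R b) (N k)),
     [/\ (forall k, (0 < N k)%N),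
         N k @[k --> \oo] --> \oo,
         good_for_MSE (fun k => product_lattice (P k)) &
         poltyrev_good P]).
Proof.
split.
  case: b => N P; apply: product_lattice_is_lattice.
  - exact: int_embB.
  - exact: int_emb_min.
  - exact: eis_embB.
  - exact: eis_emb_min.
case: b; apply: exists_good_sequence.
- exact: exists_good_int_lattice.
- exact: exists_good_eis_lattice.
Qed.
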